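(* Unless $\mathsf{TC}^0 = \mathsf{NC}^1$, a graph neural network $\mathsf{GNN}(X) = \mathsf{Head}\circ\mathsf{READOUT}\circ\mathsf{GNN}_m\circ\cdots\circ\mathsf{GNN}_1(X)$ with precision $p\le\mathrm{poly}(n)$, a constant number of layers $m=O(1)$, and embedding size $d = O(n)$ cannot solve the undirected graph connectivity problem: given an undirected graph $\mathcal{G}=(\mathcal{V},\mathcal{E})$ with $n$ nodes, decide whether there is a path between every pair of nodes in $\mathcal{V}$.
   Context: A $p$-bit floating-point number (FPN) is a pair $\langle s', e\rangle$ of binary integers with $|s'| \in \{0\} \cup [2^{p-1}, 2^p)$ and $e \in [-2^p, 2^p-1]$, representing $s' \cdot 2^e$; $\mathbb{F}_p$ is the set of $p$-bit FPNs; arithmetic is exact followed by rounding to the nearest $p$-bit FPN. The GNN takes an $n$-node graph with adjacency matrix $A$ and node features $X\in\mathbb{F}_p^{n\times d}$ and outputs an element of $\mathbb{F}_p$. Each layer is $\mathsf{GNN}_i(X) = \mathsf{ReLU}(CXW_i)$, $W_i\in\mathbb{F}_p^{d\times d}$, with $C$ one of $C_{\mathrm{GCN}} = (D+I)^{-1/2}(A+I)(D+I)^{-1/2}$ ($D$ diagonal degree matrix), $C_{\mathrm{GIN}} = A+(1+\epsilon)I$, or $C_{\mathrm{GAT}} = \mathsf{Softmax}(E)$ (row-wise) with $E_{i,j} = a^\top\mathsf{LeakyReLU}(W'X_i\|W'X_j)$ if $A_{i,j}=1$ and $-\infty$ otherwise. $\mathsf{ReLU}$ is entrywise $\max\{0,\cdot\}$.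 $\mathsf{READOUT}$ is the average or coordinatewise maximum of the rows indexed by a chosen nonempty node subset $B$; $\mathsf{Head}(x) = w^\top\mathsf{ReLU}(Wx+b)$. A path is a sequence of distinct nodes in which consecutive nodes are adjacent. $\mathsf{TC}^0$: languages decided by $\mathrm{poly}(n)$-size, $O(1)$-depth circuit families with unbounded fan-in AND, OR, NOT, MAJORITY gates; $\mathsf{NC}^1$: languages decided by $\mathrm{poly}(n)$-size, $O(\log n)$-depth circuit families with bounded fan-in AND, OR, NOT gates. *)

(* Defs.v *)
From Stdlib Require Import Reals.
From mathcomp Require Import all_boot all_order all_algebra.
From mathcomp Require Import Rstruct.
Set Implicit Arguments. Unset Strict Implicit. Unset Printing Implicit Defensive.
Import Order.TTheory GRing.Theory Num.Theory.
Local Open Scope ring_scope.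

Inductive gate_kind := GAnd | GOr | GNot | GMaj.

(* A gate: its kind and the list of wires feeding it.  In a circuit with
   [k] inputs, wires 0..k-1 are the input bits and wire k+j is the output of
   gate number j; gate j may only read wires < k+j (topological order).
   The circuit output is the last gate. *)
Record gate := Gate { gkind : gate_kind; gins : seq nat }.
Definition circuit := seq gate.

Definition gate_eval (g : gate) (vals : seq bool) : bool :=
  let xs := [seq nth false vals i | i <- gins g] in
  match gkind g with
  | GAnd => all id xs
  | GOr => has id xs
  | GNot => ~~ head false xs
  | GMaj => (size xs < 2 * count id xs)%N
  end.

Definition wire_vals (c : circuit) (w : seq bool) : seq bool :=
  foldl (fun vals g => rcons vals (gate_eval g vals)) w c.

Definition circ_eval (c : circuit) (w : seq bool) : bool := last false (wire_vals c w).

Definition circ_wf (k : nat) (c : circuit) : Prop :=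
  (0 < size c)%N /\
  forall j, (j < size c)%N ->
    let g := nth (Gate GAnd [::]) c j in
    all (fun i => i < k + j)%N (gins g) /\ (gkind g = GNot -> size (gins g) = 1%N).

Definition wire_depths (k : nat) (c : circuit) : seq nat :=
  foldl (fun ds g => rcons ds (1 + foldr maxn 0 [seq nth 0 ds i | i <- gins g]))%N
        (nseq k 0%N) c.

Definition circ_depth (k : nat) (c : circuit) : nat := foldr maxn 0%N (wire_depths k c).

Definition circ_size (c : circuit) : nat := \sum_(g <- c) (1 + size (gins g))%N.

Definition language := seq bool -> bool.

Definition decides (C : nat -> circuit) (L : language) : Prop :=
  forall w : seq bool, circ_eval (C (size w)) w = L w.

Definition TC0 (L : language) : Prop :=
  exists (C : nat -> circuit) (c k D : nat),
    (forall n, circ_wf n (C n) /\ (circ_size (C n) <= c * n ^ k + c)%N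
               /\ (circ_depth n (C n) <= D)%N) /\ decides C L.

Definition NC1 (L : language) : Prop :=
  exists (C : nat -> circuit) (c k : nat),
    (forall n, circ_wf n (C n) /\ (circ_size (C n) <= c * n ^ k + c)%N
               /\ (circ_depth n (C n) <= c * trunc_log 2 n + c)%N
               /\ all (fun g => (if gkind g is GMaj then false else true) && (size (gins g) <= 2)%N) (C n))
    /\ decides C L.

Definition TC0_eq_NC1 : Prop := forall L : language, TC0 L <-> NC1 L.

Definition R := Rdefinitions.R.

Definition fpn_val (se : int * int) : R := (se.1)%:~R * (2 : R) ^ se.2.

Definition is_fpn_pair (p : nat) (se : int * int) : bool :=
  ((`|se.1|%N == 0%N) || ((2 ^ p.-1 <= `|se.1|)%N && (`|se.1| < 2 ^ p)%N)) &&
  ((- (2 ^ p)%:Z <= se.2) && (se.2 <= (2 ^ p)%:Z - 1)).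

Definition is_fpn (p : nat) (x : R) : Prop :=
  exists se : int * int, is_fpn_pair p se /\ x = fpn_val se.

Definition sig_range (p : nat) : seq int :=
  0 :: [seq (Posz i) | i <- iota (2 ^ p.-1) (2 ^ p - 2 ^ p.-1)]
    ++ [seq (- Posz i) | i <- iota (2 ^ p.-1) (2 ^ p - 2 ^ p.-1)].
Definition exp_range (p : nat) : seq int :=
  [seq (Posz i - Posz (2 ^ p)) | i <- iota 0 (2 ^ p.+1)].
Definition fpn_list (p : nat) : seq (int * int) :=
  [seq (s, e) | s <- sig_range p, e <- exp_range p].

(* candidate [a] is preferred to [b] for rounding [x]: strictly closer, or
   equally close with even significand while [b]'s is odd (ties-to-even) *)
Definition rnd_better (x : R) (a b : int * int) : bool :=
  let da := `|x - fpn_val a| in let db := `|x - fpn_val b| in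
  (da < db) || ((da == db) && ~~ odd `|a.1|%N && odd `|b.1|%N).

Definition rnd (p : nat) (x : R) : R :=
  fpn_val (foldl (fun best c => if rnd_better x c best then c else best)
                 (0, 0) (fpn_list p)).

Definition fadd p (x y : R) : R := rnd p (x + y).
Definition fmul p (x y : R) : R := rnd p (x * y).
Definition fdiv p (x y : R) : R := rnd p (x / y).
Definition fsqrt p (x : R) : R := rnd p (R_sqrt.sqrt x).
Definition fexp p (x : R) : R := rnd p (Rtrigo_def.exp x).
Definition fsum p (n : nat) (f : nat -> R) : R := rnd p (\sum_(i < n) f i).

Definition relu (x : R) : R := Num.max 0 x.

(* matrices are functions nat -> nat -> R (only indices below the stated
   dimensions matter); floating-point product with inner dimension k:
   (A B)_{ij} = rnd (sum_l rnd (A_il B_lj)) *)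
Definition mat := nat -> nat -> R.
Definition fmm p (k : nat) (A B : mat) : mat :=
  fun i j => fsum p k (fun l => fmul p (A i l) (B l j)).

Definition graph := nat -> nat -> bool.
Definition undirected (n : nat) (A : graph) : Prop :=
  forall i j, (i < n)%N -> (j < n)%N -> A i j = A j i /\ A i i = false.

Definition connected (n : nat) (A : graph) : Prop :=
  forall u v, (u < n)%N -> (v < n)%N ->
    exists s : seq nat, all (fun x => x < n)%N s /\ path A u s /\
                        last u s = v /\ uniq (u :: s).

Inductive agg_kind := AggGCN | AggGIN | AggGAT.

Record layer := Layer {
  l_agg : agg_kind;
  l_W : mat;
  l_eps : R;
  l_att : nat -> R;
  l_attW : mat;
  l_slope : R
}.

Record GNN := MkGNN {
  g_prec : nat;
  g_dim : nat;
  g_feat : mat;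
  g_layers : seq layer;
  g_readmax : bool;    (* READOUT: true = coordinatewise max, false = average *)
  g_B : nat -> bool;
  g_headW : mat;
  g_headb : nat -> R;
  g_headw : nat -> R
}.

Section Eval.
Variables (p n d : nat) (A : graph).

Definition indic (b : bool) : R := if b then 1 else 0.

(* C_GCN = (D+I)^{-1/2} (A+I) (D+I)^{-1/2} *)
Definition C_GCN : mat :=
  let degI i := fadd p (fsum p n (fun j => indic (A i j))) 1 in
  let Dm : mat := fun i j => if i == j then fdiv p 1 (fsqrt p (degI i)) else 0 in
  let AI : mat := fun i j => if i == j then fadd p (indic (A i j)) 1 else indic (A i j) in
  fmm p n (fmm p n Dm AI) Dm.

Definition C_GIN (eps : R) : mat :=
  fun i j => if i == j then fadd p (indic (A i j)) (fadd p 1 eps) else indic (A i j).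

Definition leaky (slope x : R) : R := if 0 <= x then x else fmul p slope x.

(* C_GAT = Softmax(E), E_ij = a^T LeakyReLU(W'X_i || W'X_j) if A_ij, else -oo *)
Definition C_GAT (a : nat -> R) (W' : mat) (slope : R) (X : mat) : mat :=
  let Z : mat := fun i k => fsum p d (fun l => fmul p (W' k l) (X i l)) in
  let v i j k := if (k < d)%N then leaky slope (Z i k) else leaky slope (Z j (k - d)%N) in
  let E i j := fsum p (2 * d) (fun k => fmul p (a k) (v i j k)) in
  let den i := fsum p n (fun k => if A i k then fexp p (E i k) else 0) in
  fun i j => if A i j then fdiv p (fexp p (E i j)) (den i) else 0.

Definition agg_matrix (L : layer) (X : mat) : mat :=
  match l_agg L with
  | AggGCN => C_GCN
  | AggGIN => C_GIN (l_eps L)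
  | AggGAT => C_GAT (l_att L) (l_attW L) (l_slope L) X
  end.

Definition layer_apply (L : layer) (X : mat) : mat :=
  fun i j => relu (fmm p d (fmm p n (agg_matrix L X) X) (l_W L) i j).

Definition readout (maxr : bool) (B : nat -> bool) (H : mat) : nat -> R :=
  fun j =>
    let vs := [seq H i j | i <- [seq i <- iota 0 n | B i]] in
    if maxr then foldl Num.max (head 0 vs) (behead vs)
    else fdiv p (rnd p (\sum_(x <- vs) x)) (rnd p (size vs)%:R).

Definition head_apply (W : mat) (b w : nat -> R) (x : nat -> R) : R :=
  let h k := relu (fadd p (fsum p d (fun l => fmul p (W k l) (x l))) (b k)) in
  fsum p d (fun k => fmul p (w k) (h k)).

End Eval.

Definition gnn_output (n : nat) (G : GNN) (A : graph) : R :=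
  let p := g_prec G in let d := g_dim G in
  let H := foldl (fun X L => layer_apply p n d A L X) (g_feat G) (g_layers G) in
  head_apply p d (g_headW G) (g_headb G) (g_headw G)
             (readout p n (g_readmax G) (g_B G) H).

Definition gnn_valid (n : nat) (G : GNN) : Prop :=
  let p := g_prec G in let d := g_dim G in
  (forall i j, (i < n)%N -> (j < d)%N -> is_fpn p (g_feat G i j)) /\
  (forall L, List.In L (g_layers G) ->
     (forall i j, (i < d)%N -> (j < d)%N ->
        is_fpn p (l_W L i j) /\ is_fpn p (l_attW L i j)) /\
     (forall k, (k < 2 * d)%N -> is_fpn p (l_att L k)) /\
     is_fpn p (l_eps L) /\ is_fpn p (l_slope L)) /\
  (forall i j, (i < d)%N -> (j < d)%N -> is_fpn p (g_headW G i j)) /\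
  (forall k, (k < d)%N -> is_fpn p (g_headb G k) /\ is_fpn p (g_headw G k)) /\
  (exists i, (i < n)%N && g_B G i) /\ (forall i, g_B G i -> (i < n)%N).

Definition solves_connectivity (G : nat -> GNN) : Prop :=
  forall n, (0 < n)%N -> forall A : graph, undirected n A ->
    (0 < gnn_output n (G n) A <-> connected n A).

(* Main.v *)
From Stdlib Require Import ClassicalEpsilon.
Require Import Defs.
From mathcomp Require Import all_boot all_order all_algebra.
From mathcomp Require Import all_fingroup Rstruct ring lra zify.
Set Implicit Arguments. Unset Strict Implicit. Unset Printing Implicit Defensive.
Import Order.TTheory GRing.Theory Num.Theory.

(* If such networks existed, every language in NC1 would be in TC0; the converse inclusion
   TC0 <= NC1 holds unconditionally (majority by carry-save addition).

   An NC1 language is given by formulas of logarithmic depth.  Such a formula is turned into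
   a graph of polynomial size whose edges are labelled by literals and whose potential degree
   is at most 3: it is connected iff the formula is true.  On these graphs the features of a
   node after boundedly many layers depend on boundedly many input bits, so the layers, with
   their exponentials, square roots and quotients, are mere lookup tables.

   What remains are the readout and the head.  They are evaluated in TC0 on real numbers
   written as sums of constants [s 2^e] selected by bits, where [e] may be exponentially
   large.  Such sums are closed under rounding.  Indeed a real threshold function has integer
   weights at most T! (a vertex of the polyhedron of realizing weights, by Cramer's rule), so
   it is in TC0; the parity of the integer part of a sum of selected constants is the parity
   of the selected integer parts plus the carry out of the fractional parts, which is counted
   by thresholds; and the leading exponent of such a sum lies in a set of polynomially many
   candidates. *)

(** Both classes are non-uniform, and so is the family of networks: whatever depends only on the
    input length and on the network may be hardwired without being computed. Two obstacles shape the
    argument. Simulating the layers on arbitrary graphs would mean evaluating exponentials and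
    square roots at polynomial precision; only the instances produced by the reduction have to be
    simulated, so these are chosen so that each node sees boundedly many input bits. For this the
    degree counts potential edges, present or not: the bits seen by a node then do not vary with the
    input. The readout and the head still combine unboundedly many numbers. Their exponents reach
    [2 ^ p] with [p] polynomial, so positional notation would take exponentially many bits. In a sum
    of selected constants an exponent is never carried by wires; it occurs only in the constants,
    and these enter the circuits through thresholds and parities alone, whose cost does not depend
    on their magnitude. *)

Definition poly_bounded (f : nat -> nat) := exists k, forall n, f n <= (n + 2) ^ k.

Lemma poly_bounded_le f g : (forall n, f n <= g n) -> poly_bounded g -> poly_bounded f.
Proof. by move=> fg [k gk]; exists k => n; apply: leq_trans (fg n) (gk n). Qed.

Lemma poly_bounded_const c : poly_bounded (fun _ => c).
Proof.
exists c => n; apply: leq_trans (ltnW (ltn_expl c (ltnSn 1))) _.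
by case: c => // c; rewrite leq_exp2r // addn2.
Qed.

Lemma poly_bounded_id : poly_bounded (fun n => n).
Proof. by exists 1 => n; rewrite expn1 leq_addr. Qed.

Lemma poly_bounded_mul f g : poly_bounded f -> poly_bounded g -> poly_bounded (fun n => f n * g n).
Proof. by move=> [a fa] [b gb]; exists (a + b) => n; rewrite expnD leq_mul. Qed.

Lemma poly_bounded_add f g : poly_bounded f -> poly_bounded g -> poly_bounded (fun n => f n + g n).
Proof.
move=> [a fa] [b gb]; exists (a + b).+1 => n.
have a0 : 0 < (n + 2) ^ a by rewrite expn_gt0 addn2.
have b0 : 0 < (n + 2) ^ b by rewrite expn_gt0 addn2.
apply: leq_trans (leq_add (fa n) (gb n)) _.
rewrite expnS expnD; nia.
Qed.

Lemma poly_bounded_succ f : poly_bounded f -> poly_bounded (fun n => (f n).+1).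
Proof. by move=> pf; apply: (poly_bounded_le (g := fun n => f n + 1)) => [n|]; [rewrite addn1|apply/poly_bounded_add/poly_bounded_const]. Qed.

Lemma poly_bounded_exp f k : poly_bounded f -> poly_bounded (fun n => f n ^ k).
Proof.
by move=> [a fa]; exists (a * k) => n; rewrite expnM; case: k => [|k] //; rewrite leq_exp2r.
Qed.

(** The base [n + 2] is at least 2, so one exponent absorbs constants and the form composes well;
    the two-constant form is the one in [TC0] and [NC1]. *)
Lemma poly_boundedP f : poly_bounded f <-> exists c k, forall n, f n <= c * n ^ k + c.
Proof.
split=> [[k fk]|[c [k fk]]].
  exists (3 ^ k), k => n; apply: leq_trans (fk n) _.
  case: n => [|n]; first by apply: leq_trans (leq_addl _ _); case: k {fk} => // k; rewrite leq_exp2r.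
  apply: leq_trans (leq_addr _ _); rewrite -expnMn.
  by case: k {fk} => // k; rewrite leq_exp2r //; lia.
apply: (poly_bounded_le (g := fun n => c * n ^ k + c)) => //.
by apply/poly_bounded_add/poly_bounded_const/poly_bounded_mul/poly_bounded_exp/poly_bounded_id/poly_bounded_const.
Qed.

Ltac poly_bounded_tac := repeat first
  [ eassumption | apply: poly_bounded_const | apply: poly_bounded_id | apply: poly_bounded_add | apply: poly_bounded_mul
  | apply: poly_bounded_succ | apply: poly_bounded_exp ].

(** * Extending circuits *)

Section RconsFold.
Variables (T : Type) (x0 : T) (F : seq T -> gate -> T).
(** Wire values and wire depths are both folds of this shape, whose earlier entries never change. *)
Let acc (a : seq T) (c : circuit) := foldl (fun l g => rcons l (F l g)) a c.

Lemma size_acc a c : size (acc a c) = size a + size c.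
Proof.
by elim: c a => [|g c IH] a /=; rewrite ?addn0 // IH size_rcons addnS addSn.
Qed.

Lemma nth_acc a c i : i < size a -> nth x0 (acc a c) i = nth x0 a i.
Proof.
elim: c a => [|g c IH] a //= ia.
by rewrite IH ?nth_rcons ?ia // size_rcons ltnW.
Qed.
End RconsFold.

Lemma size_wire_vals c w : size (wire_vals c w) = size w + size c.
Proof. exact: (size_acc (fun l g => gate_eval g l)). Qed.

Lemma nth_wire_vals_cat c c' w i : i < size w + size c ->
  nth false (wire_vals (c ++ c') w) i = nth false (wire_vals c w) i.
Proof.
move=> ic; rewrite /wire_vals foldl_cat.
by rewrite (nth_acc _ (fun l g => gate_eval g l)) // size_wire_vals.
Qed.

Lemma wire_vals_rcons c g w :
  wire_vals (rcons c g) w = rcons (wire_vals c w) (gate_eval g (wire_vals c w)).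
Proof. by rewrite /wire_vals foldl_rcons. Qed.

Definition gate_depth (ds : seq nat) (g : gate) :=
  1 + foldr maxn 0 [seq nth 0 ds i | i <- gins g].

Lemma size_wire_depths n c : size (wire_depths n c) = n + size c.
Proof. by rewrite (size_acc gate_depth) size_nseq. Qed.

Lemma nth_wire_depths_cat n c c' i : i < n + size c ->
  nth 0 (wire_depths n (c ++ c')) i = nth 0 (wire_depths n c) i.
Proof.
move=> ic; rewrite /wire_depths foldl_cat.
by rewrite (nth_acc _ gate_depth) // size_wire_depths.
Qed.

Lemma wire_depths_rcons n c g :
  wire_depths n (rcons c g) = rcons (wire_depths n c) (gate_depth (wire_depths n c) g).
Proof. by rewrite /wire_depths foldl_rcons. Qed.

Lemma foldr_maxn_rcons s x : foldr maxn 0 (rcons s x) = maxn (foldr maxn 0 s) x.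
Proof. by elim: s => [|y s IH] /=; rewrite ?maxn0 ?max0n // IH maxnA. Qed.

Lemma foldr_maxn_leP s d : reflect (forall x, x \in s -> x <= d) (foldr maxn 0 s <= d).
Proof.
apply: (iffP idP) => [|H].
  elim: s => [|y s IH] //=; rewrite geq_max => /andP[yd sd] x.
  by rewrite inE => /orP[/eqP->//|/(IH sd)].
elim: s H => [|y s IH] //= H; rewrite geq_max H ?mem_head //=.
by apply: IH => x xs; apply: H; rewrite inE xs orbT.
Qed.

Lemma circ_depth_rcons n c g :
  circ_depth n (rcons c g) = maxn (circ_depth n c) (gate_depth (wire_depths n c) g).
Proof. by rewrite /circ_depth wire_depths_rcons foldr_maxn_rcons. Qed.

Definition gate0 := Gate GAnd [::].

(** [circ_wf] without nonemptiness, so that constructions can start from the empty circuit. *)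
Definition wf_prefix n (c : circuit) := forall j, j < size c ->
  let g := nth gate0 c j in
  all (fun i => i < n + j) (gins g) /\ (gkind g = GNot -> size (gins g) = 1).

Lemma wf_prefix_rcons n c g : wf_prefix n c ->
  all (fun i => i < n + size c) (gins g) ->
  (gkind g = GNot -> size (gins g) = 1) -> wf_prefix n (rcons c g).
Proof.
move=> wc ag ng j; rewrite size_rcons ltnS leq_eqVlt nth_rcons => /predU1P[->|jc].
  by rewrite ltnn eqxx.
by rewrite jc; apply: wc.
Qed.

Definition gate_op (k : gate_kind) (xs : seq bool) : bool :=
  match k with
  | GAnd => all id xs
  | GOr => has id xs
  | GNot => ~~ head false xs
  | GMaj => size xs < 2 * count id xs
  end.

Lemma gate_evalE g vals :
  gate_eval g vals = gate_op (gkind g) [seq nth false vals i | i <- gins g].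
Proof. by []. Qed.

Definition computes n (c : circuit) d i (f : seq bool -> bool) :=
  [/\ i < n + size c, nth 0 (wire_depths n c) i <= d &
      forall w, size w = n -> nth false (wire_vals c w) i = f w].

Lemma computes_cat n c c' d i f : computes n c d i f -> computes n (c ++ c') d i f.
Proof.
move=> [ic di fi]; split=> [||w sw].
- by rewrite size_cat addnA ltn_addr.
- by rewrite nth_wire_depths_cat.
- by rewrite nth_wire_vals_cat ?sw // fi.
Qed.

(* Stating computability relative to an arbitrary prefix makes gates composable
   without renumbering wires. *)
Definition computable (Q : pred gate) n d z (f : seq bool -> bool) :=
  forall c, wf_prefix n c -> exists c', [/\ all Q c', wf_prefix n (c ++ c'),
    circ_size c' <= z, circ_depth n (c ++ c') <= maxn (circ_depth n c) d &
    exists i, computes n (c ++ c') d i f].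

Lemma computable_le (Q : pred gate) n d d' z z' f : d <= d' -> z <= z' -> computable Q n d z f -> computable Q n d' z' f.
Proof.
move=> dd zz E c wc; have [c' [Qc wc' sz dc [i [ic di fi]]]] := E c wc.
exists c'; split=> //; first exact: leq_trans zz.
  by apply: leq_trans dc _; rewrite geq_max leq_maxl leq_max dd orbT.
by exists i; split=> //; apply: leq_trans dd.
Qed.

Lemma eq_computable (Q : pred gate) n d z f g : (forall w, size w = n -> f w = g w) ->
  computable Q n d z f -> computable Q n d z g.
Proof.
move=> fg E c wc; have [c' [Qc wc' sz dc [i [ic di fi]]]] := E c wc.
by exists c'; split=> //; exists i; split=> // w sw; rewrite fi ?fg.
Qed.

Lemma circ_size_cat c c' : circ_size (c ++ c') = circ_size c + circ_size c'.
Proof. by rewrite /circ_size big_cat. Qed.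

(** Appending the blocks one after another adds sizes but only takes the maximum of depths, since
    depth is tracked wire by wire. *)
Lemma computable_seq (Q : pred gate) n d z (I : eqType) (r : seq I) (F : I -> seq bool -> bool) :
  (forall i, i \in r -> computable Q n d z (F i)) ->
  forall c, wf_prefix n c -> exists c', [/\ all Q c', wf_prefix n (c ++ c'),
    circ_size c' <= size r * z, circ_depth n (c ++ c') <= maxn (circ_depth n c) d &
    exists js : seq nat, [/\ size js = size r, all (fun j => j < n + size (c ++ c')) js,
      all (fun j => nth 0 (wire_depths n (c ++ c')) j <= d) js &
      forall w, size w = n ->
        [seq nth false (wire_vals (c ++ c') w) j | j <- js] = [seq F i w | i <- r]]].
Proof.
elim: r => [|x r IH] H c wc.
  exists [::]; rewrite cats0; split=> //; first by rewrite /circ_size big_nil.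
    exact: leq_maxl.
  by exists [::]; split.
have [c1 [Q1 w1 s1 d1 [i ci]]] := H x (mem_head _ _) c wc.
have [|c2 [Q2 w2 s2 d2 [js [sj j1 j2 j3]]]] := IH _ (c ++ c1) w1.
  by move=> i' i'r; apply: H; rewrite inE i'r orbT.
rewrite -catA in w2 d2 j1 j2 j3.
have [ci1 ci2 ci3] := computes_cat c2 ci; rewrite -catA in ci1 ci2 ci3.
exists (c1 ++ c2); split=> //.
- by rewrite all_cat Q1.
- by rewrite circ_size_cat mulSn leq_add.
- by apply: leq_trans d2 _; rewrite geq_max d1 leq_maxr.
exists (i :: js); split=> /=; rewrite ?sj ?ci1 ?ci2 //.
by move=> w sw; rewrite ci3 // j3.
Qed.

(** The predicate [Q] on gates lets one construction serve both threshold circuits ([predT]) and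
    circuits of fan-in 2 ([nc_gate]). *)
Lemma computable_gate (Q : pred gate) n d z k (I : eqType) (r : seq I) (F : I -> seq bool -> bool) :
  (forall js, size js = size r -> Q (Gate k js)) -> (k = GNot -> size r = 1) ->
  (forall i, i \in r -> computable Q n d z (F i)) ->
  computable Q n d.+1 (size r * z + (size r).+1) (fun w => gate_op k [seq F i w | i <- r]).
Proof.
move=> Qg kr H c wc; have [c' [Qc w' sz dc [js [sj j1 j2 j3]]]] := computable_seq H wc.
have dg : gate_depth (wire_depths n (c ++ c')) (Gate k js) <= d.+1.
  rewrite /gate_depth add1n ltnS; apply/foldr_maxn_leP => x /mapP[j jj ->].
  by move/allP: j2; apply.
exists (rcons c' (Gate k js)); rewrite -rcons_cat; split.
- by rewrite all_rcons Qg.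
- by apply: wf_prefix_rcons => // /kr; rewrite sj.
- by rewrite -cats1 circ_size_cat leq_add // /circ_size big_seq1 /= sj.
- rewrite circ_depth_rcons geq_max; apply/andP; split; last by rewrite leq_max dg orbT.
  by apply: leq_trans dc _; rewrite geq_max leq_maxl leq_max leqnSn orbT.
exists (n + size (c ++ c')); split.
- by rewrite size_rcons addnS.
- by rewrite wire_depths_rcons nth_rcons size_wire_depths ltnn eqxx.
move=> w sw; rewrite wire_vals_rcons nth_rcons size_wire_vals sw ltnn eqxx.
by rewrite gate_evalE /= j3.
Qed.

Lemma computable_in (Q : pred gate) n i : i < n -> computable Q n 0 0 (fun w => nth false w i).
Proof.
move=> lin c wc; exists [::]; rewrite cats0; split=> //; first by rewrite /circ_size big_nil.
exists i; split.
- exact: ltn_addr.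
- have := @nth_wire_depths_cat n [::] c i; rewrite addn0 => -> //.
  by rewrite nth_nseq; case: ifP.
- move=> w sw; have := @nth_wire_vals_cat [::] c w i; rewrite addn0 sw => -> //.
Qed.

Lemma computable_circuit (Q : pred gate) n d z f : (forall j, Q (Gate GAnd [:: j])) -> computable Q n d z f ->
  exists c, [/\ circ_wf n c, circ_size c <= z + 2, circ_depth n c <= d.+1, all Q c &
    forall w, size w = n -> circ_eval c w = f w].
Proof.
move=> QA E.
have [//|c [Qc w0 s0 d0 [j [j1 j2 j3]]]] := E [::].
rewrite cat0s in w0 d0 j1 j2 j3.
have dn : circ_depth n [::] = 0.
  by apply/eqP; rewrite -leqn0; apply/foldr_maxn_leP => x /nseqP[->].
(* The output has to be the last gate, whereas wire [j] may lie anywhere and may even be an input; a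
   unary conjunction copies it. *)
exists (rcons c (Gate GAnd [:: j])); split.
- split; first by rewrite size_rcons.
  by apply: wf_prefix_rcons => //=; rewrite j1.
- by rewrite -cats1 circ_size_cat /circ_size big_seq1 leq_add.
- rewrite circ_depth_rcons geq_max; apply/andP; split.
    by apply: leq_trans d0 _; rewrite dn max0n.
  by rewrite /gate_depth /= maxn0 add1n ltnS.
- by rewrite all_rcons QA.
move=> w sw; rewrite /circ_eval wire_vals_rcons last_rcons gate_evalE /= andbT.
exact: j3.
Qed.

(** * Counting and weighted thresholds in constant depth *)

Notation tc := (computable predT).

Lemma tc_const n b : tc n 1 1 (fun _ => b).
Proof.
case: b.
- exact: (@computable_gate predT n 0 0 GAnd nat [::] (fun _ _ => true)).
- exact: (@computable_gate predT n 0 0 GOr nat [::] (fun _ _ => true)).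
Qed.

Lemma tc_has n d z (I : eqType) (r : seq I) F : (forall i, i \in r -> tc n d z (F i)) ->
  tc n d.+1 (size r * z + (size r).+1) (fun w => has (F^~ w) r).
Proof.
move=> H; have := @computable_gate predT n d z GOr I r F _ _ H.
by move=> /(_ _ _)/eq_computable; apply=> // w _; rewrite /= has_map.
Qed.

Lemma tc_all n d z (I : eqType) (r : seq I) F : (forall i, i \in r -> tc n d z (F i)) ->
  tc n d.+1 (size r * z + (size r).+1) (fun w => all (F^~ w) r).
Proof.
move=> H; have := @computable_gate predT n d z GAnd I r F _ _ H.
by move=> /(_ _ _)/eq_computable; apply=> // w _; rewrite /= all_map.
Qed.

Lemma tc_not n d z f : tc n d z f -> tc n d.+1 (z + 2) (fun w => ~~ f w).
Proof.
move=> H; have := @computable_gate predT n d z GNot _ [:: tt] (fun _ => f).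
by rewrite /= mul1n; apply.
Qed.

Lemma tc_and n d z f g : tc n d z f -> tc n d z g ->
  tc n d.+1 (2 * z + 3) (fun w => f w && g w).
Proof.
move=> Hf Hg; apply: eq_computable (@tc_all n d z _ [:: true; false] (fun b => if b then f else g) _).
  by move=> w _ /=; rewrite andbT.
by case.
Qed.

Lemma tc_or n d z f g : tc n d z f -> tc n d z g ->
  tc n d.+1 (2 * z + 3) (fun w => f w || g w).
Proof.
move=> Hf Hg; apply: eq_computable (@tc_has n d z _ [:: true; false] (fun b => if b then f else g) _).
  by move=> w _ /=; rewrite orbF.
by case.
Qed.

Lemma tc_ge : exists k, forall n d z (I : eqType) (r : seq I) F v,
  size r <= z -> (forall i, i \in r -> tc n d z (F i)) ->
  tc n d.+2 ((z + 2) ^ k) (fun w => v <= count (F^~ w) r).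
Proof.
have [k pk] : poly_bounded (fun z => (4 * z + 1) * (z + 1) + (4 * z + 2)) by poly_bounded_tac.
exists k => n d z I r F v rz H; apply: computable_le (leqnn _) (pk z) _.
(* For larger [v] the answer is constant, which keeps the padding by [2 * v] constants
   polynomial. *)
have [rv|vr] := ltnP (size r) v.
  apply: (eq_computable (f := fun=> false)) => [w _|].
    by apply/esym/negbTE; rewrite -ltnNge; apply: leq_ltn_trans (count_size _ _) rv.
  by apply: (computable_le _ _ (@tc_const n false)); lia.
(* Padding by constants moves the majority threshold to [v]. *)
pose r' := [seq inl i | i <- r] ++ nseq (size r).+1 (inr true) ++ nseq (2 * v) (inr false).
pose F' (x : I + bool) := match x with inl i => F i | inr b => fun=> b end.
have sr' : size r' = (2 * size r + 2 * v).+1.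
  by rewrite /r' !size_cat size_map !size_nseq; lia.
have H' : forall x, x \in r' -> tc n d.+1 (z + 1) (F' x).
  move=> [i|b] xr; last by apply: (computable_le _ _ (@tc_const n b)); lia.
  apply: computable_le (leqnSn _) (leq_addr _ _) (H i _).
  by move: xr; rewrite !mem_cat !mem_nseq !andbF !orbF mem_map // => ? ? [].
have := @computable_gate predT n d.+1 (z + 1) GMaj _ r' F' _ _ H'.
move=> /(_ _ _)/(computable_le (leqnn _)) E; apply: eq_computable (E _ _ _ _) => //.
  move=> w _; rewrite /= size_map sr' count_map /r' !count_cat !count_nseq /= count_map.
  by rewrite (@eq_count _ _ (F^~ w)) //; lia.
by rewrite sr'; nia.
Qed.

(** Each count takes polynomially many values, so [g] is hardwired as a disjunction over the pairs
    it accepts. Two counts are taken because a digit after carrying depends on two adjacent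
    columns. *)
Lemma tc_count2 : exists k, forall n d z (I : eqType) (r1 r2 : seq I) F (g : nat -> nat -> bool),
  size r1 <= z -> size r2 <= z -> (forall i, i \in r1 ++ r2 -> tc n d z (F i)) ->
  tc n (d + 6) ((z + 2) ^ k) (fun w => g (count (F^~ w) r1) (count (F^~ w) r2)).
Proof.
have [a tca] := tc_ge.
pose S1 z := 2 * ((z + 2) ^ a + 2) + 3.
have [k pk] : poly_bounded (fun z => ((z + 1) * (z + 1)) * (2 * S1 z + 3) + ((z + 1) * (z + 1)).+1).
  by rewrite /S1; poly_bounded_tac.
exists k => n d z I r1 r2 F g s1 s2 H.
have eqc r v : size r <= z -> {subset r <= r1 ++ r2} ->
    tc n (d + 4) (S1 z) (fun w => count (F^~ w) r == v).
  move=> sr rr; rewrite addn4.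
  have G u := tca n d z I r F u sr (fun i ir => H i (rr i ir)).
  apply: eq_computable (tc_and (computable_le (leqnSn _) (leq_addr 2 _) (G v)) (tc_not (G v.+1))).
  by move=> w _; rewrite -leqNgt eqn_leq andbC.
pose r := [seq (x, y) | x <- iota 0 (size r1).+1, y <- iota 0 (size r2).+1].
have E : forall x, x \in r -> tc n (d + 5) (2 * S1 z + 3)
    (fun w => (count (F^~ w) r1 == x.1) && (count (F^~ w) r2 == x.2)).
  move=> [x y] _; rewrite addnS; apply: tc_and; apply: eqc => //= i ir.
    by rewrite mem_cat ir.
  by rewrite mem_cat ir orbT.
pose r' := [seq x <- r | g x.1 x.2].
have := tc_has (r := r') (fun x xr => E x (mem_subseq (filter_subseq _ _) xr)).
rewrite -(addnS d 5) => /(computable_le (leqnn _)) X; apply: eq_computable (X _ _) => [w _|].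
  apply/hasP/idP => [[x]|gw].
    by rewrite mem_filter => /andP[gx _] /andP[/eqP-> /eqP->].
  exists (count (F^~ w) r1, count (F^~ w) r2); rewrite ?eqxx // mem_filter gw /=.
  by apply: allpairs_f; rewrite mem_iota /= ltnS count_size.
apply: leq_trans (pk z).
have sr : size r' <= (z + 1) * (z + 1).
  apply: leq_trans (size_subseq (filter_subseq _ _)) _.
  by rewrite size_allpairs !size_iota leq_mul // addn1.
by rewrite leq_add ?leq_mul.
Qed.

Lemma tc_count : exists k, forall n d z (I : eqType) (r : seq I) F (g : nat -> bool),
  size r <= z -> (forall i, i \in r -> tc n d z (F i)) ->
  tc n (d + 6) ((z + 2) ^ k) (fun w => g (count (F^~ w) r)).
Proof.
have [k tck] := tc_count2; exists k => n d z I r F g sr H.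
by apply: (tck n d z I r [::] F (fun a _ => g a)) => //; rewrite cats0.
Qed.

(** * Iterated addition by carry look-ahead *)

Section Carry.
Variables (B : nat) (S : nat -> nat).
Hypotheses (B1 : 1 < B) (SB : forall b, S b <= B.-1 * B.-1).

Let low b := if b is b'.+1 then S b' else 0.
(** Each column sum is below [B ^ 2]; its low digit stays and its high digit moves one place up. One
    such step reduces many summands to two. *)
Definition digit_sum b := S b %% B + low b %/ B.

(* Digit sums are at most [2 (B - 1)], so carries are bits and can be looked ahead. *)
Definition carry m := has (fun j => (B <= digit_sum j) &&
  all (fun i => B.-1 <= digit_sum i) (iota j.+1 (m - j.+1))) (iota 0 m).

Lemma carryS m : carry m.+1 = (B <= digit_sum m) || (B.-1 <= digit_sum m) && carry m.
Proof.
rewrite /carry -[m.+1]addn1 iotaD has_cat /= add0n addn1 subnn andbT orbF orbC; congr orb.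
rewrite -[RHS]andbC; case: hasP => [[j]|N]; last first.
  apply/esym/negbTE/negP => /andP[/hasP[j ji /andP[Bj /allP aj]] mB]; apply: N; exists j => //.
  rewrite Bj; apply/allP => i; rewrite mem_iota => ij.
  have [->//|im] := eqVneq i m; apply: aj; rewrite mem_iota; move: ji ij im.
  by rewrite mem_iota; lia.
rewrite mem_iota => jm /andP[Bj /allP aj]; rewrite (aj m) ?andbT ?mem_iota; last by lia.
apply/esym/hasP; exists j; rewrite ?mem_iota // Bj; apply/allP => i.
by rewrite mem_iota => ij; apply: aj; rewrite mem_iota; lia.
Qed.

Lemma digit_sum_le b : digit_sum b <= (B.-1).*2.
Proof.
rewrite /digit_sum -addnn leq_add //; first by have := ltn_pmod (S b) (ltnW B1); lia.
case: b => [|b] /=; first by rewrite div0n.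
by rewrite -(mulnK B.-1 (ltnW B1)) leq_div2r //; apply: leq_trans (SB b) _; rewrite leq_mul // leq_pred.
Qed.

Lemma carryP m : carry m = (B ^ m <= \sum_(b < m) digit_sum b * B ^ b).
Proof.
have lt2 k : \sum_(b < k) digit_sum b * B ^ b < 2 * B ^ k.
  elim: k => [|k IH]; first by rewrite big_ord0.
  rewrite big_ord_recr /= expnS.
  have := leq_mul (digit_sum_le k) (leqnn (B ^ k)); move: IH.
  have -> : (B.-1).*2 * B ^ k = 2 * (B * B ^ k) - 2 * B ^ k.
    by rewrite -mulnBr -[X in _ - X]mul1n -mulnBl subn1 mulnA mul2n.
  have : B ^ k <= B * B ^ k by rewrite leq_pmull // ltnW.
  by move: (B ^ k) (B * _) (digit_sum k * _) (\sum_(_ < k) _) => *; lia.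
elim: m => [|m IH]; first by rewrite big_ord0.
rewrite carryS IH big_ord_recr /= expnS; have := lt2 m; have : 0 < B ^ m by rewrite expn_gt0 ltnW.
move: (B ^ m) (\sum_(_ < m) _) (digit_sum m) => P s D P0 s2.
have [BD|DB] := leqP B D; first by apply/esym; apply: leq_trans (leq_addl _ _); rewrite leq_mul2r BD orbT.
have [DB1|DB1] /= := leqP B.-1 D; last by apply/esym/negbTE; nia.
have -> : D = B.-1 by lia.
have -> : B * P = P + B.-1 * P by rewrite -mulSn prednK // ltnW.
by rewrite leq_add2r.
Qed.

(** Splitting leaves the high digit of column [m - 1] at place [m]. If it is nonzero it reaches
    [B ^ m] alone; otherwise the carry decides. *)
Lemma digit_carry m : (B ^ m <= \sum_(b < m) S b * B ^ b) = (0 < low m %/ B) || carry m.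
Proof.
have -> : \sum_(b < m) S b * B ^ b = \sum_(b < m) digit_sum b * B ^ b + low m %/ B * B ^ m.
  elim: m => [|m IH]; first by rewrite !big_ord0 div0n.
  rewrite !big_ord_recr /= IH /digit_sum {1}(divn_eq (S m) B) expnS.
  by rewrite !mulnDl -!mulnA !addnA [LHS]addnAC [LHS]addnAC -!addnA [S m %% B * _ + _]addnC -!addnA; congr addn; lia.
rewrite carryP; have : 0 < B ^ m by rewrite expn_gt0 ltnW.
move: (\sum_(_ < m) _) (B ^ m) (low m %/ B) => s P [|h] P0 /=; first by rewrite mul0n addn0.
by rewrite mulSn; lia.
Qed.
End Carry.

Definition digit B u b := (u %/ B ^ b) %% B.

Lemma digits_sum B u m : 0 < B -> u < B ^ m -> u = \sum_(b < m) digit B u b * B ^ b.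
Proof.
move=> B0; have E k : u = \sum_(b < k) digit B u b * B ^ b + u %/ B ^ k * B ^ k.
  elim: k => [|k IH]; first by rewrite big_ord0 expn0 divn1 muln1.
  rewrite big_ord_recr /= {1}IH -addnA; congr addn.
  by rewrite {1}(divn_eq (u %/ B ^ k) B) -divnMA -expnSr mulnDl -mulnA -expnS addnC.
by move=> um; rewrite {1}(E m) divn_small // mul0n addn0.
Qed.

(** A weight is realised by repeating a wire, which is affordable because the weights of a column
    are digits below [B]. *)
Lemma count_flatten_nseq (T : nat) (u : nat -> nat) (P : pred nat) :
  count P (flatten [seq nseq (u t) t | t <- iota 0 T]) = \sum_(t < T) u t * P t.
Proof.
rewrite count_flatten sumnE !big_map -{1}[T]subn0 big_mkord.
by apply: eq_bigr => i _; rewrite count_nseq mulnC.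
Qed.

(** The weights have [m] digits in a base [B > T] of polynomial size. A column then sums to at most
    [T * (B - 1) <= (B - 1) ^ 2], as the carry analysis requires, and is an ordinary count of
    repeated wires. *)
Lemma tc_threshold_nat : exists k, forall n d z T B m (u : nat -> nat) F,
  B <= z -> m <= z -> T < B -> 1 < B -> (forall t, t < T -> u t < B ^ m) ->
  (forall t, t < T -> tc n d z (F t)) ->
  tc n (d + 10) ((z + 2) ^ k) (fun w => B ^ m <= \sum_(t < T) u t * F t w).
Proof.
have [a tca] := tc_count2.
pose Y z := (z * z + z + 2) ^ a.
pose W z := 2 * (z * Y z + z.+1 + Y z) + 3.
have [k pk] : poly_bounded (fun z => 2 * (z * W z + z.+1) + 3) by rewrite /W /Y; poly_bounded_tac.
exists k => n d z T B m u F Bz mz TB B1 um H.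
pose r b := flatten [seq nseq (digit B (u t) b) t | t <- iota 0 T].
pose lowr b := if b is b'.+1 then r b' else [::].
pose S w b := count (F^~ w) (r b).
have SE w b : S w b = \sum_(t < T) digit B (u t) b * F t w.
  exact: (count_flatten_nseq _ (fun t => digit B (u t) b)).
have cle b (P : pred nat) : count P (r b) <= T * B.-1.
  rewrite /r (count_flatten_nseq T (fun t => digit B (u t) b)).
  apply: leq_trans (_ : \sum_(t < T) B.-1 <= _); last by rewrite sum_nat_const card_ord.
  apply: leq_sum => t _; apply: leq_trans (_ : digit B (u t) b * 1 <= _).
    by rewrite leq_mul2l leq_b1 orbT.
  by rewrite muln1 -ltnS prednK ?ltn_pmod // ltnW.
have rT b i : i \in r b -> i < T.
  move=> /flattenP[_ /mapP[t + ->]]; rewrite mem_iota /= => tT.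
  by rewrite mem_nseq => /andP[_ /eqP->].
have lT b i : i \in lowr b -> i < T by case: b => // b; apply: rT.
have sz b : size (r b) <= z * z + z.
  by rewrite -count_predT; apply: leq_trans (cle _ _) _; nia.
have szl b : size (lowr b) <= z * z + z by case: b => // b; apply: sz.
have D (g : nat -> nat -> bool) b : tc n (d + 6) (Y z)
    (fun w => g (count (F^~ w) (r b)) (count (F^~ w) (lowr b))).
  apply: tca => // i; rewrite mem_cat => /orP[/rT|/lT] /H; apply: computable_le => //; lia.
have SB w b : S w b <= B.-1 * B.-1.
  by apply: leq_trans (cle _ _) _; rewrite leq_mul2r -ltnS prednK ?TB ?orbT // ltnW.
have lowE w b : (if b is b'.+1 then S w b' else 0) = count (F^~ w) (lowr b) by case: b.
apply: (eq_computable (f := fun w => (0 < count (F^~ w) (lowr m) %/ B) || carry B (S w) m)).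
  move=> w _; rewrite -lowE -digit_carry //; congr leq.
  under eq_bigr => b _ do rewrite SE big_distrl /=.
  rewrite exchange_big /=; apply: eq_bigr => t _.
  rewrite [in RHS](@digits_sum B _ m (ltnW B1) (um t (ltn_ord t))) big_distrl /=.
  by apply: eq_bigr => b _; rewrite mulnAC.
apply: (computable_le (leqnn _) (pk z)); rewrite addnS.
have C1 : forall j, j \in iota 0 m -> tc n (d + 8) (W z) (fun w =>
    (B <= digit_sum B (S w) j) &&
    all (fun i => B.-1 <= digit_sum B (S w) i) (iota j.+1 (m - j.+1))).
  move=> j _; rewrite addnS.
  have E1 : tc n (d + 6) (Y z) (fun w => B <= digit_sum B (S w) j).
    apply: eq_computable (D (fun x y => B <= x %% B + y %/ B) j) => w _.
    by rewrite /digit_sum lowE.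
  have E2 i : tc n (d + 6) (Y z) (fun w => B.-1 <= digit_sum B (S w) i).
    apply: eq_computable (D (fun x y => B.-1 <= x %% B + y %/ B) i) => w _.
    by rewrite /digit_sum lowE.
  have E3 : tc n (d + 7) (z * Y z + z.+1 + Y z)
      (fun w => all (fun i => B.-1 <= digit_sum B (S w) i) (iota j.+1 (m - j.+1))).
    rewrite addnS; apply: (computable_le (leqnn _) _ (tc_all (fun i _ => E2 i))).
    by rewrite size_iota; apply: leq_trans (leq_addr _ _); rewrite leq_add ?leq_mul //; lia.
  have {}E1 : tc n (d + 7) (z * Y z + z.+1 + Y z) (fun w => B <= digit_sum B (S w) j).
    by apply: computable_le E1; rewrite ?leq_addl // leq_add2l.
  by apply: (computable_le (leqnn _) _ (tc_and E1 E3)); rewrite /W; lia.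
apply: tc_or.
  apply: (computable_le _ _ (D (fun _ y => 0 < y %/ B) m)); first by lia.
  by rewrite /W; nia.
have := tc_has C1; rewrite -addnS => /(computable_le (leqnn _)); apply.
by rewrite size_iota leq_add ?leq_mul.
Qed.

(** * Integer weights for real threshold functions *)

Section Vertex.
Local Open Scope ring_scope.
Variables (F : realFieldType) (K T : nat) (A : 'M[F]_(K, T)) (b : 'cV[F]_K).

Definition feasible (x : 'cV[F]_T) := forall k, b k 0 <= (A *m x) k 0.

(** Slack rows are zeroed rather than deleted, so the dimensions stay fixed while the point
    moves. *)
Definition tight_mx (x : 'cV[F]_T) :=
  \matrix_(k < K, j < T) (if (A *m x) k 0 == b k 0 then A k j else 0).

Lemma tight_mxE x (u : 'cV[F]_T) k : (tight_mx x *m u) k 0 =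
  if (A *m x) k 0 == b k 0 then (A *m u) k 0 else 0 :> F.
Proof.
rewrite [LHS]mxE; under eq_bigr => j _ do rewrite [tight_mx x k j]mxE.
by case: ifP => _; [rewrite [RHS]mxE|rewrite big1 // => j _; rewrite mul0r].
Qed.

Hypothesis A_inj : forall u : 'cV[F]_T, A *m u = 0 -> u = 0.

(** Move along a direction [u] on which all tight rows vanish until a further constraint becomes
    tight. By [A_inj] the polyhedron contains no line, so after a change of sign some constraint
    decreases along [u]; the smallest step among those keeps feasibility. *)
Lemma tight_rank_step x : feasible x -> (\rank (tight_mx x) < T)%N ->
  exists2 y, feasible y & (\rank (tight_mx x) < \rank (tight_mx y))%N.
Proof.
move=> fx rx.
have [u u0 tu] : exists2 u : 'cV[F]_T, u != 0 & tight_mx x *m u = 0.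
  have : kermx (tight_mx x)^T != 0 by rewrite -mxrank_eq0 mxrank_ker mxrank_tr subn_eq0 -ltnNge.
  case/rowV0Pn => v /sub_kermxP vt v0; exists v^T; first by rewrite trmx_eq0.
  by rewrite -[tight_mx x]trmxK -trmx_mul vt trmx0.
wlog [k0 k0n] : u u0 tu / exists k, (A *m u) k 0 < 0.
  have [k Auk] : exists k, (A *m u) k 0 != 0.
    apply/existsP; rewrite -negb_forall; apply/negP => /forallP H.
    by case/eqP: u0; apply: A_inj; apply/colP => k; rewrite (eqP (H k)) mxE.
  case: (ltrgt0P ((A *m u) k 0)) Auk => // Auk _ W; last by apply: (W u) => //; exists k.
  apply: (W (- u)); first by rewrite oppr_eq0.
    by rewrite mulmxN tu oppr0.
  by exists k; rewrite mulmxN mxE oppr_lt0.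
pose step k := ((A *m x) k 0 - b k 0) / - (A *m u) k 0.
case: (@arg_minP _ _ _ k0 (fun k => (A *m u) k 0 < 0) step k0n) => k1 k1n k1min.
have s0 : 0 <= step k1 by rewrite /step divr_ge0 // ?subr_ge0 // oppr_ge0 ltW.
pose y := x + step k1 *: u.
have AyE k : (A *m y) k 0 = (A *m x) k 0 + step k1 * (A *m u) k 0.
  by rewrite mulmxDr -scalemxAr !mxE.
have y1 : (A *m y) k1 0 = b k1 0.
  by rewrite AyE /step; field; rewrite lt_eqF.
exists y.
  move=> k; rewrite AyE; have [Auk|Auk] := leP 0 ((A *m u) k 0).
    by apply: ler_wpDr (fx k); apply: mulr_ge0.
  have := k1min k Auk; rewrite {2}/step ler_pdivlMr ?oppr_gt0 // mulrN; lra.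
have tight0 k : (A *m x) k 0 == b k 0 -> (A *m u) k 0 = 0.
  by move=> E; have := tight_mxE x u k; rewrite E tu mxE.
(* The old tight rows vanish on [u], hence stay tight; row [k1] does not vanish on [u], hence lies
   outside their span. *)
apply: rank_ltmx; rewrite ltmxE; apply/andP; split.
  apply/row_subP => k; have -> : row k (tight_mx x) =
      if (A *m x) k 0 == b k 0 then row k (tight_mx y) else 0.
    apply/rowP => j; rewrite mxE [tight_mx x k j]mxE; case: ifP => E; last by rewrite mxE.
    by rewrite [RHS]mxE [tight_mx y k j]mxE AyE (eqP E) tight0 // mulr0 addr0 eqxx.
  by case: ifP => _; [exact: row_sub|exact: sub0mx].
apply/negP => /submxP[D yD].
have := tight_mxE y u k1; rewrite y1 eqxx yD -mulmxA tu mulmx0 mxE => E.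
by rewrite -E ltxx in k1n.
Qed.

Lemma exists_vertex x : feasible x -> exists2 y, feasible y & row_full (tight_mx y).
Proof.
have [m] := ubnP (T - \rank (tight_mx x)); elim: m x => // m IH x rm fx.
have [rx|rx] := ltnP (\rank (tight_mx x)) T.
  have [y fy rxy] := tight_rank_step fx rx.
  by apply: (IH y _ fy); apply: leq_trans (ltnSE rm); rewrite ltn_sub2l.
by exists x => //; rewrite /row_full eqn_leq rank_leq_col rx.
Qed.
End Vertex.

Section SmallWeights.
Local Open Scope ring_scope.

Lemma det_le_fact n (M : 'M[int]_n) : (forall i j, `|M i j| <= 1) -> `|\det M| <= n`!%:R.
Proof.
move=> M1; apply: le_trans (ler_norm_sum _ _ _) _.
rewrite -card_Sn -sum1_card natr_sum; apply: ler_sum => s _.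
rewrite normrM normrX normrN1 expr1n mul1r normr_prod.
by apply: prodr_ile1 => i _; rewrite normr_ge0 M1.
Qed.

Lemma adj_le_fact n (M : 'M[int]_n.+1) i j : (forall i j, `|M i j| <= 1) -> `|\adj M i j| <= n`!%:R.
Proof.
move=> M1; rewrite mxE /cofactor normrM normrX normrN1 expr1n mul1r.
by apply: det_le_fact => a c; rewrite !mxE.
Qed.

(** There is one constraint per assignment [c]: value at least 0 if [a] accepts [c], at most -1 if
    it rejects. The margin turns a strict inequality into a closed one. Coefficients lie in {-1, 0,
    1} and right-hand sides in {0, 1}, so Cramer's rule at a vertex gives numerators bounded by [T]
    cofactors of size [(T - 1)!]; multiplying by the absolute value of the determinant preserves all
    signs. *)
Lemma small_weights (F : realFieldType) T (a : 'I_T -> F) : exists u : 'I_T -> int,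
  (forall t, (`|u t| <= T`!)%N) /\ forall c : {ffun 'I_T -> bool},
  (0 <= \sum_t a t * (c t)%:R) = (0 <= \sum_t u t * (c t)%:R).
Proof.
case: T a => [|T] a; first by exists (fun=> 0); split=> [[]|c] //; rewrite !big_ord0 !lexx.
set K := #|{ffun 'I_T.+1 -> bool}|; pose cf (k : 'I_K) : {ffun 'I_T.+1 -> bool} := enum_val k.
pose s (c : {ffun 'I_T.+1 -> bool}) := \sum_t a t * (c t)%:R.
pose sg (c : {ffun 'I_T.+1 -> bool}) : int := if 0 <= s c then 1 else -1.
pose Az : 'M[int]_(K, T.+1) := \matrix_(k, j) (sg (cf k) * (cf k j)%:R).
pose bz : 'cV[int]_K := \col_k (if 0 <= s (cf k) then 0 else 1).
pose A := map_mx (intr : int -> F) Az; pose b := map_mx (intr : int -> F) bz.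
have AE (x : 'cV[F]_T.+1) k : (A *m x) k 0 = (sg (cf k))%:~R * \sum_t x t 0 * (cf k t)%:R.
  rewrite mxE big_distrr; apply: eq_bigr => j _; rewrite !mxE rmorphM /= -mulrA; congr (_ * _).
  by rewrite mulrC; case: (cf k j).
have A_inj (u : 'cV[F]_T.+1) : A *m u = 0 -> u = 0.
  (* The assignments with a single true bit already determine [u]. *)
  move=> Au; apply/colP => j; pose c := [ffun i : 'I_T.+1 => i == j].
  have := AE u (enum_rank c); rewrite Au /cf enum_rankK mxE (bigD1 j) //= ffunE eqxx mulr1.
  rewrite big1 => [|i ij]; last by rewrite ffunE (negbTE ij) mulr0.
  rewrite addr0 mxE /sg; case: ifP => _ /esym /eqP; rewrite mulf_eq0 => /orP[|/eqP//].
    by rewrite oner_eq0.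
  by rewrite rmorphN1 oppr_eq0 oner_eq0.
(* [M] bounds every [1 / |s c|], so scaling [a] by it gives margin 1 on all rejected assignments;
   where [s c = 0] the term is [0^-1 = 0] and no margin is required. *)
pose M := \sum_k `|s (cf k)|^-1.
have [||y fy ry] := @exists_vertex F K T.+1 A b _ (\col_t (M * a t)); first exact: A_inj.
  move=> k; rewrite AE mxE mxE.
  have -> : \sum_t (\col_t (M * a t)) t 0 * (cf k t)%:R = M * s (cf k).
    by rewrite /s mulr_sumr; apply: eq_bigr => t _; rewrite mxE mulrA.
  have M0 : `|s (cf k)|^-1 <= M.
    by rewrite /M (bigD1 k) //= lerDl sumr_ge0 // => i _; rewrite invr_ge0.
  rewrite /sg; case: (leP 0 (s (cf k))) => sk.
    by rewrite mul1r mulr_ge0 // (le_trans _ M0) // invr_ge0.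
  rewrite rmorphN1 mulN1r -mulrN -(ler_pdivrMr _ _) ?oppr_gt0 // mul1r.
  by rewrite -(ltr0_norm sk).
pose f := fullrankfun ry.
pose B := rowsub f Az; pose d := \det B.
have Bt : rowsub f (tight_mx A b y) = map_mx intr B /\ forall i, (A *m y) (f i) 0 = b (f i) 0.
  have E i : (A *m y) (f i) 0 == b (f i) 0.
    (* A slack row would be a zero row of an invertible matrix. *)
    apply/negP => /negP/negbTE N.
    have : row i (rowsub f (tight_mx A b y)) = 0 by apply/rowP => j; rewrite 3![LHS]mxE N mxE.
    move/(congr1 (mulmxr (invmx (rowsub f (tight_mx A b y))))); rewrite /= -row_mul mul0mx.
    rewrite mulmxV ?fullrowsub_unit // => /rowP/(_ i); rewrite !mxE eqxx => /eqP.
    by rewrite oner_eq0.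
  split=> [|i]; last exact/eqP/E.
  by apply/matrixP => i j; rewrite 2![LHS]mxE E !mxE.
have d0 : d != 0.
  have := fullrowsub_unit ry; rewrite -/f Bt.1 unitmxE det_map_mx unitfE.
  by rewrite intr_eq0.
(* The factor [sgz d] makes [v] the multiple of [y] by [|d|] instead of [d], so that signs
   survive. *)
pose v : 'cV[int]_T.+1 := sgz d *: (\adj B *m rowsub f bz).
have vE t : (v t 0)%:~R = `|d|%:~R * y t 0.
  have : \adj (map_mx intr B) *m (map_mx intr B *m y) = (d%:~R : F) *: y.
    by rewrite mulmxA mul_adj_mx det_map_mx mul_scalar_mx.
  have -> : map_mx intr B *m y = map_mx intr (rowsub f bz).
    apply/colP => i; rewrite -Bt.1; have := Bt.2 i; rewrite !mxE => <-.
    apply: eq_bigr => j _; rewrite !mxE -/f.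
    by have := Bt.2 i; rewrite !mxE => ->; rewrite eqxx.
  rewrite -map_mx_adj -map_mxM => /colP/(_ t) E.
  have {}E : ((\adj B *m rowsub f bz) t 0)%:~R = d%:~R * y t 0.
    by move: E; rewrite [LHS]mxE [RHS]mxE.
  by rewrite /v mxE rmorphM /= E mulrA -rmorphM /= -abszEsg abszE.
have dpos : 0 < `|d|%:~R :> F by rewrite ltr0z normr_gt0.
exists (fun t => v t 0); split.
  move=> t; rewrite -lez_nat abszE mxE normrM normr_sgz d0 mul1r mxE.
  apply: le_trans (ler_norm_sum _ _ _) _.
  apply: le_trans (_ : \sum_(k < T.+1) T`!%:R <= _); last first.
    by rewrite sumr_const card_ord -mulrnA natz factS mulnC.
  apply: ler_sum => k _; rewrite normrM -[leRHS]mulr1 ler_pM ?normr_ge0 //.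
    apply: adj_le_fact => i j; rewrite !mxE normrM /sg.
    by case: ifP; case: (cf _ _).
  by rewrite !mxE; case: ifP.
move=> c; have := fy (enum_rank c); rewrite AE !mxE /cf enum_rankK -/(s c) /sg.
have -> : (0 <= \sum_t v t 0 * (c t)%:R) = (0 <= \sum_t y t 0 * (c t)%:R).
  rewrite -(ler0z F) rmorph_sum -[RHS](pmulr_rge0 _ dpos) big_distrr /=.
  by congr (_ <= _); apply: eq_bigr => t _; rewrite rmorphM /= vE mulrA; case: (c t).
case: (leP 0 (s c)) => _; first by rewrite mul1r => ->.
rewrite rmorphN1 mulN1r => H; apply/esym/negbTE; rewrite -ltNge; lra.
Qed.
End SmallWeights.

Lemma fact_le_exp n m : n <= m -> n`! <= m ^ n.
Proof. by elim: n => // n IH nm; rewrite factS expnS leq_mul // IH // ltnW. Qed.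

(** A negative weight becomes positive by negating its literal, which raises the threshold by its
    absolute value. *)
Lemma signed_sum_ge0 T (u : 'I_T -> int) (c : 'I_T -> bool) :
  (0 <= \sum_t u t * (c t)%:R)%R =
  (\sum_t `|u t|%N * (u t < 0)%R <= \sum_t `|u t|%N * (c t (+) (u t < 0)%R)).
Proof.
have E : (\sum_t u t * (c t)%:R = (\sum_t `|u t|%N * (c t (+) (u t < 0)%R))%:Z -
    (\sum_t `|u t|%N * (u t < 0)%R)%:Z)%R.
  rewrite !(big_morph Posz PoszD (erefl _)) -sumrB; apply: eq_bigr => t _.
  by case: ltrP; case: (c t) => /=; lia.
by rewrite E subr_ge0 lez_nat.
Qed.

Lemma tc_threshold : exists k, forall (R : realFieldType) n d z T (a : nat -> R) (th : R) F,
  T <= z -> (forall t, t < T -> tc n d z (F t)) ->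
  tc n (d + 11) ((z + 2) ^ k) (fun w => th <= \sum_(t < T) a t * (F t w)%:R)%R.
Proof.
have [e tce] := tc_threshold_nat.
have [k pk] : poly_bounded (fun z => (z + 4 + 2) ^ e) by poly_bounded_tac.
exists k => R n d z T a th F Tz H; apply: (computable_le (leqnn _) (pk z)).
(* The threshold becomes the weight of an extra input that is always true, so it is made an integer
   together with the other weights. *)
pose a' (t : 'I_T.+1) := (if (t < T)%N then a t else - th)%R.
pose F' t w := if t < T then F t w else true.
have [u [u_le uE]] := small_weights a'.
pose N := \sum_t `|u t|%N * (u t < 0)%R.
pose B := T + 4; pose m := T + 2.
have NB : N <= B ^ m.
  apply: leq_trans (_ : (T.+2)`! <= _); last by rewrite /m addn2 fact_le_exp // /B; lia.
  apply: leq_trans (_ : \sum_(t < T.+1) (T.+1)`! <= _).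
    by apply: leq_sum => t _; case: (_ < _)%R; rewrite ?muln0 // muln1.
  by rewrite sum_nat_const card_ord [T.+2`!]factS leq_mul.
have uB t : `|u t|%N < B ^ m.
  apply: leq_ltn_trans (u_le t) _; apply: leq_ltn_trans (fact_le_exp (leqnn _)) _.
  apply: leq_ltn_trans (_ : B ^ T.+1 < _); first by rewrite leq_exp2r // /B; lia.
  by rewrite ltn_exp2l /m /B; lia.
(* A second constant input, of weight [B ^ m - N], moves the threshold from [N] to the power
   [B ^ m]. *)
pose un t := if t < T.+1 then `|u (inord t)|%N else B ^ m - N.
pose Fn t w := if t < T.+1 then F' t w (+) (u (inord t) < 0)%R else true.
apply: (eq_computable (f := fun w => N <= \sum_(t < T.+1) `|u t|%N * (F' t w (+) (u t < 0)%R))).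
  move=> w _; have := uE [ffun t : 'I_T.+1 => F' t w]; rewrite [RHS]signed_sum_ge0.
  under [X in _ = (_ <= X)]eq_bigr do rewrite ffunE.
  move=> <-; rewrite big_ord_recr /= /a' ltnn ffunE /F' ltnn mulr1 subr_ge0.
  by congr (_ <= _)%R; apply: eq_bigr => t _; rewrite ffunE /= ltn_ord.
(* For [N = 0] the padding weight would be [B ^ m], which has one digit too many; the test is then
   constantly true. *)
have [N0|N0] := posnP N.
  apply: (eq_computable (f := fun=> true)) => [w _|]; first by rewrite N0.
  apply: (computable_le _ _ (@tc_const n true)); first by lia.
  by rewrite expn_gt0; lia.
apply: (eq_computable (f := fun w => B ^ m <= \sum_(t < T.+2) un t * Fn t w)).
  move=> w _; rewrite big_ord_recr /= /un /Fn ltnn muln1.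
  rewrite -{1}(subnKC NB) leq_add2r; congr leq.
  by apply: eq_bigr => t _; rewrite /= ltn_ord inord_val.
rewrite -addSnnS; apply: tce; rewrite /B /m; try lia.
  by move=> t _; rewrite /un; case: ifP => _; [exact: uB|rewrite /B /m; lia].
move=> t _; rewrite /Fn; case tT: (t < T.+1); last first.
  by apply: (computable_le _ _ (@tc_const n true)); lia.
rewrite /F'; case tT': (t < T); last first.
  by case: (_ < _)%R; [apply: (computable_le _ _ (@tc_const n false))|apply: (computable_le _ _ (@tc_const n true))]; lia.
have := H t tT'; case: (_ < _)%R => Ht.
  by apply: eq_computable (computable_le (leqnn _) _ (tc_not Ht)) => [w _|]; [rewrite addbT|lia].
by apply: eq_computable (computable_le (leqnSn _) _ Ht) => [w _|]; [rewrite addbF|lia].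
Qed.

(** * Rounding *)

Section Rounding.
Local Open Scope ring_scope.
Local Notation R := Defs.R.

Definition pow2 (e : int) : R := (2 : R) ^ e.

Lemma pow2_gt0 e : 0 < pow2 e. Proof. by rewrite exprz_gt0. Qed.

Lemma pow2D e f : pow2 (e + f) = pow2 e * pow2 f.
Proof. by rewrite /pow2 expfzDr // pnatr_eq0. Qed.

Lemma pow2_nat n : pow2 n%:Z = (2 ^ n)%:R.
Proof. by rewrite /pow2 -exprnP natrX. Qed.

Lemma pow2S e : pow2 (e + 1) = 2 * pow2 e.
Proof. by rewrite pow2D mulrC. Qed.

Lemma pow2_le e f : e <= f -> pow2 e <= pow2 f.
Proof. by move=> ef; rewrite ler_eXz2l // ltr1n. Qed.

Lemma pow2_sub (e f : int) : e <= f -> pow2 f = (2 ^ `|f - e|%N)%:R * pow2 e.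
Proof.
move=> ef; rewrite -pow2_nat -pow2D; congr pow2.
by rewrite gez0_abs ?subr_ge0 // subrK.
Qed.

Lemma mem_fpn_list p (s e : int) : ((s, e) \in fpn_list p) =
  ((s == 0) || (2 ^ p.-1 <= `|s| < 2 ^ p)%N) && (- (2 ^ p)%:Z <= e <= (2 ^ p)%:Z - 1).
Proof.
have p0 : (0 < 2 ^ p)%N by rewrite expn_gt0.
have p1 : (2 ^ p.-1 <= 2 ^ p)%N by rewrite leq_exp2l // leq_pred.
have pS : (2 ^ p.+1 = 2 ^ p + 2 ^ p)%N by rewrite expnS mul2n addnn.
have sE : (s \in sig_range p) = ((s == 0) || (2 ^ p.-1 <= `|s| < 2 ^ p)%N).
  rewrite inE; congr orb; rewrite mem_cat; apply/orP/idP.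
    by case=> /mapP[i]; rewrite mem_iota => ? ->; lia.
  case: (ltP s 0) => s0 H; [right|left]; apply/mapP; exists `|s|%N; rewrite ?mem_iota; lia.
have eE : (e \in exp_range p) = (- (2 ^ p)%:Z <= e <= (2 ^ p)%:Z - 1).
  apply/mapP/idP => [[i]|H]; first by rewrite mem_iota => ? ->; lia.
  by exists (absz (e + (2 ^ p)%:Z)); rewrite ?mem_iota; lia.
rewrite -sE -eE; apply/allpairsP/andP => [[[x y] /= [? ? [-> ->]]]//|[? ?]].
by exists (s, e).
Qed.

Lemma fpn0_in p : (0, 0) \in fpn_list p.
Proof.
rewrite mem_fpn_list eqxx /=; have : (0 < 2 ^ p)%N by rewrite expn_gt0.
lia.
Qed.

Lemma fpn_val0 e : fpn_val (0, e) = 0.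
Proof. by rewrite /fpn_val mul0r. Qed.

Lemma rnd_better_asym x a c : rnd_better x a c -> ~~ rnd_better x c a.
Proof.
rewrite /rnd_better; case: (ltgtP `|x - fpn_val a| `|x - fpn_val c|) => //= _.
by case/andP => /negbTE-> _; rewrite andbF.
Qed.

(** Together with asymmetry this makes [rnd_better x] a strict weak order, so the left fold in [rnd]
    returns an element that no candidate beats. *)
Lemma rnd_better_ntrans x a b c :
  ~~ rnd_better x a b -> ~~ rnd_better x b c -> ~~ rnd_better x a c.
Proof.
rewrite /rnd_better; move: `|x - fpn_val a| `|x - fpn_val b| `|x - fpn_val c| => A B C.
case: (ltgtP A B) => //= AB; case: (ltgtP B C) => //= BC; case: (ltgtP A C) => //= AC; try lra.
by case: (odd _); case: (odd _); case: (odd _).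
Qed.

Lemma rnd_spec p x : exists2 a, rnd p x = fpn_val a &
  a \in fpn_list p /\ forall c, c \in fpn_list p -> ~~ rnd_better x c a.
Proof.
pose upd best c := if rnd_better x c best then c else best.
suff H l b : let a := foldl upd b l in
    a \in b :: l /\ forall c, c \in b :: l -> ~~ rnd_better x c a.
  have [a1 a2] := H (fpn_list p) (0, 0).
  exists (foldl upd (0, 0) (fpn_list p)) => //; split=> [|c cl]; last first.
    by apply: a2; rewrite inE cl orbT.
  by move: a1; rewrite inE => /predU1P[->|//]; exact: fpn0_in.
elim: l b => [|y l IH] b /=.
  split=> [|c]; first by rewrite inE.
  by rewrite inE => /eqP->; rewrite /rnd_better ltxx eqxx /=; case: odd.
have [a1 a2] := IH (upd b y).
split; first by move: a1; rewrite !inE /upd; case: ifP => _ /orP[]->; rewrite ?orbT.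
have H c : ~~ rnd_better x c (upd b y) -> ~~ rnd_better x c (foldl upd (upd b y) l).
  by move=> H; apply: rnd_better_ntrans H _; apply: a2; rewrite mem_head.
move=> c; rewrite inE => /predU1P[->|].
  apply: H; rewrite /upd; case: ifP => [/rnd_better_asym//|_].
  by rewrite /rnd_better ltxx eqxx /=; case: odd.
rewrite inE => /predU1P[->|cl]; last by apply: a2; rewrite inE cl orbT.
apply: H; rewrite /upd; case: ifP => [_|->//].
by rewrite /rnd_better ltxx eqxx /=; case: odd.
Qed.

Lemma rnd_nearest p x : exists2 a, rnd p x = fpn_val a & [/\ a \in fpn_list p,
  forall c, c \in fpn_list p -> `|x - fpn_val a| <= `|x - fpn_val c| &
  forall c, c \in fpn_list p -> `|x - fpn_val a| = `|x - fpn_val c| ->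
    odd `|a.1|%N -> odd `|c.1|%N].
Proof.
have [a ra [al H]] := rnd_spec p x; exists a => //; split=> // c cl.
  by move: (H c cl); rewrite /rnd_better negb_or -leNgt => /andP[].
by move=> E oa; move: (H c cl); rewrite /rnd_better E ltxx eqxx oa /= andbT negbK.
Qed.

(** For [x < y], nearest points in the wrong order would put [x] at or above their midpoint and [y]
    at or below it, whatever the tie rule. *)
Lemma rnd_mono p x y : x <= y -> rnd p x <= rnd p y.
Proof.
rewrite le_eqVlt => /predU1P[->//|xy].
have [a -> [al Ha _]] := rnd_nearest p x; have [c -> [cl Hc _]] := rnd_nearest p y.
rewrite leNgt; apply/negP => ca; have := Ha c cl; have := Hc a al.
move: (fpn_val a) (fpn_val c) ca => A C CA.
case: (ger0P (x - A)) => ?; case: (ger0P (x - C)) => ?; case: (ger0P (y - A)) => ?;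
  case: (ger0P (y - C)) => ?; lra.
Qed.

Lemma rnd0 p : rnd p 0 = 0.
Proof.
have [a -> [al Ha _]] := rnd_nearest p 0; have := Ha _ (fpn0_in p).
by rewrite fpn_val0 subr0 normr0 normr_le0 sub0r oppr_eq0 => /eqP.
Qed.

Lemma rnd_prec0 x : rnd 0 x = 0.
Proof.
have [[s e] -> [+ _ _]] := rnd_nearest 0 x; rewrite mem_fpn_list /= => /andP[/orP[/eqP->|H] _].
  exact: fpn_val0.
by move: H; rewrite expn0; lia.
Qed.

Definition sgn (b : bool) : R := (-1) ^+ b.

Lemma sgnK b x : sgn b * (sgn b * x) = x.
Proof. by rewrite mulrA -expr2 sqrr_sign mul1r. Qed.

Lemma sgn_norm b x y : `|x - y| = `|sgn b * x - sgn b * y|.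
Proof. by rewrite -mulrBr normrM normr_sign mul1r. Qed.

Lemma fpn_val_sgn b s e : sgn b * fpn_val (s, e) = fpn_val ((-1) ^+ b * s, e).
Proof. by rewrite /fpn_val /= mulrA rmorphM rmorph_sign. Qed.

Lemma fpn_list_sgn p b s e : ((-1) ^+ b * s, e) \in fpn_list p = ((s, e) \in fpn_list p).
Proof. by rewrite !mem_fpn_list mulf_eq0 signr_eq0 /= abszMsign. Qed.

(** The list of candidates is symmetric under sign, so a negative [v] is handled by mirroring the
    candidates rather than the function [rnd]. *)
Lemma rnd_bracket p b v lo hi : let u := sgn b * v in
  lo \in fpn_list p -> hi \in fpn_list p -> fpn_val lo <= u <= fpn_val hi ->
  (forall c, c \in fpn_list p -> fpn_val c <= fpn_val lo \/ fpn_val hi <= fpn_val c) ->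
  exists2 a, sgn b * rnd p v = fpn_val a & [/\ a \in fpn_list p,
    fpn_val a = fpn_val lo /\ u - fpn_val lo <= fpn_val hi - u \/
    fpn_val a = fpn_val hi /\ fpn_val hi - u <= u - fpn_val lo &
    forall c, c \in fpn_list p -> `|u - fpn_val a| = `|u - fpn_val c| ->
      odd `|a.1|%N -> odd `|c.1|%N].
Proof.
move=> u lol hil /andP[lou uhi] gap.
have [[s e] rE [al Ha Hodd]] := rnd_nearest p v.
pose a := ((-1) ^+ b * s, e); have al' : a \in fpn_list p by rewrite fpn_list_sgn.
have aE : sgn b * rnd p v = fpn_val a by rewrite rE fpn_val_sgn.
have Ha' c : c \in fpn_list p -> `|u - fpn_val a| <= `|u - fpn_val c|.
  case: c => s' e' cl; rewrite -aE rE -sgn_norm.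
  have := Ha ((-1) ^+ b * s', e'); rewrite fpn_list_sgn => /(_ cl).
  by rewrite [X in _ <= X](sgn_norm b) fpn_val_sgn mulrA -expr2 sqrr_sign mul1r.
exists a => //; split=> //.
  have := Ha' _ lol; have := Ha' _ hil.
  rewrite (ger0_norm (x := u - fpn_val lo)) ?subr_ge0 // (ler0_norm (x := u - fpn_val hi)) ?subr_le0 //.
  have [?|?] := gap _ al'.
    by rewrite ger0_norm ?subr_ge0; [lra|lra].
  by rewrite ler0_norm ?subr_le0; [lra|lra].
case=> s' e' cl E oa.
have := Hodd ((-1) ^+ b * s', e'); rewrite fpn_list_sgn => /(_ cl) /=.
rewrite abszMsign; apply.
  by rewrite -rE (sgn_norm b) aE E (sgn_norm b v) fpn_val_sgn mulrA -expr2 sqrr_sign mul1r.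
by move: oa; rewrite /a /= abszMsign.
Qed.

(** Makes the parity in the tie rule a property of the number and not of its chosen
    representation. *)
Lemma mantissa_uniq p m m' e e' : (2 ^ p.-1 <= m < 2 ^ p)%N -> (2 ^ p.-1 <= m' < 2 ^ p)%N ->
  m%:R * pow2 e = m'%:R * pow2 e' -> m = m'.
Proof.
wlog ee' : m m' e e' / e <= e'.
  move=> W hm hm' E; case: (leP e e') => [ee|/ltW ee]; first exact: W ee hm hm' E.
  by apply/esym; apply: W ee hm' hm (esym E).
move=> hm hm'; rewrite (pow2_sub ee') mulrA => /(mulIf (lt0r_neq0 (pow2_gt0 e))).
rewrite -natrM => /eqP; rewrite eqr_nat => /eqP mE.
have [d0|d0] := posnP `|e' - e|%N; first by rewrite mE d0 muln1.
exfalso; move: hm hm'; rewrite mE; case: p => [|p] /=; first by lia.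
rewrite expnS -(prednK d0) expnS; have : (0 < 2 ^ `|e' - e|.-1)%N by rewrite expn_gt0.
nia.
Qed.

Section Normal.
Variables (p : nat) (b : bool) (v : R) (e : int) (k : nat).
Hypotheses (p0 : (0 < p)%N) (kp : (2 ^ p.-1 <= k < 2 ^ p)%N).
Hypothesis ep : - (2 ^ p)%:Z <= e <= (2 ^ p)%:Z - 1.
Hypothesis top : (k.+1 < 2 ^ p)%N || (e < (2 ^ p)%:Z - 1).
Let u := sgn b * v.
Hypothesis ku : k%:R * pow2 e <= u < k.+1%:R * pow2 e.

Let lo : int * int := (k%:Z, e).
(** The successor of [lo]; at the end of a binade it is renormalised, and [top] guarantees that the
    raised exponent still fits. *)
Let hi : int * int := if (k.+1 < 2 ^ p)%N then (k.+1%:Z, e) else ((2 ^ p.-1)%:Z, e + 1).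

Lemma pow2_pred : (2 ^ p = 2 * 2 ^ p.-1)%N. Proof. by rewrite -expnS prednK. Qed.

Lemma normal_lo : lo \in fpn_list p.
Proof. by rewrite mem_fpn_list ep andbT; apply/orP; right. Qed.

Lemma normal_loE : fpn_val lo = k%:R * pow2 e. Proof. by []. Qed.

Lemma normal_hi : hi \in fpn_list p.
Proof.
have := pow2_pred; have : (0 < 2 ^ p.-1)%N by rewrite expn_gt0.
by rewrite /hi; case: ifP top => k1 /=; rewrite mem_fpn_list; lia.
Qed.

Lemma normal_hiE : fpn_val hi = k.+1%:R * pow2 e.
Proof.
rewrite /hi; case: ifP => k1 //; rewrite /fpn_val /= -/(pow2 _) pow2S mulrA; congr (_ * _).
by rewrite -[_%:~R]/((2 ^ p.-1)%:R) mulrC -natrM -pow2_pred; congr (_%:R); lia.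
Qed.

Lemma normal_gap c : c \in fpn_list p -> fpn_val c <= fpn_val lo \/ fpn_val hi <= fpn_val c.
Proof.
case: c => s f; rewrite mem_fpn_list normal_loE normal_hiE /fpn_val /= -/(pow2 f) => /andP[sp _].
case: (leP e f) => [ef|fe].
  rewrite (pow2_sub ef) mulrA -[(2 ^ _)%:R]/((2 ^ `|f - e|)%:Z%:~R) -rmorphM /=.
  set m := (s * _)%R; case: (leP m k%:Z) => mk; [left|right]; rewrite ler_pM2r ?pow2_gt0 //.
    by rewrite -[k%:R]/(k%:Z%:~R) ler_int.
  by rewrite -[k.+1%:R]/(k.+1%:Z%:~R) ler_int; lia.
left; apply: le_trans (_ : (2 ^ p)%:Z%:~R * pow2 f <= _).
  rewrite ler_pM2r ?pow2_gt0 // ler_int.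
  have : (0 < 2 ^ p)%N by rewrite expn_gt0.
  by move: sp => /orP[/eqP->|]; lia.
rewrite pow2_pred PoszM rmorphM /= -mulrA [_ * pow2 f]mulrC mulrA -pow2S mulrC.
apply: ler_pM; [by rewrite ler0z|exact: ltW (pow2_gt0 _)| |].
  by rewrite -[k%:R]/(k%:Z%:~R) ler_int; case/andP: kp.
by apply: pow2_le; lia.
Qed.

(* At precision 1 every significand is odd, so a tie is decided by the order of [fpn_list]. *)
Definition tie : bool := rnd p (sgn b * (3 / 2 * pow2 e)) != sgn b * pow2 e.

Lemma rnd_normal : rnd p v = sgn b * ((k%:R + ((k%:R * pow2 e + pow2 e / 2 < u) ||
  (u == k%:R * pow2 e + pow2 e / 2) && (if (1 < p)%N then odd k else tie))%:R) * pow2 e).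
Proof.
have E0 := pow2_gt0 e.
have [|a aE [al H Hodd]] := @rnd_bracket p b v lo hi normal_lo normal_hi _ normal_gap.
  by rewrite normal_loE normal_hiE -/u; case/andP: ku => -> /ltW.
rewrite -[LHS](sgnK b) aE; congr (_ * _).
move: H; rewrite -/u normal_loE normal_hiE -natr1 => H.
case: (ltgtP u (k%:R * pow2 e + pow2 e / 2)) => uE /=.
- by rewrite addr0; case: H => [[-> _]//|]; lra.
- by case: H => [|[-> _]//]; lra.
rewrite -/u in Hodd.
have [p1|p1] := ltnP 1 p; last first.
  have pE : p = 1%N by lia.
  (* The only significand being 1, the tie point is [3 / 2 * pow2 e]; hence [tie] depends on [b] and
     [e] alone and can be hardwired. *)
  have kE : k = 1%N by move: kp; rewrite pE expn0 expn1; lia.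
  have vE : v = sgn b * (3 / 2 * pow2 e) by rewrite -[v](sgnK b) -/u uE kE; congr (_ * _); lra.
  rewrite /tie -vE; have := aE; rewrite kE => aE'.
  have rE : rnd p v = sgn b * fpn_val a by rewrite -aE sgnK.
  case: eqVneq => [rv|rv] /=; case: H => [[aV _]|[aV _]]; rewrite aV kE; try lra.
    have : fpn_val a = pow2 e by rewrite -aE rv sgnK.
    by rewrite aV kE => ?; lra.
  by exfalso; move/eqP: rv; apply; rewrite rE aV kE mul1r.
have sE m : (2 ^ p.-1 <= m < 2 ^ p)%N -> fpn_val a = m%:R * pow2 e -> `|a.1|%N = m.
  case: a al {aE H Hodd} => s f; rewrite mem_fpn_list /fpn_val /= -/(pow2 f) => /andP[sp _] mp E.
  have m0 : (0 < m)%N by case/andP: mp => + _; apply: leq_trans; rewrite expn_gt0.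
  have s0 : 0 < s.
    have : 0 < s%:~R * pow2 f by rewrite E mulr_gt0 // ltr0n.
    by rewrite pmulr_lgt0 ?pow2_gt0 // ltr0z.
  apply: (@mantissa_uniq p _ _ f e) mp _; first by move: sp; lia.
  by rewrite -E -[X in X * _]/((`|s|%N)%:Z%:~R) gtz0_abs.
have eq_d : `|u - fpn_val lo| = `|u - fpn_val hi|.
  by rewrite normal_loE normal_hiE -natr1 ger0_norm ?ler0_norm; lra.
case: H => [[aV _]|[aV _]]; rewrite aV.
  have ak := sE k kp aV.
  case ok: (odd k); last by rewrite addr0.
  have : odd `|hi.1|%N.
    by apply: Hodd normal_hi _ _; rewrite ?ak ?ok // aV -normal_loE.
  (* Past the binade the successor has significand [2 ^ p.-1], which is even because [1 < p]. *)
  rewrite /hi; case: ifP => _ /=; first by rewrite ok.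
  by rewrite oddX; case: (p) p1 => [|[|]].
case ok: (odd k) => //; exfalso.
have k1 : (k.+1 < 2 ^ p)%N.
  have : odd (2 ^ p) = false by rewrite oddX; case: (p) p0.
  by move: kp ok => /andP[_]; rewrite leq_eqVlt => /predU1P[<- /= -> //|].
have ak : `|a.1|%N = k.+1 by apply: sE; rewrite ?aV ?natr1 // k1 andbT ltnW // ltnS; case/andP: kp.
have : odd `|lo.1|%N.
  apply: Hodd normal_lo _ _; rewrite ?ak /= ?ok //.
  by rewrite aV eq_d normal_hiE natr1.
by rewrite /= ok.
Qed.
End Normal.

(** The format has no subnormals, so nothing lies strictly between 0 and [fmin p]; overflow
    saturates at [fmax p]. *)
Definition fmin p : R := fpn_val ((2 ^ p.-1)%:Z, - (2 ^ p)%:Z).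
Definition fmax p : R := fpn_val ((2 ^ p)%:Z - 1, (2 ^ p)%:Z - 1).

(** The self-referential form avoids locating the rounding boundary: the condition is monotone in
    [sgn b * v], and monotone conditions are what threshold circuits decide. *)
Lemma rnd_underflow p b v : (0 < p)%N -> 0 <= sgn b * v < fmin p ->
  rnd p v = if fmin p <= sgn b * rnd p v then sgn b * fmin p else 0.
Proof.
move=> p0 /andP[u0 um]; have pp := @pow2_pred p p0.
have pp0 : (0 < 2 ^ p.-1)%N by rewrite expn_gt0.
have m0 : 0 < fmin p by rewrite mulr_gt0 ?pow2_gt0 // ltr0z.
have [||||a aE [_ H _]] := @rnd_bracket p b v (0, 0) ((2 ^ p.-1)%:Z, - (2 ^ p)%:Z).
  - exact: fpn0_in.
  - by rewrite mem_fpn_list; lia.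
  - by rewrite fpn_val0 u0 ltW.
  case=> s f; rewrite mem_fpn_list fpn_val0 => /andP[sp fp].
  case: (leP s 0) => s0; [left|right].
    by apply: mulr_le0_ge0; [rewrite lerz0|exact: ltW (pow2_gt0 _)].
  have ps : (2 ^ p.-1 <= `|s|)%N by case/orP: sp s0 => [/eqP->|/andP[]//]; rewrite ltxx.
  apply: ler_pM; [by rewrite ler0z|exact: ltW (pow2_gt0 _)| |by apply: pow2_le; case/andP: fp].
  by rewrite ler_int -(gtz0_abs s0) lez_nat.
rewrite -[LHS](sgnK b) aE; move: H; rewrite fpn_val0 -/(fmin p).
case=> [[-> _]|[-> _]]; last by rewrite lexx.
by rewrite leNgt m0 mulr0.
Qed.

Lemma fpn_le_fmax p a : a \in fpn_list p -> fpn_val a <= fmax p.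
Proof.
have pp0 : (0 < 2 ^ p)%N by rewrite expn_gt0.
case: a => s f; rewrite mem_fpn_list => /andP[sp fp].
apply: le_trans (_ : ((2 ^ p)%:Z - 1)%:~R * pow2 f <= _).
  rewrite ler_pM2r ?pow2_gt0 // ler_int lerBrDr.
  apply: le_trans (_ : `|s|%N%:Z + 1 <= _); first by rewrite lerD2r abszE ler_norm.
  by case/orP: sp => [/eqP->|/andP[_]]; lia.
have m0 : 0 <= (2 ^ p)%:Z - 1 by lia.
rewrite /fmax /fpn_val /= -/(pow2 _); apply: ler_wpM2l; first by rewrite ler0z.
by apply: pow2_le; case/andP: fp.
Qed.

Lemma fmax_in p : ((2 ^ p)%:Z - 1, (2 ^ p)%:Z - 1) \in fpn_list p.
Proof.
have pp0 : (0 < 2 ^ p)%N by rewrite expn_gt0.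
have p1 : (2 ^ p.-1 <= 2 ^ p)%N by rewrite leq_exp2l // leq_pred.
rewrite mem_fpn_list; case: p pp0 p1 => [|p]; first by rewrite expn0; lia.
rewrite /= expnS; have : (0 < 2 ^ p)%N by rewrite expn_gt0.
lia.
Qed.

Lemma rnd_overflow p b v : fmax p <= sgn b * v -> rnd p v = sgn b * fmax p.
Proof.
move=> mu; have [[s e] rE [al Ha _]] := rnd_nearest p v.
pose a := ((-1) ^+ b * s, e); have al' : a \in fpn_list p by rewrite fpn_list_sgn.
have aE : sgn b * rnd p v = fpn_val a by rewrite rE fpn_val_sgn.
rewrite -[LHS](sgnK b) aE; congr (_ * _); apply/eqP; rewrite eq_le fpn_le_fmax //=.
have := Ha ((-1) ^+ b * ((2 ^ p)%:Z - 1), (2 ^ p)%:Z - 1).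
rewrite fpn_list_sgn => /(_ (fmax_in p));
rewrite [X in X <= _](sgn_norm b) [X in _ <= X](sgn_norm b) -[in X in _ <= X]fpn_val_sgn sgnK.
rewrite -rE aE -/(fmax p).
have := fpn_le_fmax al' => am.
by rewrite !ger0_norm ?subr_ge0 ?(le_trans am) //; lra.
Qed.

Lemma fmin_gt0 p : 0 < fmin p.
Proof. by rewrite mulr_gt0 ?pow2_gt0 // ltr0z; have : (0 < 2 ^ p.-1)%N by rewrite expn_gt0. Qed.
End Rounding.

(** * Binades and leading exponents *)

Section Binade.
Local Open Scope ring_scope.
Local Notation R := Defs.R.

Lemma floor_bounds (x : R) (m : int) : m%:~R <= x -> x < (m + 1)%:~R -> Num.floor x = m.
Proof. by move=> mx xm; apply: floor_def; rewrite mx. Qed.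

Lemma exists_binade (x : R) : 0 < x -> exists q, pow2 q <= x < pow2 (q + 1).
Proof.
have ge1 y : 1 <= y -> exists q, pow2 q <= y < pow2 (q + 1).
  move=> y1; have y0 : 0 <= y by apply: le_trans y1.
  pose k := `|Num.floor y|%N; have kE : k%:Z = Num.floor y by rewrite /k gez0_abs ?floor_ge0.
  have k0 : (0 < k)%N by rewrite -ltz_nat kE floor_gt0.
  have [ky yk] : k%:R <= y /\ y < k.+1%:R.
    split; first by rewrite -[k%:R]/(k%:Z%:~R) kE; apply: floor_le.
    by rewrite -[k.+1%:R]/(k.+1%:Z%:~R) -addn1 PoszD kE; apply: floorD1_gt.
  have /andP[t1 t2] := trunc_log_bounds (ltnSn 1) k0.
  exists (trunc_log 2 k)%:Z; rewrite pow2_nat (_ : _ + 1 = (trunc_log 2 k).+1%:Z) ?pow2_nat; last by lia.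
  apply/andP; split; first by apply: le_trans ky; rewrite ler_nat.
  by apply: lt_le_trans yk _; rewrite ler_nat.
move=> x0; have [x1|x1] := leP 1 x; first exact: ge1.
have [|q /andP[q1 q2]] := ge1 x^-1; first by rewrite -invr1 lef_pV2 ?posrE // ltW.
have qE : pow2 (- q) = (pow2 q)^-1 by rewrite /pow2 invr_expz.
(* Inversion reverses the half-open interval, so its closed end is treated apart. *)
have [xq|xq] := eqVneq x (pow2 (- q)).
  by exists (- q); rewrite -xq lexx /= pow2S -xq; lra.
exists (- (q + 1)); have -> : - (q + 1) + 1 = - q by lia.
have q1E : pow2 (- (q + 1)) = (pow2 (q + 1))^-1 by rewrite /pow2 invr_expz.
rewrite lt_neqAle xq q1E qE /= -[x]invrK !lef_pV2 ?posrE ?invr_gt0 ?pow2_gt0 // q1 andbT.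
exact: ltW.
Qed.

Lemma binade_uniq (x : R) q q' : pow2 q <= x < pow2 (q + 1) -> pow2 q' <= x < pow2 (q' + 1) -> q = q'.
Proof.
move=> /andP[a1 a2] /andP[b1 b2]; apply/eqP; rewrite eq_le; apply/andP; split.
  rewrite leNgt; apply/negP => H; have : pow2 (q' + 1) <= pow2 q by apply: pow2_le; lia.
  lra.
rewrite leNgt; apply/negP => H; have : pow2 (q + 1) <= pow2 q' by apply: pow2_le; lia.
lra.
Qed.

(* A gap between the binades of the summands cannot be bridged by cancellation. *)
Lemma lead_exponent (I : eqType) (r : seq I) (s e : I -> int) (F : I -> bool) z (rho : R) r0 q :
  let X := \sum_(i <- r) (s i)%:~R * pow2 (e i) * (F i)%:R in
  (forall i, i \in r -> `|s i|%N <= 2 ^ z)%N ->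
  pow2 r0 <= `|rho| < pow2 (r0 + 1) -> pow2 q <= `|rho * X| < pow2 (q + 1) ->
  exists2 i, i \in r & - 1 <= q - e i - r0 <= (z + size r + 1)%N%:Z.
Proof.
move=> X sz /andP[rho1 rho2]; rewrite normrM => /andP[X1 X2].
pose g := q - r0.
pose near i := - 1 <= g - e i <= (z + size r + 1)%N%:Z.
have [/hasP[i ir ni]|/hasPn far] := boolP (has near r).
  by exists i => //; move: ni; rewrite /near /g; lia.
(* With no exponent near [g], the high terms sum to an integer multiple of [4 * pow2 g] and the low
   terms to at most [pow2 g / 4] in absolute value, whereas [|X|] lies strictly between [pow2 g / 2]
   and [2 * pow2 g]. *)
exfalso; pose hi i := g + 2 <= e i.
have gE k : pow2 (g + k) = pow2 g * pow2 k by rewrite pow2D.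
have [p1 [p2 pm1]] : pow2 1 = 2 /\ pow2 2 = 4 /\ pow2 (- 1) = 2^-1.
  by rewrite /pow2 expr1z; split=> //; split; [rewrite -exprnP; lra|rewrite exprN1].
have pm2 : pow2 (- 2) = 4^-1.
  by rewrite (_ : - 2 = - 1 + - 1) // pow2D pm1; lra.
have g0 := pow2_gt0 g.
have q2 : pow2 q = pow2 g * pow2 r0 by rewrite -pow2D subrK.
have X_hi : `|X| < 2 * pow2 g.
  rewrite ltNge; apply/negP => H.
  have : pow2 r0 * (2 * pow2 g) <= `|rho| * `|X|.
    by apply: ler_pM => //; rewrite ?mulr_ge0 // ltW // pow2_gt0.
  by move: X2; rewrite pow2D p1 q2; lra.
have X_lo : pow2 g / 2 < `|X|.
  rewrite ltNge; apply/negP => H.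
  have : `|rho| * `|X| < pow2 (r0 + 1) * (pow2 g / 2).
    apply: le_lt_trans (ler_wpM2l _ H) _; first exact: normr_ge0.
    by rewrite ltr_pM2r // divr_gt0.
  by move: X1; rewrite pow2D p1 q2; lra.
pose d i := absz (e i - (g + 2))%R.
have [m hiE] : exists m : int, \sum_(i <- r | hi i) (s i)%:~R * pow2 (e i) * (F i)%:R = m%:~R * (4 * pow2 g).
  exists (\sum_(i <- r | hi i) s i * (2 ^ d i)%N%:Z * (F i)%:R).
  rewrite rmorph_sum big_distrl; apply: eq_bigr => i hi_i /=.
  rewrite (pow2_sub hi_i) gE p2 !rmorphM /= -/(d i).
  have -> : ((2 ^ d i)%N%:Z%:~R = (2 ^ d i)%:R :> R) by [].
  by case: (F i) => /=; ring.
have loE : `|\sum_(i <- r | ~~ hi i) (s i)%:~R * pow2 (e i) * (F i)%:R| <= pow2 g / 4.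
  apply: le_trans (ler_norm_sum _ _ _) _.
  pose c := pow2 (g - 2 - (size r)%:Z).
  apply: le_trans (_ : \sum_(i <- r | ~~ hi i) c <= _).
    rewrite big_seq_cond [leRHS]big_seq_cond; apply: ler_sum => i /andP[ir nhi].
    rewrite !normrM [`|(F i)%:R|]ger0_norm ?ler0n // [`|pow2 _|]ger0_norm ?(ltW (pow2_gt0 _)) //.
    apply: le_trans (_ : (2 ^ z)%:R * pow2 (e i) * 1 <= _).
      apply: ler_pM; rewrite ?mulr_ge0 ?ler0n ?(ltW (pow2_gt0 _)) //; last by case: (F i).
      rewrite ler_wpM2r ?(ltW (pow2_gt0 _)) // -intr_norm -[(2 ^ z)%:R]/((2 ^ z)%N%:Z%:~R) ler_int.
      by rewrite -abszE lez_nat; apply: sz.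
    rewrite mulr1 -pow2_nat -pow2D /c; apply: pow2_le.
    by move: (far i ir) nhi; rewrite /near /hi; lia.
  rewrite big_const_seq iter_addr_0 -[c *+ _]mulr_natr.
  apply: le_trans (_ : c * (2 ^ size r)%:R <= _).
    rewrite ler_wpM2l ?(ltW (pow2_gt0 _)) // ler_nat.
    apply: leq_trans (count_size _ _) _; apply: ltnW; exact: ltn_expl.
  by rewrite -pow2_nat -pow2D /c subrK gE pm2.
have XE : X = m%:~R * (4 * pow2 g) + \sum_(i <- r | ~~ hi i) (s i)%:~R * pow2 (e i) * (F i)%:R.
  by rewrite -hiE /X (bigID hi).
have [m0|m0] := eqVneq m 0.
  by move: X_lo; rewrite XE m0 mul0r add0r; lra.
have m1 : 1 <= `|m%:~R| :> R by rewrite -intr_norm ler1z; lia.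
have : 4 * pow2 g <= `|m%:~R * (4 * pow2 g)|.
  by rewrite normrM (ger0_norm (x := 4 * _)) ?mulr_ge0 ?(ltW g0) // ler_peMl // mulr_ge0 ?(ltW g0).
have mE : m%:~R * (4 * pow2 g) =
    X - \sum_(i <- r | ~~ hi i) (s i)%:~R * pow2 (e i) * (F i)%:R by rewrite XE addrK.
by rewrite mE; have := ler_normB X (\sum_(i <- r | ~~ hi i) (s i)%:~R * pow2 (e i) * (F i)%:R); lra.
Qed.

End Binade.

(** * Rounding expressed by parities and comparisons *)

Section Bits.
Local Open Scope ring_scope.
Local Notation R := Defs.R.

Definition fodd (x : R) : bool := odd `|Num.floor x|%N.

(** For a non-integer, [floor (- x) = - floor x - 1] flips the parity. Two parity bits thus test
    integrality, which detects exact ties. *)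
Lemma fodd_opp x : (fodd (- x) == fodd x) = (x == (Num.floor x)%:~R).
Proof.
have [xE|xn] := eqVneq x (Num.floor x)%:~R.
  by rewrite /fodd xE -rmorphN !intrKfloor abszN eqxx.
have F : Num.floor (- x) = - Num.floor x - 1.
  have := floor_le x; rewrite le_eqVlt eq_sym (negbTE xn) /= => l1; have := floorD1_gt x => l2.
  move: l2; rewrite rmorphD /= => l2.
  by apply: floor_bounds; rewrite ?subrK ?rmorphB rmorphN /=; lra.
by rewrite /fodd F; apply/negbTE; move: (Num.floor x) => m; lia.
Qed.

Lemma floor_div_nat (x : R) (m : nat) : (0 < m)%N -> 0 <= x ->
  Num.floor (x / m%:R) = (`|Num.floor x| %/ m)%N%:Z.
Proof.
move=> m0 x0; have m0' : 0 < m%:R :> R by rewrite ltr0n.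
have := floor_le x; have := floorD1_gt x.
rewrite -[Num.floor x]gez0_abs ?floor_ge0 //; move: `|Num.floor x|%N => k /=.
rewrite -PoszD addn1 -![(_%:Z)%:~R]/(_%:R) => xk kx; apply: floor_bounds.
  rewrite ler_pdivlMr //; apply: le_trans kx.
  by rewrite -[(_%:Z)%:~R]/(_%:R) -natrM ler_nat leq_trunc_div.
rewrite ltr_pdivrMr //; apply: lt_le_trans xk _.
rewrite -PoszD addn1 -[(_%:Z)%:~R]/(_%:R) -natrM ler_nat.
by rewrite ltn_ceil.
Qed.

Lemma bits_sum k p : (k < 2 ^ p)%N -> k = (\sum_(i < p) odd (k %/ 2 ^ i) * 2 ^ i)%N.
Proof.
by move=> kp; rewrite {1}(@digits_sum 2 k p) //; apply: eq_bigr => i _; rewrite /digit modn2.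
Qed.

Variable p : nat.

Definition ulp_exp (q : int) : int := q - p%:Z + 1.

Definition normal_binade q (u : R) :=
  [&& pow2 q <= u, u < pow2 (q + 1), fmin p <= u & u < fmax p].

(** Here [h] measures [u] in half units in the last place. An odd floor of [h] means that the
    remainder is at least half a unit; given this, [fodd (- h)] holds exactly at a tie. *)
Definition round_up b q (u : R) :=
  let h := u / pow2 (ulp_exp q - 1) in
  fodd h && (fodd (- h) ==> if (1 < p)%N then fodd (u / pow2 (ulp_exp q)) else tie p b (ulp_exp q)).

Lemma rnd_normal_bits b q v : (0 < p)%N -> let u := sgn b * v in normal_binade q u ->
  rnd p v = sgn b * (\sum_(i < p) (fodd (u / pow2 (ulp_exp q + i%:Z)))%:R * pow2 (ulp_exp q + i%:Z)
    + (round_up b q u)%:R * pow2 (ulp_exp q)).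
Proof.
move=> p0 u /and4P[u1 u2 u3 u4]; rewrite /round_up; set e := ulp_exp q.
have E0 := pow2_gt0 e.
have pp := pow2_pred p0; have pp0 : (0 < 2 ^ p.-1)%N by rewrite expn_gt0.
have qE : pow2 q = (2 ^ p.-1)%:R * pow2 e.
  by rewrite -pow2_nat -pow2D; congr pow2; rewrite /e /ulp_exp; lia.
have q1E : pow2 (q + 1) = (2 ^ p)%:R * pow2 e.
  by rewrite -pow2_nat -pow2D; congr pow2; rewrite /e /ulp_exp; lia.
have u0 : 0 <= u by apply: le_trans u1; apply/ltW/pow2_gt0.
have x0 : 0 <= u / pow2 e by rewrite divr_ge0 // ltW.
pose k := `|Num.floor (u / pow2 e)|%N.
have kE : Num.floor (u / pow2 e) = k%:Z by rewrite gez0_abs ?floor_ge0.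
have ku : k%:R * pow2 e <= u < k.+1%:R * pow2 e.
  rewrite -ler_pdivlMr // -ltr_pdivrMr //; apply/andP; split.
    by rewrite -[k%:R]/(k%:Z%:~R) -kE floor_le.
  by rewrite -[k.+1%:R]/(k.+1%:Z%:~R) -addn1 PoszD -kE floorD1_gt.
have /andP[ku1 ku2] := ku.
have kp : (2 ^ p.-1 <= k < 2 ^ p)%N.
  apply/andP; split; last first.
    rewrite -(ltr_nat R) -(ltr_pM2r E0) -q1E; exact: le_lt_trans u2.
  rewrite -ltnS -(ltr_nat R) -(ltr_pM2r E0) -qE; exact: le_lt_trans ku2.
have e1 : - (2 ^ p)%:Z <= e.
  have : pow2 (p.-1%:Z - (2 ^ p)%:Z) < pow2 (q + 1).
    by rewrite pow2D pow2_nat; apply: le_lt_trans u2.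
  rewrite ltNge => H; rewrite leNgt; apply/negP => H'; case/negP: H; apply: pow2_le.
  by move: H'; rewrite /e /ulp_exp; lia.
have mE : fmax p = ((2 ^ p)%:R - 1) * pow2 ((2 ^ p)%:Z - 1).
  by rewrite /fmax /fpn_val /= rmorphB /=.
have e2 : e <= (2 ^ p)%:Z - 1.
  rewrite leNgt; apply/negP => H.
  have : pow2 ((2 ^ p)%:Z - 1 + 1) <= pow2 e by apply: pow2_le; lia.
  rewrite pow2S => H1.
  have : (2 ^ p)%:R * pow2 ((2 ^ p)%:Z - 1) <= u.
    apply: le_trans u1; rewrite qE.
    have -> : (2 ^ p)%:R = (2 ^ p.-1)%:R * 2 :> R by rewrite pp natrM mulrC.
    by rewrite -mulrA ler_wpM2l ?ler0n.
  by move: u4 (pow2_gt0 ((2 ^ p)%:Z - 1)); rewrite mE mulrBl mul1r => ? ? ?; lra.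
have top : (k.+1 < 2 ^ p)%N || (e < (2 ^ p)%:Z - 1).
  case: ltnP => //= kt; rewrite lt_neqAle e2 andbT; apply/eqP => eE.
  have : u < fmax p by [].
  rewrite ltNge mE -eE; case/negP; apply: le_trans ku1; rewrite ler_wpM2r ?(ltW E0) //.
  by rewrite lerBlDr natr1 ler_nat.
rewrite (@rnd_normal p b v e k) ?e1 // -/u; congr (_ * _); rewrite mulrDl; congr (_ + _).
  rewrite {1}(@bits_sum k p); last by case/andP: kp.
  rewrite natr_sum big_distrl; apply: eq_bigr => i _ /=.
  rewrite natrM -mulrA [pow2 (e + _)]pow2D pow2_nat [_ * pow2 e]mulrC; congr (_ %:R * _).
  by rewrite invfM mulrA /fodd floor_div_nat ?expn_gt0 // kE.
congr (_%:R * _); set h := u / pow2 (e - 1).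
have hE : h = 2 * (u / pow2 e).
  rewrite /h (_ : e = (e - 1) + 1); last by rewrite subrK.
  rewrite addrK pow2S; field; exact/lt0r_neq0/pow2_gt0.
have E1 : pow2 (e - 1) = pow2 e / 2.
  by have := pow2S (e - 1); rewrite subrK => ->; lra.
set c := k%:R * pow2 e + _.
have hk : u = h * (pow2 e / 2) by rewrite hE; field; apply: lt0r_neq0.
have tieE : fodd (u / pow2 e) = odd k by rewrite /fodd kE.
have h1 : 2 * k%:R <= h by rewrite hE ler_pM2l // ler_pdivlMr.
have h2 : h < 2 * k%:R + 2.
  rewrite hE (_ : _ + 2 = 2 * k.+1%:R); last by rewrite -natr1; lra.
  by rewrite ltr_pM2l // ltr_pdivrMr.
have cE : c = (2 * k%:R + 1) * (pow2 e / 2) by rewrite /c; lra.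
have e20 : 0 < pow2 e / 2 by rewrite divr_gt0.
have [m kz om] : exists2 m : nat, m%:Z%:~R = 2 * k%:R :> R & odd m = false.
  by exists (2 * k)%N; [rewrite -[LHS]/((2 * k)%:R) natrM|rewrite oddM].
rewrite {1 2}hk cE ltr_pM2r // (inj_eq (mulIf (lt0r_neq0 e20))).
case: (ltP h (2 * k%:R + 1)) => hc.
  have Fh : Num.floor h = m.
    by apply: floor_bounds; rewrite ?rmorphD /= kz.
  by rewrite {1}/fodd Fh /= om /= ltNge ltW //= lt_eqF.
have Fh : Num.floor h = (m + 1)%N.
  by apply: floor_bounds; rewrite ?PoszD ?rmorphD /= kz; lra.
have oh : fodd h by rewrite /fodd Fh /= oddD om.
rewrite oh /= tieE; have := fodd_opp h; rewrite oh eqb_id => ->.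
rewrite Fh PoszD rmorphD /= kz le_eqVlt eq_sym in hc *.
case: eqVneq hc => [->|hne] /= hc; first by rewrite ltxx.
by rewrite hc.
Qed.

Definition small_up b (v : R) := (fmin p <= sgn b * rnd p v) && (sgn b * v < fmin p).

Lemma fmin_lt_fmax : (0 < p)%N -> fmin p <= fmax p.
Proof.
move=> p0; apply: fpn_le_fmax; rewrite mem_fpn_list.
have := pow2_pred p0; have : (0 < 2 ^ p.-1)%N by rewrite expn_gt0.
lia.
Qed.

(** The binade of the input is not known in advance, so every candidate [q] contributes its bits
    masked by the test for [q]. All exponents thereby become constants of the sum. *)
Definition rnd_part (Q : seq int) b v :=
  sgn b * fmin p * (small_up b v)%:R + sgn b * fmax p * (fmax p <= sgn b * v)%R%:R +
  \sum_(q <- Q) (\sum_(i < p) sgn b * pow2 (ulp_exp q + i%:Z) *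
      (normal_binade q (sgn b * v) && fodd (sgn b * v / pow2 (ulp_exp q + i%:Z)))%:R +
    sgn b * pow2 (ulp_exp q) * (normal_binade q (sgn b * v) && round_up b q (sgn b * v))%:R).

(** The part for the wrong sign vanishes and at most one mask is true in the other, so the
    distinction by sign and magnitude becomes a plain sum. *)
Lemma rnd_decomp v (Q : seq int) : (0 < p)%N -> uniq Q ->
  (forall q, pow2 q <= `|v| < pow2 (q + 1) -> q \in Q) ->
  rnd p v = rnd_part Q false v + rnd_part Q true v.
Proof.
move=> p0 uQ Qv; pose S b := rnd_part Q b v; rewrite -/(S false) -/(S true).
have m0 := fmin_gt0 p; have mM := fmin_lt_fmax p0.
have neg b : sgn b * v <= 0 -> S b = 0.
  move=> u0; rewrite /S /rnd_part.
  have -> : small_up b v = false.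
    apply/negbTE; rewrite negb_and -ltNge (le_lt_trans _ m0) //.
    have [v0|v0] := leP v 0.
      have := rnd_mono p v0; rewrite rnd0; move: u0; rewrite /sgn.
      case: b => /=; rewrite ?expr0 ?expr1; last by lra.
      rewrite mulN1r oppr_le0 => v0'; have -> : v = 0 by lra.
      by rewrite rnd0 mulr0.
    have := rnd_mono p (ltW v0); rewrite rnd0; move: u0; rewrite /sgn.
    by case: b => /=; rewrite ?expr0 ?expr1; lra.
  have -> : (fmax p <= sgn b * v) = false by apply/negbTE; rewrite -ltNge; lra.
  rewrite !mulr0 addr0 add0r big1 // => q _.
  have -> : normal_binade q (sgn b * v) = false.
    by apply/negbTE; rewrite /normal_binade !negb_and -ltNge (le_lt_trans u0) // pow2_gt0.
  by rewrite /= mulr0 addr0 big1 // => i _; rewrite mulr0.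
have pos b : 0 < sgn b * v -> S b = rnd p v.
  move=> u0; rewrite /S /rnd_part /small_up.
  have [um|mu] := ltP (sgn b * v) (fmin p).
    have -> : (fmax p <= sgn b * v) = false by apply/negbTE; rewrite -ltNge; lra.
    have nb q : normal_binade q (sgn b * v) = false.
      by rewrite /normal_binade (leNgt (fmin p)) um /= !andbF.
    rewrite andbT mulr0 addr0 big1 => [|q _]; last first.
      by rewrite nb mulr0 addr0 big1 // => i _; rewrite mulr0.
    rewrite [RHS](@rnd_underflow p b) ?um ?(ltW u0) // addr0.
    by case: ifP => _; rewrite ?mulr1 ?mulr0.
  rewrite andbF mulr0 add0r.
  have [Mu|uM] := leP (fmax p) (sgn b * v).
    rewrite mulr1 big1 => [|q _]; first by rewrite addr0 (rnd_overflow Mu).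
    have -> : normal_binade q (sgn b * v) = false by rewrite /normal_binade (ltNge _ (fmax p)) Mu !andbF.
    by rewrite mulr0 addr0 big1 // => i _; rewrite mulr0.
  rewrite mulr0 add0r; have [q qu] := exists_binade u0.
  have qQ : q \in Q.
    apply: Qv; have -> // : `|v| = sgn b * v.
    by rewrite -(gtr0_norm u0) normrM normr_sign mul1r.
  have nq : normal_binade q (sgn b * v) by case/andP: qu => ? ?; apply/and4P; split.
  rewrite (bigD1_seq q) //= [X in _ + X]big1 ?addr0 => [|q' q'q].
    rewrite nq [RHS](rnd_normal_bits p0 nq) mulrDr big_distrr /=.
    congr (_ + _); last by rewrite -mulrA [pow2 _ * _]mulrC.
    by apply: eq_bigr => i _; rewrite -mulrA [pow2 _ * _]mulrC.
  have -> : normal_binade q' (sgn b * v) = false.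
    apply/negP => /and4P[a1 a2 _ _]; case/eqP: q'q.
    by apply: binade_uniq qu; rewrite a1.
  by rewrite mulr0 addr0 big1 // => i _; rewrite mulr0.
case: (ltrgtP v 0) => v0.
- rewrite (neg false) ?(pos true) /sgn ?expr0 ?expr1; first by rewrite add0r.
    by lra.
  by lra.
- rewrite (neg true) ?(pos false) /sgn ?expr0 ?expr1; first by rewrite addr0.
    by lra.
  by lra.
- by rewrite !neg ?v0 ?mulr0 // addr0 rnd0.
Qed.
End Bits.

(** * Real numbers given by constant-depth bits *)

Section Forms.
Local Open Scope ring_scope.
Local Notation R := Defs.R.

Lemma tc_threshold_seq : exists k, forall n d z (I : eqType) (r : seq I) (a : I -> R) (th : R) F,
  (size r <= z)%N -> (forall i, i \in r -> tc n d z (F i)) ->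
  tc n (d + 11) ((z + 2) ^ k) (fun w => th <= \sum_(i <- r) a i * (F i w)%:R).
Proof.
have [k tck] := tc_threshold; exists k => n d z I r a th F rz H.
case: r rz H => [|i0 r'] rz H.
  apply: eq_computable (tck R n d z 0%N (fun=> 0) th (fun _ _ => true) _ _) => // w _.
  by rewrite big_nil big_ord0.
set r := i0 :: r' in rz H *.
apply: eq_computable (tck R n d z (size r) (fun t => a (nth i0 r t)) th (fun t => F (nth i0 r t)) rz _).
  by move=> w _; rewrite (big_nth i0) big_mkord.
by move=> t tr; apply: H; apply: mem_nth.
Qed.

(* The real [X w] is a sum of constants of the form [s 2^e], with [s] short and [e]
   arbitrary, selected by constant-depth bits of [w]. *)
Definition bitreal n d z (X : seq bool -> R) :=
  exists (I : eqType) (r : seq I) (F : I -> seq bool -> bool) (s e : I -> int),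
  [/\ (size r <= z)%N, forall i, i \in r -> (`|s i| <= 2 ^ z)%N,
      forall i, i \in r -> tc n d z (F i) &
      forall w, size w = n -> X w = \sum_(i <- r) (s i)%:~R * pow2 (e i) * (F i w)%:R].

Lemma bitreal_le n d d' z z' X : (d <= d')%N -> (z <= z')%N -> bitreal n d z X -> bitreal n d' z' X.
Proof.
move=> dd zz [I [r [F [s [e [rz sz tF XE]]]]]]; exists I, r, F, s, e; split=> //.
- exact: leq_trans zz.
- by move=> i /sz; move/leq_trans; apply; rewrite leq_exp2l.
- by move=> i /tF; apply: computable_le.
Qed.

Lemma eq_bitreal n d z X Y : (forall w, size w = n -> X w = Y w) -> bitreal n d z X -> bitreal n d z Y.
Proof.
move=> XY [I [r [F [s [e [rz sz tF XE]]]]]]; exists I, r, F, s, e; split=> //.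
by move=> w sw; rewrite -XY // XE.
Qed.

Lemma bitreal0 n d z : bitreal n d z (fun=> 0).
Proof.
by exists nat, [::], (fun _ _ => true), (fun=> 0), (fun=> 0); split=> // w _; rewrite big_nil.
Qed.

Lemma bitreal_mono n d z (s e : int) G : (0 < z)%N -> (`|s| <= 2 ^ z)%N -> tc n d z G ->
  bitreal n d z (fun w => s%:~R * pow2 e * (G w)%:R).
Proof.
move=> z0 sz tG; exists nat, [:: 0%N], (fun=> G), (fun=> s), (fun=> e); split=> // w _.
by rewrite big_seq1.
Qed.

Lemma bitreal_add n d z z' X Y : bitreal n d z X -> bitreal n d z' Y ->
  bitreal n d (z + z') (fun w => X w + Y w).
Proof.
move=> [I [r [F [s [e [rz sz tF XE]]]]]] [I' [r' [F' [s' [e' [rz' sz' tF' XE']]]]]].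
exists (I + I')%type, ([seq inl i | i <- r] ++ [seq inr i | i <- r']),
  (fun x => match x with inl i => F i | inr i => F' i end),
  (fun x => match x with inl i => s i | inr i => s' i end),
  (fun x => match x with inl i => e i | inr i => e' i end); split.
- by rewrite size_cat !size_map leq_add.
- move=> x; rewrite mem_cat => /orP[] /mapP[i ir ->].
    by apply: leq_trans (sz i ir) _; rewrite leq_exp2l // leq_addr.
  by apply: leq_trans (sz' i ir) _; rewrite leq_exp2l // leq_addl.
- move=> x; rewrite mem_cat => /orP[] /mapP[i ir ->].
    by apply: computable_le (tF i ir); rewrite ?leq_addr.
  by apply: computable_le (tF' i ir); rewrite ?leq_addl.
- by move=> w sw; rewrite big_cat !big_map XE ?XE'.
Qed.

Lemma bitreal_sum n d z (I : eqType) (r : seq I) (X : I -> seq bool -> R) :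
  (forall i, i \in r -> bitreal n d z (X i)) ->
  bitreal n d (size r * z) (fun w => \sum_(i <- r) X i w).
Proof.
elim: r => [|i r IH] H.
  by apply: eq_bitreal (bitreal0 n d _) => w _; rewrite big_nil.
apply: eq_bitreal (bitreal_add (H i (mem_head _ _)) (IH _)) => [w _|i' ir].
  by rewrite big_cons.
by apply: H; rewrite inE ir orbT.
Qed.

Lemma bitreal_scale n d z (s e : int) X : (`|s| <= 2 ^ z)%N -> bitreal n d z X ->
  bitreal n d (z + z) (fun w => s%:~R * pow2 e * X w).
Proof.
move=> sz [I [r [F [s' [e' [rz sz' tF XE]]]]]].
exists I, r, F, (fun i => s * s' i), (fun i => e + e' i); split.
- by apply: leq_trans rz (leq_addr _ _).
- by move=> i ir; rewrite abszM expnD leq_mul // sz'.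
- by move=> i ir; apply: computable_le (tF i ir); rewrite ?leq_addr.
- move=> w sw; rewrite XE // big_distrr; apply: eq_bigr => i _ /=.
  by rewrite rmorphM /= pow2D; ring.
Qed.

(** There are finitely many inputs of length [n], so on the attained values an upward closed [P] is
    a threshold at the least accepted one, which is hardwired. *)
Lemma tc_bitreal_up : exists k, forall n d z X (c : R) (P : R -> bool), bitreal n d z X ->
  (forall x y, x <= y -> P x -> P y) ->
  tc n (d + 11) ((z + 2) ^ k) (fun w => P (c * X w)).
Proof.
have [k tck] := tc_threshold_seq; exists k => n d z X c P [I [r [F [s [e [rz sz tF XE]]]]]] Pup.
have [t0 Pt0|N] := pickP (fun t : n.-tuple bool => P (c * X t)); last first.
  apply: (eq_computable (f := fun=> false)) => [w sw|].
    by have := N (Tuple (introT eqP sw)); rewrite /= => ->.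
  apply: (computable_le _ _ (@tc_const n false)); first by rewrite addnS.
  by rewrite expn_gt0 addn2.
case: (@arg_minP _ _ _ t0 (fun t : n.-tuple bool => P (c * X t)) (fun t => c * X t) Pt0) => t1 Pt1 t1min.
apply: eq_computable (tck n d z I r (fun i => c * ((s i)%:~R * pow2 (e i))) (c * X t1) F rz tF) => w sw.
have -> : \sum_(i <- r) c * ((s i)%:~R * pow2 (e i)) * (F i w)%:R = c * X w.
  by rewrite XE // big_distrr; apply: eq_bigr => i _; rewrite -mulrA.
apply/idP/idP => [H|Pw]; first exact: Pup H Pt1.
exact: (t1min (Tuple (introT eqP sw)) Pw).
Qed.

Lemma oddz_add (x y : int) : odd (absz (x + y)%R) = odd `|x|%N (+) odd `|y|%N.
Proof. lia. Qed.

Lemma oddz_sum (I : eqType) (r : seq I) (A : I -> int) (F : I -> bool) :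
  odd (absz (\sum_(i <- r) A i * (F i)%:R)%R) = odd (count F [seq i <- r | odd `|A i|%N]).
Proof.
elim: r => [|i r IH]; first by rewrite big_nil.
rewrite big_cons oddz_add IH /=; case: ifP => oA /=.
  by rewrite oddD; case: (F i); rewrite ?mulr1 ?mulr0 ?oA.
by case: (F i); rewrite ?mulr1 ?mulr0 ?oA.
Qed.

(** The fractional parts sum to a number between 0 and [size r], so their carry into the integer
    part is the number of thresholds among 1, ..., [size r] that they reach. *)
Lemma floor_sum_frac (I : eqType) (r : seq I) (a : I -> R) (F : I -> bool) :
  let S := \sum_(i <- r) (a i - (Num.floor (a i))%:~R) * (F i)%:R in
  Num.floor (\sum_(i <- r) a i * (F i)%:R) =
  \sum_(i <- r) Num.floor (a i) * (F i)%:R + (count (fun k => k%:R <= S) (iota 1 (size r)))%:Z.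
Proof.
move=> S; have SE : \sum_(i <- r) a i * (F i)%:R =
    (\sum_(i <- r) Num.floor (a i) * (F i)%:R)%:~R + S.
  rewrite rmorph_sum -big_split; apply: eq_bigr => i _ /=.
  by rewrite rmorphM /=; case: (F i) => /=; ring.
have S0 : 0 <= S.
  by apply: sumr_ge0 => i _; rewrite mulr_ge0 ?ler0n // subr_ge0 floor_le.
have Sr : S <= (size r)%:R.
  rewrite -sum1_size natr_sum; apply: ler_sum => i _.
  have := floorD1_gt (a i); rewrite rmorphD /= => f1; have := floor_le (a i) => f2.
  by case: (F i) => /=; lra.
rewrite SE floorDzr ?intr_int // intrKfloor; congr (_ + _).
pose m := `|Num.floor S|%N; have mE : Num.floor S = m by rewrite gez0_abs ?floor_ge0.
have mr : (m <= size r)%N.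
  by rewrite -(ler_nat R); apply: le_trans Sr; rewrite -[m%:R]/(m%:Z%:~R) -mE floor_le.
rewrite mE; congr Posz; rewrite -(subnKC mr) iotaD count_cat.
rewrite (eq_in_count (a2 := predT)) => [|k]; last first.
  rewrite mem_iota => /andP[_ km]; apply: le_trans (_ : m%:R <= _); first by rewrite ler_nat; lia.
  by rewrite -[m%:R]/(m%:Z%:~R) -mE floor_le.
rewrite count_predT size_iota (eq_in_count (a2 := pred0)) ?count_pred0 ?addn0 // => k.
rewrite mem_iota => /andP[km _]; apply/negbTE; rewrite -ltNge.
have := floorD1_gt S; rewrite mE => /lt_le_trans; apply.
by rewrite -PoszD -[(_%:Z)%:~R]/(_%:R) ler_nat; lia.
Qed.

(** Of the integer parts only the parities matter, and the fractional parts enter real thresholds;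
    hence the size depends neither on the exponents nor on [c]. *)
Lemma tc_bitreal_odd : exists k, forall n d z X (c : R), bitreal n d z X ->
  tc n (d + 17) ((z + 2) ^ k) (fun w => fodd (c * X w)).
Proof.
have [a tca] := tc_threshold_seq; have [b tcb] := tc_count.
have [k pk] : poly_bounded (fun z => (z + z + (z + 2) ^ a + 2) ^ b)%N by poly_bounded_tac.
exists k => n d z X c [I [r [F [s [e [rz sz tF XE]]]]]].
pose A i : R := c * ((s i)%:~R * pow2 (e i)).
pose S w : R := \sum_(i <- r) (A i - (Num.floor (A i))%:~R) * (F i w)%:R.
pose r' : seq (I + nat) :=
  [seq inl i | i <- [seq i <- r | odd `|Num.floor (A i)|%N]] ++ [seq inr j | j <- iota 1 (size r)].
pose G (x : I + nat) w := match x with inl i => F i w | inr j => j%:R <= S w end.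
apply: (eq_computable (f := fun w => odd (count (G^~ w) r'))) => [w sw|].
  rewrite count_cat !count_map XE // big_distrr /=.
  under [in RHS]eq_bigr => i _ do rewrite mulrA.
  by rewrite /fodd (floor_sum_frac r A (F^~ w)) oddz_add oddz_sum oddD.
apply: (computable_le (leqnn _) (pk z)); rewrite (addnA d 11 6); apply: tcb.
  rewrite size_cat !size_map size_iota; apply: leq_trans (leq_addr _ _); rewrite leq_add //.
  by rewrite size_filter; apply: leq_trans (count_size _ _) rz.
move=> x; rewrite mem_cat => /orP[] /mapP[].
  move=> i + ->; rewrite mem_filter => /andP[_ ir].
  by apply: (computable_le _ _ (tF i ir)); lia.
move=> j _ ->; apply: (computable_le (leqnn _) _ (tca n d z I r _ j%:R F rz tF)); lia.
Qed.

(** The factor [rho] is an arbitrary real so as to cover the division in the average readout, whose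
    reciprocal need not have a short significand. *)
Lemma bitreal_rnd : exists k dd, forall n d z p X (rho : R), (p <= z)%N -> bitreal n d z X ->
  bitreal n (d + dd) ((z + 2) ^ k) (fun w => rnd p (rho * X w)).
Proof.
have [ku tcu] := tc_bitreal_up; have [ko tco] := tc_bitreal_odd.
pose Z z := ((z + 2) ^ ku + (z + 2) ^ ko + z + 1)%N.
pose Z1 z := (2 * (2 * (2 * Z z + 7) + 3) + 7)%N.
pose Z2 z := (Z1 z + Z1 z + z * (z + z + 3) * (z * Z1 z + Z1 z))%N.
have [k pk] : poly_bounded (fun z => Z2 z + Z2 z)%N by rewrite /Z2 /Z1 /Z; poly_bounded_tac.
exists k, 21%N => n d z p X rho pz fX; apply: (bitreal_le (leqnn _) (pk z)).
case: p pz => [|p'] pz.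
  by apply: eq_bitreal (bitreal0 n _ _) => w _; rewrite rnd_prec0.
set p := p'.+1 in pz *; have p0 : (0 < p)%N by [].
(* By [lead_exponent] each summand accounts for at most [z + size r + 3] binades of the product; for
   [rho = 0] the product lies in no binade at all. *)
have [Q [uQ sQ QX]] : exists Q, [/\ uniq Q, (size Q <= z * (z + z + 3))%N &
    forall w q, size w = n -> pow2 q <= `|rho * X w| < pow2 (q + 1) -> q \in Q].
  have [rho0|rho0] := eqVneq rho 0.
    exists [::]; split=> // w q _; rewrite rho0 mul0r normr0 => /andP[H _].
    by have := pow2_gt0 q; lra.
  have [|r0 r0E] := @exists_binade `|rho|; first by rewrite normr_gt0.
  have [I [r [F [s [e [rz sz tF XE]]]]]] := fX.
  exists (undup [seq e i + r0 - 1 + j%:Z | i <- r, j <- iota 0 (z + size r + 3)]); split.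
  - exact: undup_uniq.
  - apply: leq_trans (size_undup _) _; rewrite size_allpairs size_iota leq_mul //; lia.
  move=> w q sw; rewrite XE // => qX.
  have [i ir qi] := lead_exponent sz r0E qX; rewrite mem_undup.
  apply/allpairsP; exists (i, absz (q - e i - r0 + 1)%R); split=> //=; last by lia.
  by rewrite mem_iota; lia.
apply: (eq_bitreal (X := fun w => rnd_part p Q false (rho * X w) + rnd_part p Q true (rho * X w))).
  by move=> w sw; rewrite -rnd_decomp // => q; apply: QX.
suff part b : bitreal n (d + 21) (Z2 z) (fun w => rnd_part p Q b (rho * X w)).
  by apply: bitreal_add; apply: part.
pose c := sgn b * rho.
have up (P : R -> bool) : (forall x y, x <= y -> P x -> P y) ->
    tc n (d + 17) (Z z) (fun w => P (sgn b * (rho * X w))).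
  move=> Pup; apply: (eq_computable (f := fun w => P (c * X w))) => [w _|]; first by rewrite /c mulrA.
  by apply: computable_le (tcu n d z X c P fX Pup); rewrite /Z; lia.
have geq th : tc n (d + 17) (Z z) (fun w => th <= sgn b * (rho * X w)).
  by apply: up => x y xy; move/le_trans; apply.
have ltq th : tc n (d + 18) (Z z + 2) (fun w => sgn b * (rho * X w) < th).
  by rewrite addnS; apply: eq_computable (tc_not (geq th)) => w _; rewrite ltNge.
have {}geq th : tc n (d + 18) (Z z + 2) (fun w => th <= sgn b * (rho * X w)).
  by apply: computable_le (geq th); lia.
have od u : tc n (d + 17) (Z z) (fun w => fodd (sgn b * (rho * X w) / u)).
  apply: (eq_computable (f := fun w => fodd (c / u * X w))) => [w _|].
    by congr fodd; rewrite /c; ring.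
  by apply: computable_le (tco n d z X (c / u) fX); rewrite /Z; lia.
have tc_small : tc n (d + 19) (2 * (Z z + 2) + 3) (fun w => small_up p b (rho * X w)).
  rewrite addnS; apply: tc_and; last exact: ltq.
  (* Conjugating [rnd p] by the sign keeps it increasing, so this too is a threshold. *)
  have H : tc n (d + 17) (Z z) (fun w => fmin p <= sgn b * rnd p (sgn b * (sgn b * (rho * X w)))).
    apply: (up (fun x => fmin p <= sgn b * rnd p (sgn b * x))) => x y xy.
    move/le_trans; apply; rewrite /sgn; case: (b) => /=.
      by rewrite expr1 !mulN1r lerN2 rnd_mono // lerN2.
    by rewrite expr0 !mul1r rnd_mono.
  apply: computable_le (eq_computable _ H); try lia.
  by move=> w _; rewrite sgnK.
have tc_nb q : tc n (d + 20) (2 * (2 * (Z z + 2) + 3) + 3)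
    (fun w => normal_binade p q (sgn b * (rho * X w))).
  rewrite addnS; apply: (eq_computable (f := fun w => (pow2 q <= sgn b * (rho * X w)) &&
      (sgn b * (rho * X w) < pow2 (q + 1)) && ((fmin p <= sgn b * (rho * X w)) &&
      (sgn b * (rho * X w) < fmax p)))) => [w _|]; first by rewrite /normal_binade -!andbA.
  by apply: tc_and; rewrite addnS; apply: tc_and; first [exact: geq|exact: ltq].
have tc_bit q u : tc n (d + 21) (Z1 z)
    (fun w => normal_binade p q (sgn b * (rho * X w)) && fodd (sgn b * (rho * X w) / u)).
  rewrite addnS; apply: computable_le (leqnn _) _ (tc_and (tc_nb q) (computable_le _ _ (od u))); rewrite ?/Z1; lia.
have tc_up q : tc n (d + 21) (Z1 z)
    (fun w => normal_binade p q (sgn b * (rho * X w)) && round_up p b q (sgn b * (rho * X w))).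
  rewrite addnS; apply: computable_le (leqnn _) _ (tc_and (tc_nb q) (_ : tc n (d + 20) _ _)).
    by rewrite /Z1; lia.
  pose t w := if (1 < p)%N then fodd (sgn b * (rho * X w) / pow2 (ulp_exp p q)) else tie p b (ulp_exp p q).
  have tt : tc n (d + 18) (Z z + 2) t.
    rewrite /t; case: (1 < p)%N; first by apply: computable_le (od _); lia.
    by apply: (computable_le _ _ (@tc_const n _)); rewrite /Z; lia.
  set h := pow2 (ulp_exp p q - 1).
  have oh : tc n (d + 18) (Z z + 2) (fun w => ~~ fodd (- (sgn b * (rho * X w) / h))).
    rewrite addnS; apply: tc_not; apply: eq_computable (od (- h)) => w _.
    by rewrite invrN mulrN.
  apply: (eq_computable (f := fun w => fodd (sgn b * (rho * X w) / h) &&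
      (~~ fodd (- (sgn b * (rho * X w) / h)) || t w))) => [w _|].
    by rewrite /round_up implybE.
  rewrite addnS; apply: tc_and; last by rewrite addnS; apply: tc_or.
  by apply: computable_le (od h); lia.
have Z1z : (p <= Z1 z)%N by rewrite /Z1 /Z; lia.
have Z10 : (0 < Z1 z)%N by apply: leq_trans Z1z.
have f1 : bitreal n (d + 21) (Z1 z) (fun w => sgn b * fmin p * (small_up p b (rho * X w))%:R).
  apply: (eq_bitreal (X := fun w => ((-1) ^+ b * (2 ^ p.-1)%N%:Z)%:~R * pow2 (- (2 ^ p)%N%:Z) *
      (small_up p b (rho * X w))%:R)) => [w _|].
    by rewrite rmorphM rmorph_sign -[in LHS](mulrA ((-1) ^+ b)).
  apply: bitreal_mono => //; last by apply: computable_le tc_small; rewrite /Z1; lia.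
  by rewrite abszMsign leq_exp2l //= ; lia.
have f2 : bitreal n (d + 21) (Z1 z) (fun w => sgn b * fmax p * (fmax p <= sgn b * (rho * X w))%R%:R).
  apply: (eq_bitreal (X := fun w => ((-1) ^+ b * ((2 ^ p)%N%:Z - 1))%:~R * pow2 ((2 ^ p)%N%:Z - 1) *
      (fmax p <= sgn b * (rho * X w))%R%:R)) => [w _|].
    by rewrite rmorphM rmorph_sign -[in LHS](mulrA ((-1) ^+ b)).
  apply: bitreal_mono => //; last by apply: computable_le (geq _); rewrite /Z1; lia.
  rewrite abszMsign; apply: leq_trans (_ : 2 ^ p <= _)%N; last by rewrite leq_exp2l.
  by have : (0 < 2 ^ p)%N by [rewrite expn_gt0]; lia.
have f3 e G : tc n (d + 21) (Z1 z) G -> bitreal n (d + 21) (Z1 z) (fun w => sgn b * pow2 e * (G w)%:R).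
  move=> tG; apply: (eq_bitreal (X := fun w => ((-1) ^+ b)%:~R * pow2 e * (G w)%:R)) => [w _|].
    by rewrite rmorph_sign.
  by apply: bitreal_mono => //; rewrite absz_sign expn_gt0.
apply: bitreal_add; first exact: bitreal_add.
have f4 q : bitreal n (d + 21) (z * Z1 z + Z1 z) (fun w =>
    \sum_(i < p) sgn b * pow2 (ulp_exp p q + i%:Z) *
      (normal_binade p q (sgn b * (rho * X w)) &&
         fodd (sgn b * (rho * X w) / pow2 (ulp_exp p q + i%:Z)))%:R +
    sgn b * pow2 (ulp_exp p q) *
      (normal_binade p q (sgn b * (rho * X w)) && round_up p b q (sgn b * (rho * X w)))%:R).
  apply: bitreal_add; last exact: f3.
  apply: (bitreal_le (leqnn _) _ (bitreal_sum (r := index_enum 'I_p) (z := Z1 z) _)).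
    have -> : size (index_enum 'I_p) = p by rewrite -[RHS]card_ord cardE enumT.
    by rewrite leq_mul2r pz orbT.
  by move=> i _; apply: f3.
apply: bitreal_le (leqnn _) _ (bitreal_sum (fun q _ => f4 q)).
by rewrite leq_mul2r sQ orbT.
Qed.
End Forms.

(** * Readout and head on selected sums *)

Section Readout.
Local Open Scope ring_scope.
Local Notation R := Defs.R.

Lemma bitreal_mask n d z X G : bitreal n d z X -> tc n d z G ->
  bitreal n d.+1 (2 * z + 3) (fun w => X w * (G w)%:R).
Proof.
move=> [I [r [F [s [e [rz sz tF XE]]]]]] tG.
exists I, r, (fun i w => F i w && G w), s, e; split.
- by apply: leq_trans rz _; lia.
- by move=> i /sz; move/leq_trans; apply; rewrite leq_exp2l //; lia.
- by move=> i ir; apply: tc_and (tF i ir) tG.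
- move=> w sw; rewrite XE // big_distrl; apply: eq_bigr => i _ /=.
  by case: (F i w); case: (G w); rewrite ?mulr1 ?mulr0 ?mul0r.
Qed.

Lemma bitreal_fpn n d z p x : (0 < d)%N -> (0 < z)%N -> (p <= z)%N -> is_fpn p x ->
  bitreal n d z (fun=> x).
Proof.
move=> d0 z0 pz [[s e] [/andP[sp _] ->]].
apply: (eq_bitreal (X := fun w => s%:~R * pow2 e * (true%:R))) => [w _|]; first by rewrite mulr1.
apply: bitreal_mono => //; last by apply: (computable_le _ _ (@tc_const n true)).
have : (2 ^ p <= 2 ^ z)%N by rewrite leq_exp2l.
by case/orP: sp => [/eqP/= ->//|/andP[_ /= ?]]; lia.
Qed.

Lemma bitreal_scale_fpn n d z p c X : (p <= z)%N -> is_fpn p c -> bitreal n d z X ->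
  bitreal n d (z + z) (fun w => c * X w).
Proof.
move=> pz [[s e] [/andP[sp _] ->]] fX; apply: bitreal_scale fX.
have : (2 ^ p <= 2 ^ z)%N by rewrite leq_exp2l.
by case/orP: sp => [/eqP/= ->//|/andP[_ /= ?]]; lia.
Qed.

Lemma tc_bitreal_le : exists k, forall n d z X Y, bitreal n d z X -> bitreal n d z Y ->
  tc n (d + 11) ((z + 2) ^ k) (fun w => X w <= Y w).
Proof.
have [k tck] := tc_bitreal_up.
have [k' pk] : poly_bounded (fun z => (z + (z + 1 + (z + 1)) + 2) ^ k)%N by poly_bounded_tac.
exists k' => n d z X Y fX fY; apply: (computable_le (leqnn _) (pk z)).
apply: eq_computable (tck n d _ _ 1 (fun x => 0 <= x) (bitreal_add fY
  (@bitreal_scale n d (z + 1) (-1) 0 X _ (bitreal_le (leqnn _) (leq_addr _ _) fX))) _).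
- by move=> w _; rewrite mul1r /pow2 expr0z mulr1 rmorphN1 mulN1r subr_ge0.
- by rewrite expn_gt0.
- by move=> x y xy; move/le_trans; apply.
Qed.

Lemma bitreal_relu : exists k, forall n d z X, bitreal n d z X ->
  bitreal n (d + 12) ((z + 2) ^ k) (fun w => relu (X w)).
Proof.
have [k tck] := tc_bitreal_le.
have [k' pk] : poly_bounded (fun z => 2 * (z + (z + 2) ^ k) + 3)%N by poly_bounded_tac.
exists k' => n d z X fX; apply: (bitreal_le (leqnn _) (pk z)); rewrite addnS.
apply: (eq_bitreal (X := fun w => X w * (0 <= X w)%R%:R)) => [w _|].
  by rewrite /relu; case: leP => _; rewrite ?mulr1 ?mulr0.
apply: bitreal_mask; first by apply: bitreal_le fX; lia.
by apply: computable_le (tck n d z _ _ (bitreal0 n d z) fX) => //; apply: leq_addl.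
Qed.

Lemma foldl_max_spec (vs : seq R) : vs != [::] ->
  let m := foldl Num.max (head 0 vs) (behead vs) in m \in vs /\ forall x, x \in vs -> x <= m.
Proof.
case: vs => // v vs _ /=; elim/last_ind: vs => [|vs x [IH1 IH2]].
  by split=> [|x]; rewrite inE // => /eqP->.
rewrite foldl_rcons; set m := foldl _ _ _ in IH1 IH2 *; split.
  rewrite -rcons_cons mem_rcons inE; case: leP => _; rewrite ?eqxx //.
  by rewrite IH1 orbT.
move=> y; rewrite -rcons_cons mem_rcons inE le_max => /predU1P[->|/IH2->//].
by rewrite lexx orbT.
Qed.

(** Exactly one mask is true, that of the least index attaining the maximum; asking smaller indices
    to be strictly smaller in value breaks ties. *)
Lemma max_decomp (r : seq nat) (x : nat -> R) : uniq r -> r != [::] ->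
  foldl Num.max (head 0 [seq x i | i <- r]) (behead [seq x i | i <- r]) =
  \sum_(i <- r) x i * (all (fun j => (x j <= x i) && ((j < i)%N ==> ~~ (x i <= x j))) r)%:R.
Proof.
move=> ur r0; have vs0 : [seq x i | i <- r] != [::] by case: (r) r0.
have [] := foldl_max_spec vs0; set m := foldl _ _ _ => mr mmax.
have ex : exists i, (i \in r) && (x i == m).
  by case/mapP: mr => i ir ->; exists i; rewrite ir eqxx.
case: (ex_minnP ex) => i0 /andP[i0r /eqP xi0] i0min.
have xm j : j \in r -> x j <= m by move=> jr; apply: mmax; apply: map_f.
have all0 : all (fun j => (x j <= x i0) && ((j < i0)%N ==> ~~ (x i0 <= x j))) r.
  apply/allP => j jr; rewrite xi0 xm //=; apply/implyP => ji; apply/negP => mj.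
  have := i0min j; rewrite jr (eqP (_ : x j == m)) ?eqxx => [/(_ isT)|]; first by rewrite leqNgt ji.
  by rewrite eq_le mj xm.
rewrite (bigD1_seq i0) //= all0 mulr1 big_seq_cond big1 ?addr0 ?xi0 // => i /andP[ir ii0].
case: allP => [H|]; last by rewrite mulr0.
exfalso; have /andP[mi _] := H _ i0r; have xi : x i = m by apply/eqP; rewrite eq_le xm // -xi0.
have i0i : (i0 < i)%N by rewrite ltn_neqAle eq_sym ii0 i0min // ir xi eqxx.
by have /andP[_] := H _ i0r; rewrite i0i xi xi0 lexx.
Qed.

Lemma bitreal_max : exists k, forall n d z (r : seq nat) X, uniq r -> r != [::] ->
  (size r <= z)%N -> (forall i, i \in r -> bitreal n d z (X i)) ->
  bitreal n (d + 16) ((z + 2) ^ k)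
    (fun w => foldl Num.max (head 0 [seq X i w | i <- r]) (behead [seq X i w | i <- r])).
Proof.
have [k tck] := tc_bitreal_le; pose Y z := (2 * ((z + 2) ^ k + 2) + 3)%N.
have [k' pk] : poly_bounded (fun z => z * (2 * (z * Y z + z.+1 + z) + 3))%N by rewrite /Y; poly_bounded_tac.
exists k' => n d z r X ur r0 rz fX; apply: (bitreal_le (leqnn _) (pk z)).
apply: (eq_bitreal (X := fun w => \sum_(i <- r) X i w *
    (all (fun j => (X j w <= X i w) && ((j < i)%N ==> ~~ (X i w <= X j w))) r)%:R)) => [w _|].
  by rewrite (max_decomp (X^~ w)).
have C i j : i \in r -> j \in r ->
    tc n (d + 14) (Y z) (fun w => (X j w <= X i w) && ((j < i)%N ==> ~~ (X i w <= X j w))).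
  move=> ir jr; have L := tck n d z _ _ (fX j jr) (fX i ir); have L' := tck n d z _ _ (fX i ir) (fX j jr).
  case: (ltnP j i) => _ /=.
    by apply: (computable_le _ _ (tc_and (computable_le (leqnSn _) (leq_addr 2 _) L) (tc_not L'))); rewrite ?/Y; lia.
  by apply: (eq_computable _ (computable_le _ _ L)) => [w _||]; rewrite ?andbT // ?/Y; lia.
apply: bitreal_le (leqnn _) _ (bitreal_sum (z := 2 * (z * Y z + z.+1 + z) + 3) _).
  by rewrite leq_mul2r rz orbT.
move=> i ir; rewrite addnS; apply: bitreal_mask.
  by apply: bitreal_le (fX i ir); lia.
rewrite addnS; apply: (computable_le (leqnn _) _ (tc_all (fun j jr => C i j ir jr))).
by apply: leq_trans (leq_addr _ _); rewrite leq_add ?leq_mul2r ?rz ?orbT.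
Qed.

Lemma bitreal_sum_ord n d z K (X : nat -> seq bool -> R) :
  (forall i, (i < K)%N -> bitreal n d z (X i)) ->
  bitreal n d (K * z) (fun w => \sum_(i < K) X i w).
Proof.
move=> H; apply: (eq_bitreal (X := fun w => \sum_(i <- iota 0 K) X i w)) => [w _|].
  by rewrite -{1}[K]subn0 -/(index_iota 0 K) big_mkord.
have := @bitreal_sum n d z _ (iota 0 K) X; rewrite size_iota; apply=> i.
by rewrite mem_iota; apply: H.
Qed.

Lemma bitreal_readout : exists k dd, forall n d z N p maxr (B : nat -> bool) H j,
  (N <= z)%N -> (p <= z)%N -> (exists i, (i < N)%N && B i) ->
  (forall i, (i < N)%N -> bitreal n d z (fun w => H w i j)) ->
  bitreal n (d + dd) ((z + 2) ^ k) (fun w => readout p N maxr B (H w) j).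
Proof.
have [k1 bmax] := bitreal_max; have [k2 [dd brnd]] := bitreal_rnd.
pose Y z := ((z * z + z + 2) ^ k2)%N.
have [k pk] : poly_bounded (fun z => (z + 2) ^ k1 + (Y z + z + 2) ^ k2)%N by rewrite /Y; poly_bounded_tac.
exists k, (16 + dd + dd)%N => n d z N p maxr B H j Nz pz exB fH.
apply: (bitreal_le (leqnn _) (pk z)); rewrite /readout.
pose r := [seq i <- iota 0 N | B i].
have rN i : i \in r -> (i < N)%N by rewrite mem_filter mem_iota => /andP[].
have rz : (size r <= z)%N.
  by rewrite size_filter; apply: leq_trans (count_size _ _) _; rewrite size_iota.
case: maxr.
  apply: bitreal_le (bmax n d z r (fun i w => H w i j) _ _ rz _); rewrite ?leq_addr //; try lia.
  - exact/filter_uniq/iota_uniq.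
  - case: exB => i /andP[iN Bi]; apply/eqP => r0.
    by have : i \in r by [rewrite mem_filter Bi mem_iota]; rewrite r0.
  - by move=> i ir; apply: fH (rN i ir).
have fS : bitreal n d (z * z + z) (fun w => \sum_(x <- [seq H w i j | i <- r]) x).
  apply: (eq_bitreal (X := fun w => \sum_(i <- r) H w i j)) => [w _|]; first by rewrite big_map.
  apply: (bitreal_le (leqnn _) _ (bitreal_sum (fun i ir => fH i (rN i ir)))).
  by apply: leq_trans (leq_addr _ _); rewrite leq_mul2r rz orbT.
have fR := brnd n d _ p _ 1 (leq_trans pz (leq_addl _ _)) fS.
have := brnd n (d + dd)%N (Y z + z)%N p _ (rnd p (size r)%:R)^-1 (leq_trans pz (leq_addl _ _))
  (bitreal_le (leqnn _) (leq_addr _ _) fR).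
move/(bitreal_le (_ : _ <= d + (16 + dd + dd))%N (leq_addl ((z + 2) ^ k1)%N _)) => E.
apply: eq_bitreal (E _) => [w _|]; last by lia.
by rewrite mul1r size_map mulrC.
Qed.

Lemma bitreal_head : exists k dd, forall n d z p K W b v x,
  (0 < d)%N -> (0 < z)%N -> (K <= z)%N -> (p <= z)%N ->
  (forall i j, (i < K)%N -> (j < K)%N -> is_fpn p (W i j)) ->
  (forall i, (i < K)%N -> is_fpn p (b i) /\ is_fpn p (v i)) ->
  (forall j, (j < K)%N -> bitreal n d z (fun w => x w j)) ->
  bitreal n (d + dd) ((z + 2) ^ k) (fun w => head_apply p K W b v (x w)).
Proof.
have [k1 relu1] := bitreal_relu; have [k2 [dd brnd]] := bitreal_rnd.
pose r z := ((z + 2) ^ k2)%N.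
pose z1 z := (z * r (z + z) + z)%N.
pose z2 z := (r (z1 z) + z)%N.
pose z3 z := ((r (z2 z) + 2) ^ k1 + z)%N.
pose z4 z := (z * r (z3 z + z3 z) + z)%N.
have [k pk] : poly_bounded (fun z => r (z4 z)) by rewrite /z4 /z3 /z2 /z1 /r; poly_bounded_tac.
have brnd1 n d z p X : (p <= z)%N -> bitreal n d z X ->
    bitreal n (d + dd) (r z) (fun w => rnd p (X w)).
  move=> pz fX; apply: eq_bitreal (brnd n d z p X 1 pz fX) => w _.
  by rewrite mul1r.
exists k, (dd + dd + dd + 12 + dd + dd)%N => n d z p K W b v x d0 z0 Kz pz fW fb fx.
apply: (bitreal_le (leqnn _) (pk z)); rewrite /head_apply /fsum /fmul /fadd.
have mulK m z' X : (forall j, (j < K)%N -> bitreal n m z' (X j)) ->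
    bitreal n m (z * z' + z) (fun w => \sum_(j < K) X j w).
  move=> H; apply: bitreal_le (leqnn _) _ (bitreal_sum_ord H).
  by apply: leq_trans (leq_addr _ _); rewrite leq_mul2r Kz orbT.
have lez z' : (p <= z' + z)%N by apply: leq_trans pz (leq_addl _ _).
have fh i : (i < K)%N -> bitreal n (d + (dd + dd + dd + 12)) (z3 z) (fun w => relu (rnd p
    (rnd p (\sum_(l < K) rnd p (W i l * x w l)) + b i))).
  move=> iK.
  have f1 : bitreal n (d + dd + dd) (r (z1 z)) (fun w => rnd p (\sum_(l < K) rnd p (W i l * x w l))).
    apply/brnd1; first exact: lez.
    apply: (mulK _ _ (fun l w => rnd p (W i l * x w l))) => l lK.
    apply/brnd1; first exact: lez.
    by apply: (bitreal_scale_fpn pz (fW i l iK lK)); apply: fx.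
  have f2 : bitreal n (d + dd + dd + dd) (r (z2 z)) (fun w => rnd p
      (rnd p (\sum_(l < K) rnd p (W i l * x w l)) + b i)).
    apply/brnd1; first exact: lez.
    by apply: bitreal_add f1 (bitreal_fpn n _ z0 pz (fb i iK).1); lia.
  by apply: bitreal_le (relu1 _ _ _ _ f2); [lia|apply: leq_addr].
rewrite !addnA; apply/brnd1; first exact: lez.
apply: (mulK _ _ (fun i w => rnd p (v i * relu (rnd p
    (rnd p (\sum_(l < K) rnd p (W i l * x w l)) + b i))))) => i iK.
apply/brnd1; first exact: leq_trans (lez _) (leq_addr _ _).
by apply: (bitreal_scale_fpn (lez _) (fb i iK).2); have := fh i iK; rewrite !addnA.
Qed.

Lemma tc_bitreal_gt0 : exists k, forall n d z X, bitreal n d z X ->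
  tc n (d + 12) ((z + 2) ^ k) (fun w => 0 < X w).
Proof.
have [k tck] := tc_bitreal_le.
have [k' pk] : poly_bounded (fun z => (z + 2) ^ k + 2)%N by poly_bounded_tac.
exists k' => n d z X fX; apply: (computable_le (leqnn _) (pk z)); rewrite addnS.
apply: eq_computable (tc_not (tck n d z _ _ fX (bitreal0 n d z))) => w _.
by rewrite -ltNge.
Qed.
End Readout.

(** * Locality of message passing *)

Section Locality.
Local Open Scope ring_scope.
Local Notation R := Defs.R.

Definition row_eq N (A A' : graph) i := forall j, (j < N)%N -> A i j = A' i j.

Lemma eq_fsum p N f g : (forall i, (i < N)%N -> f i = g i) -> fsum p N f = fsum p N g.
Proof. by move=> fg; congr rnd; apply: eq_bigr => i _; apply: fg. Qed.

Lemma fsum_single p N f i : (i < N)%N -> (forall l, l != i -> f l = 0) -> fsum p N f = rnd p (f i).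
Proof.
move=> iN f0; congr rnd; rewrite (bigD1 (Ordinal iN)) //= big1 ?addr0 // => l li.
by apply: f0; apply: contra li => /eqP li; apply/eqP/val_inj.
Qed.

Lemma fmul0r p x : fmul p 0 x = 0. Proof. by rewrite /fmul mul0r rnd0. Qed.
Lemma fmulr0 p x : fmul p x 0 = 0. Proof. by rewrite /fmul mulr0 rnd0. Qed.

(** A product with a diagonal matrix has a single nonzero term per entry, and 0 rounds to 0, so the
    rounded sums collapse. *)
Lemma C_GCN_E p N A i k : (i < N)%N -> (k < N)%N ->
  let deg i := fadd p (fsum p N (fun j => indic (A i j))) 1 in
  let inv i := fdiv p 1 (fsqrt p (deg i)) in
  C_GCN p N A i k = rnd p (fmul p (rnd p (fmul p (inv i)
    (if i == k then fadd p (indic (A i k)) 1 else indic (A i k)))) (inv k)).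
Proof.
move=> iN kN deg inv; rewrite /C_GCN /fmm (fsum_single _ kN) ?eqxx => [|l lk]; last first.
  by rewrite (negbTE lk) fmulr0.
rewrite (fsum_single _ iN) ?eqxx // => l li.
by rewrite eq_sym (negbTE li) fmul0r.
Qed.

Definition gat_score p d (a : nat -> R) (W' : mat) slope (X : mat) i j : R :=
  fsum p (2 * d) (fun k => fmul p (a k)
    (if (k < d)%N then leaky p slope (fsum p d (fun l => fmul p (W' k l) (X i l)))
     else leaky p slope (fsum p d (fun l => fmul p (W' (k - d)%N l) (X j l))))).

Lemma C_GAT_E p N d A a W' slope X i j : C_GAT p N d A a W' slope X i j =
  if A i j then fdiv p (fexp p (gat_score p d a W' slope X i j))
    (fsum p N (fun k => if A i k then fexp p (gat_score p d a W' slope X i k) else 0))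
  else 0.
Proof. by []. Qed.

Lemma gat_score_local p d a W' slope (X X' : mat) i j : X i =1 X' i -> X j =1 X' j ->
  gat_score p d a W' slope X i j = gat_score p d a W' slope X' i j.
Proof.
move=> Xi Xj; apply: eq_fsum => k _; apply: (congr1 (fmul p (a k))).
case: (k < d)%N; apply: (congr1 (leaky p slope)); apply: eq_fsum => l _.
  by rewrite Xi.
by rewrite Xj.
Qed.

(** Row [i] alone would not suffice: a GCN entry contains the degree of [k], and the GAT normaliser
    contains the features of all neighbours of [i]. *)
Lemma agg_local p N d L A A' X X' i k : (i < N)%N -> (k < N)%N -> row_eq N A A' i ->
  (forall l, (l < N)%N -> l = i \/ A i l -> row_eq N A A' l /\ X l =1 X' l) ->
  k = i \/ A i k -> agg_matrix p N d A L X i k = agg_matrix p N d A' L X' i k.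
Proof.
move=> iN kN ri H ki; rewrite /agg_matrix; case: (l_agg L) => /=.
- have deg l : row_eq N A A' l ->
      fsum p N (fun j => indic (A l j)) = fsum p N (fun j => indic (A' l j)).
    by move=> rl; apply: eq_fsum => j jN; rewrite rl.
  rewrite (C_GCN_E _ _ iN kN) (C_GCN_E _ _ iN kN) (deg i ri) (deg k (H k kN ki).1).
  by rewrite (ri k kN).
- by rewrite /C_GIN (ri k kN).
rewrite !C_GAT_E -(ri k kN); case Aik: (A i k) => //.
have EE l : (l < N)%N -> A i l -> gat_score p d (l_att L) (l_attW L) (l_slope L) X i l =
    gat_score p d (l_att L) (l_attW L) (l_slope L) X' i l.
  move=> lN Ail; apply: gat_score_local; first exact: (H i iN (or_introl erefl)).2.
  exact: (H l lN (or_intror Ail)).2.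
rewrite (EE k kN Aik); congr fdiv; apply: eq_fsum => l lN; rewrite -(ri l lN).
case Ail: (A i l); last by [].
by rewrite (EE l lN Ail).
Qed.

Lemma agg_far p N d L A X i k : (i < N)%N -> (k < N)%N -> k != i -> ~~ A i k ->
  agg_matrix p N d A L X i k = 0.
Proof.
move=> iN kN ki Aik; rewrite /agg_matrix; case: (l_agg L) => /=.
- by rewrite (C_GCN_E _ _ iN kN) eq_sym (negbTE ki) (negbTE Aik) /= fmulr0 rnd0 fmul0r rnd0.
- by rewrite /C_GIN eq_sym (negbTE ki) (negbTE Aik).
- by rewrite /C_GAT (negbTE Aik).
Qed.

Lemma layer_local p N d L A A' X X' i : (i < N)%N -> row_eq N A A' i ->
  (forall l, (l < N)%N -> l = i \/ A i l -> row_eq N A A' l /\ X l =1 X' l) ->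
  layer_apply p N d A L X i =1 layer_apply p N d A' L X' i.
Proof.
move=> iN ri H j; apply: (congr1 relu); apply: eq_fsum => l _.
apply: (congr1 (fun x => fmul p x (l_W L l j))).
apply: eq_fsum => k kN; have [->|ki] := eqVneq k i.
  rewrite (agg_local _ _ _ iN iN ri H) ?(H i iN _).2 //; [by left|by left].
case Aik: (A i k).
  by rewrite (agg_local _ _ _ iN kN ri H) ?(H k kN _).2 //; right.
by rewrite !agg_far // -?ri ?Aik // !fmul0r.
Qed.

(** Agreement of the rows on the ball of radius [m] around [i], the part of the graph that [m]
    layers can read from [i]. *)
Fixpoint near_eq m N (A A' : graph) i : Prop :=
  if m is m'.+1 then near_eq m' N A A' i /\
    forall l, (l < N)%N -> A i l -> near_eq m' N A A' l
  else row_eq N A A' i.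

Lemma near_eq_row m N A A' i : near_eq m N A A' i -> row_eq N A A' i.
Proof. by elim: m => [|m IH] //= [/IH]. Qed.

Definition features p N d A Ls X := foldl (fun X L => layer_apply p N d A L X) X Ls.

Lemma features_rcons p N d A Ls L X :
  features p N d A (rcons Ls L) X = layer_apply p N d A L (features p N d A Ls X).
Proof. exact: foldl_rcons. Qed.

Lemma features_local p N d A A' Ls X i : (i < N)%N -> near_eq (size Ls) N A A' i ->
  features p N d A Ls X i =1 features p N d A' Ls X i.
Proof.
elim/last_ind: Ls i => [|Ls L IH] i iN; first by move=> _ j; reflexivity.
rewrite size_rcons => -[ni nl] j.
rewrite (features_rcons p N d A) (features_rcons p N d A').
apply: (layer_local p d L iN (near_eq_row ni) _ j) => l lN [->|Ail].
  by split; [exact: near_eq_row ni|exact: IH iN ni].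
by split; [exact: near_eq_row (nl l lN Ail)|exact: IH lN (nl l lN Ail)].
Qed.

Lemma is_fpn_rnd p x : is_fpn p (rnd p x).
Proof.
have [[s e] -> [+ _ _]] := rnd_nearest p x; rewrite mem_fpn_list => H.
by exists (s, e); split=> //; rewrite /is_fpn_pair /= absz_eq0.
Qed.

Lemma is_fpn0 p : is_fpn p 0.
Proof. by rewrite -(rnd0 p); apply: is_fpn_rnd. Qed.

Lemma is_fpn_features p N d A Ls X : (forall i j, (i < N)%N -> (j < d)%N -> is_fpn p (X i j)) ->
  forall i j, (i < N)%N -> (j < d)%N -> is_fpn p (features p N d A Ls X i j).
Proof.
case/lastP: Ls => // Ls L _ i j _ _; rewrite features_rcons /layer_apply /relu.
by case: leP => _; [apply: is_fpn_rnd|apply: is_fpn0].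
Qed.
End Locality.

(** * Graphs whose edges carry literals of the input *)

Definition edge := (nat * nat * option (nat * bool))%type.

Definition literal (w : seq bool) (l : option (nat * bool)) : bool :=
  if l is Some (i, b) then nth false w i == b else true.

Definition joins u v (e : edge) : bool :=
  (e.1.1 == u) && (e.1.2 == v) || (e.1.1 == v) && (e.1.2 == u).

Definition edge_graph (E : seq edge) (w : seq bool) : graph :=
  fun u v => has (fun e => joins u v e && literal w e.2) E.

Definition incident v (e : edge) : bool := (e.1.1 == v) || (e.1.2 == v).

Section View.
Variable E : seq edge.

Definition edges_at v := [seq e <- E | incident v e].
Definition vars_at v : seq nat := pmap (fun e : edge => omap fst e.2) (edges_at v).
Definition nbrs v := [seq (if e.1.1 == v then e.1.2 else e.1.1) | e <- edges_at v].

(** The positions of the input bits that can influence the ball of radius [m]. They are collected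
    along potential edges and so are the same for all inputs. *)
Fixpoint view m v : seq nat :=
  if m is m'.+1 then view m' v ++ flatten [seq view m' u | u <- nbrs v] else vars_at v.

Lemma size_view D m v : (forall u, size (edges_at u) <= D) -> size (view m v) <= D * D.+1 ^ m.
Proof.
move=> H; elim: m v => [|m IH] v /=.
  by rewrite muln1 size_pmap; apply: leq_trans (count_size _ _) (H v).
rewrite size_cat expnS mulnCA mulSn leq_add //.
have : size (nbrs v) <= D by rewrite size_map.
elim: (nbrs v) D {H} (D * D.+1 ^ m) IH => [|u r IHr] D K IH //=.
by case: D => // D; rewrite ltnS => rD; rewrite size_cat mulSn leq_add ?IH // IHr.
Qed.

Lemma edge_graph_row w w' i : {in vars_at i, forall x, nth false w x = nth false w' x} ->
  forall j, edge_graph E w i j = edge_graph E w' i j.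
Proof.
move=> H j; apply: eq_in_has => e eE; case J: (joins i j e) => //=.
have ei : e \in edges_at i.
  by rewrite mem_filter eE andbT /incident; case/orP: J => /andP[a b]; rewrite ?a ?b ?orbT.
case E2: e.2 => [[x b]|] //=; rewrite H // mem_pmap; apply/mapP; exists e => //.
by rewrite E2.
Qed.

Lemma edge_graph_nbr w i j : edge_graph E w i j -> j \in nbrs i.
Proof.
move=> /hasP[e eE /andP[J _]]; apply/mapP; exists e.
  by rewrite mem_filter eE andbT /incident; case/orP: J => /andP[a b]; rewrite ?a ?b ?orbT.
case/orP: J => /andP[/eqP a /eqP b]; first by rewrite a eqxx b.
by rewrite a b; case: eqVneq.
Qed.

Lemma view_near m N w w' i : {in view m i, forall x, nth false w x = nth false w' x} ->
  near_eq m N (edge_graph E w) (edge_graph E w') i.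
Proof.
elim: m i => [|m IH] i /= H; first by move=> j _; apply: edge_graph_row.
split=> [|l _ il]; apply: IH => x xv; apply: H; rewrite mem_cat ?xv //.
apply/orP; right; apply/flattenP; exists (view m l) => //.
by apply: map_f; apply: edge_graph_nbr il.
Qed.
End View.

(** Shannon expansion, one variable at a time. The depth grows with [K], which is a constant, and
    the leaves are floating-point constants with short significands. *)
Lemma bitreal_junta K : exists k, forall n z p f (V : seq nat), size V <= K -> p <= z ->
  (forall w, is_fpn p (f w)) ->
  (forall w w', size w = n -> size w' = n ->
    {in V, forall x, nth false w x = nth false w' x} -> f w = f w') ->
  bitreal n K.+1 ((z + 2) ^ k) f.
Proof.
elim: K => [|K [k IH]].
  exists 1 => n z p f V V0 pz fp H; rewrite expn1.
  apply: (eq_bitreal (X := fun=> f (nseq n false))) => [w sw|].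
    by apply: H => //; [rewrite size_nseq|case: (V) V0].
  by apply: (@bitreal_fpn n _ _ p) => //; lia.
have [k' pk] : poly_bounded (fun z => (2 * ((z + 2) ^ k + 2) + 3) + (2 * ((z + 2) ^ k + 2) + 3)) by poly_bounded_tac.
exists k' => n z p f V VK pz fp H; apply: (bitreal_le (leqnn _) (pk z)).
have k0 : 0 < (z + 2) ^ k by rewrite expn_gt0 addn2.
have IH' V' : size V' <= K ->
    (forall w w', size w = n -> size w' = n ->
    {in V', forall x, nth false w x = nth false w' x} -> f w = f w') ->
    bitreal n K.+2 ((2 * ((z + 2) ^ k + 2) + 3) + (2 * ((z + 2) ^ k + 2) + 3)) f.
  by move=> VK' H'; apply: bitreal_le (IH n z p f V' VK' pz fp H'); lia.
case: V VK H => [|x V] VK H; first exact: (IH' [::]).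
(* A position beyond the length reads as [false] in every input and is dropped, as [set_nth] there
   would lengthen the word. *)
have [xn|nx] := ltnP x n; last first.
  apply: (IH' V) => // w w' sw sw' ww; apply: H => // y; rewrite inE => /predU1P[->|/ww//].
  by rewrite !nth_default ?sw ?sw'.
have part b : bitreal n K.+1 ((z + 2) ^ k + 2) (fun w => f (set_nth false w x b)).
  apply: (bitreal_le (leqnn _) (leq_addr 2 _)).
  apply: (IH n z p _ V) => // w w' sw sw' ww; apply: H.
  - by rewrite size_set_nth sw; apply/maxn_idPr.
  - by rewrite size_set_nth sw'; apply/maxn_idPr.
  - by move=> y; rewrite inE !nth_set_nth /=; case: eqVneq => //= _; apply: ww.
have xt : tc n K.+1 ((z + 2) ^ k + 2) (fun w => nth false w x).
  by apply: computable_le (@computable_in predT n x xn).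
have xf : tc n K.+1 ((z + 2) ^ k + 2) (fun w => ~~ nth false w x).
  by apply: (computable_le _ _ (tc_not (@computable_in predT n x xn))); rewrite ?leq_addl.
apply: (eq_bitreal (X := fun w => (f (set_nth false w x true) * (nth false w x)%:R +
   f (set_nth false w x false) * (~~ nth false w x)%:R)%R)) => [w sw|].
  have wE : set_nth false w x (nth false w x) = w.
    apply: (@eq_from_nth _ false) => [|y _]; first by rewrite size_set_nth sw; apply/maxn_idPr.
    by rewrite nth_set_nth /=; case: eqVneq => // ->.
  by move: wE; case: (nth false w x) => /= ->; rewrite ?mulr1 ?mulr0 ?addr0 ?add0r.
apply: bitreal_add; first by apply: bitreal_mask (part true) _; apply: computable_le xt; lia.
by apply: bitreal_mask (part false) _.
Qed.

Lemma gnn_outputE n G A : gnn_output n G A =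
  head_apply (g_prec G) (g_dim G) (g_headW G) (g_headb G) (g_headw G)
    (readout (g_prec G) n (g_readmax G) (g_B G)
      (features (g_prec G) n (g_dim G) A (g_layers G) (g_feat G))).
Proof. by []. Qed.

(* On graphs of bounded potential degree each feature depends on boundedly many input bits. *)
Lemma tc_gnn M D : exists k dd, forall n z N G E,
  N <= z -> g_prec G <= z -> g_dim G <= z -> 0 < z -> size (g_layers G) <= M ->
  (forall v, size (edges_at E v) <= D) -> gnn_valid N G ->
  tc n dd ((z + 2) ^ k) (fun w => (0 < gnn_output N G (edge_graph E w))%R).
Proof.
pose K := D * D.+1 ^ M.
have [k1 junta] := bitreal_junta K.
have [k2 [d2 read]] := bitreal_readout.
have [k3 [d3 head]] := bitreal_head.
have [k4 pos] := tc_bitreal_gt0.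
pose z1 z := (z + 2) ^ k1 + z.
pose z2 z := (z1 z + 2) ^ k2 + z.
have [k pk] : poly_bounded (fun z => ((z2 z + 2) ^ k3 + 2) ^ k4) by rewrite /z2 /z1; poly_bounded_tac.
exists k, (K.+1 + d2 + d3 + 12) => n z N G E Nz pz dz z0 LM ED [fX [_ [fW [fb [[i0 iB] Bn]]]]].
apply: (computable_le (leqnn _) (pk z)).
apply/pos/(@eq_bitreal n _ _ (fun w => head_apply (g_prec G) (g_dim G) (g_headW G) (g_headb G)
    (g_headw G) (readout (g_prec G) N (g_readmax G) (g_B G)
      (features (g_prec G) N (g_dim G) (edge_graph E w) (g_layers G) (g_feat G))))).
  by move=> w _; rewrite gnn_outputE.
have zz2 : z <= z2 z by apply: leq_addl.
apply: (head n _ (z2 z)) => //.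

- exact: leq_trans zz2.
- exact: leq_trans zz2.
- exact: leq_trans zz2.
move=> j jd; have zz1 : z <= z1 z by apply: leq_addl.
apply: (bitreal_le (leqnn _) (leq_addr z _)).
apply: (read n _ (z1 z)) => //; [exact: leq_trans zz1|exact: leq_trans zz1|by exists i0|].
move=> i iN; apply: (bitreal_le (leqnn _) (leq_addr z _)).
apply: (junta n z (g_prec G) _ (view E (size (g_layers G)) i)).
- apply: leq_trans (size_view _ _ ED) _; rewrite leq_mul2l; apply/orP; right.
  exact: leq_pexp2l.
- exact: pz.
- by move=> w; apply: (is_fpn_features (edge_graph E w) (g_layers G) fX iN jd).
- move=> w w' _ _ ww; exact: (features_local _ _ _ iN (view_near N ww) j).
Qed.

(** * Logarithmic-depth formulas *)

Inductive formula := FVar (i : nat) | FConst (b : bool) | FNeg (f : formula) | FAnd (f g : formula).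

Fixpoint feval w f : bool :=
  match f with
  | FVar i => nth false w i
  | FConst b => b
  | FNeg f => ~~ feval w f
  | FAnd f g => feval w f && feval w g
  end.

Fixpoint fdepth f : nat :=
  match f with
  | FVar _ | FConst _ => 1
  | FNeg f => (fdepth f).+1
  | FAnd f g => (maxn (fdepth f) (fdepth g)).+1
  end.

Definition nc_gate (g : gate) : bool :=
  (if gkind g is GMaj then false else true) && (size (gins g) <= 2).

Lemma nc_const n b : computable nc_gate n 1 1 (fun _ => b).
Proof.
case: b.
- by apply: (@computable_gate nc_gate n 0 0 GAnd nat [::] (fun _ _ => true)) => // -[].
- by apply: (@computable_gate nc_gate n 0 0 GOr nat [::] (fun _ _ => true)) => // -[].
Qed.

Lemma formula_computable n f : computable nc_gate n (fdepth f) (3 * (2 ^ fdepth f).-1) (feval^~ f).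
Proof.
elim: f => [i|b|f IH|f IHf g IHg] /=.
- have [ni|ni] := ltnP i n; first by apply: computable_le (@computable_in nc_gate n i ni).
  apply: (eq_computable (f := fun=> false)) => [w sw|]; first by rewrite nth_default ?sw.
  by apply: computable_le (@nc_const n false).
- by apply: computable_le (@nc_const n b).
- have pf : 0 < 2 ^ fdepth f by rewrite expn_gt0.
  apply: (computable_le (leqnn _) _ (@computable_gate nc_gate n _ _ GNot _ [:: tt] (fun _ => feval^~ f) _ _ (fun _ _ => IH))) => //.
  + by rewrite expnS /=; lia.
  + by move=> js /= js1; rewrite /nc_gate /= js1.
- have pf : 0 < 2 ^ fdepth f by rewrite expn_gt0.
  set d := maxn _ _; have pd : 0 < 2 ^ d by rewrite expn_gt0.
  have := @computable_gate nc_gate n d (3 * (2 ^ d).-1) GAnd _ [:: true; false]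
    (fun b => if b then feval^~ f else feval^~ g).
  move=> E; apply: eq_computable (computable_le (leqnn _) _ (E _ _ _)) => //.
  + by move=> w _ /=; rewrite andbT.
  + by rewrite expnS /=; lia.
  + by move=> js /= js1; rewrite /nc_gate /= js1.
  case=> _; [apply: computable_le IHf|apply: computable_le IHg]; rewrite ?leq_maxl ?leq_maxr // leq_mul2l /=.
    by rewrite -!subn1 leq_sub2r // leq_exp2l // leq_maxl.
  by rewrite -!subn1 leq_sub2r // leq_exp2l // leq_maxr.
Qed.

Definition log_formulas (L : language) := exists c, forall n, exists2 f,
  fdepth f <= c * trunc_log 2 n + c & forall w, size w = n -> feval w f = L w.

Lemma poly_bounded_exp_log c e : poly_bounded (fun n => 2 ^ (c * trunc_log 2 n + e)).
Proof.
apply: (poly_bounded_le (g := fun n => (n + 1) ^ c * 2 ^ e)) => [n|]; last first.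
  by apply: poly_bounded_mul; [apply/poly_bounded_exp/poly_bounded_add; [apply: poly_bounded_id|apply: poly_bounded_const]|apply: poly_bounded_const].
rewrite expnD leq_mul2r mulnC expnM; apply/orP; right; case: c => // c; rewrite leq_exp2r //.
have [->|n0] := posnP n; first by rewrite trunc_log0.
by apply: leq_trans (trunc_logP _ n0) _; rewrite ?leq_addr.
Qed.

(** A formula of depth [d] has fewer than [2 ^ d] nodes, so logarithmic depth already bounds the
    size polynomially. *)
Lemma NC1_of_formulas L : log_formulas L -> NC1 L.
Proof.
move=> [c H].
have Hc n : exists C, [/\ circ_wf n C, circ_size C <= 3 * 2 ^ (c * trunc_log 2 n + c) + 2,
    circ_depth n C <= (c * trunc_log 2 n + c).+1, all nc_gate C &
    forall w, size w = n -> circ_eval C w = L w].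
  have [f fd fL] := H n; apply: computable_circuit => //; apply: eq_computable fL _.
  apply: (computable_le fd _ (@formula_computable n f)).
  by rewrite leq_mul2l /=; apply: leq_trans (leq_pred _) _; rewrite leq_exp2l.
pose C n := proj1_sig (constructive_indefinite_description _ (Hc n)).
have CP n := proj2_sig (constructive_indefinite_description _ (Hc n)); rewrite -/(C _) in CP.
have : poly_bounded (fun n => 3 * 2 ^ (c * trunc_log 2 n + c) + 2).
  by apply: poly_bounded_add; [apply: poly_bounded_mul; [apply: poly_bounded_const|apply: poly_bounded_exp_log]|apply: poly_bounded_const].
case/poly_boundedP => a [k sz]; exists C, (a + c.+1), k; split; last by move=> w; have [_ _ _ _] := CP (size w); apply.
move=> n; have [wf sC dC QC _] := CP n; split; [|split; [|split]] => //.
  by apply: leq_trans sC (leq_trans (sz n) _); rewrite mulnDl; lia.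
by apply: leq_trans dC _; nia.
Qed.

Lemma TC0_of_computable L d P : poly_bounded P -> (forall n, computable predT n d (P n) L) -> TC0 L.
Proof.
move=> pP H.
have Hc n : exists C, [/\ circ_wf n C, circ_size C <= P n + 2,
    circ_depth n C <= d.+1, all predT C & forall w, size w = n -> circ_eval C w = L w].
  exact: computable_circuit.
pose C n := proj1_sig (constructive_indefinite_description _ (Hc n)).
have CP n := proj2_sig (constructive_indefinite_description _ (Hc n)); rewrite -/(C _) in CP.
have : poly_bounded (fun n => P n + 2) by apply: poly_bounded_add pP (poly_bounded_const 2).
case/poly_boundedP => a [k sz]; exists C, a, k, d.+1; split; last by move=> w; have [_ _ _ _] := CP (size w); apply.
by move=> n; have [wf sC dC _ _] := CP n; split=> //; split=> //; apply: leq_trans sC (sz n).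
Qed.

(** The circuit is unfolded into a tree, with only the depth tracked. The assumption on gates
    abstracts the basis: [K] is constant for bounded fan-in and logarithmic for majority gates. *)
Lemma formulas_of_circuit K n c : wf_prefix n c ->
  (forall j, j < size c -> let g := nth gate0 c j in
    forall fs d, size fs = size (gins g) -> (forall f, List.In f fs -> fdepth f <= d) ->
    exists2 h, fdepth h <= d + K &
      forall w, feval w h = gate_op (gkind g) [seq feval w f | f <- fs]) ->
  forall i, i < n + size c -> exists2 f, fdepth f <= K * nth 0 (wire_depths n c) i + 1 &
    forall w, size w = n -> feval w f = nth false (wire_vals c w) i.
Proof.
elim/last_ind: c => [|c g IH] wf G i.
  rewrite addn0 => lin; exists (FVar i) => //=; first by rewrite addn1.
have gE j : j < size c -> nth gate0 (rcons c g) j = nth gate0 c j by move=> jc; rewrite nth_rcons jc.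
have {}IH : forall i, i < n + size c -> exists2 f, fdepth f <= K * nth 0 (wire_depths n c) i + 1 &
    forall w, size w = n -> feval w f = nth false (wire_vals c w) i.
  apply: IH => j jc; rewrite -gE //; [apply: wf|apply: G]; by rewrite size_rcons ltnW.
rewrite size_rcons addnS ltnS leq_eqVlt wire_depths_rcons nth_rcons size_wire_depths => /predU1P[->|ic].
  rewrite ltnn eqxx.
  have [] := wf (size c); first by rewrite size_rcons.
  have := G (size c); rewrite size_rcons ltnSn nth_rcons ltnn eqxx => /(_ isT) {}G gi _.
  set m := foldr maxn 0 [seq nth 0 (wire_depths n c) i | i <- gins g].
  have [fs [sfs fsd fsv]] : exists fs, [/\ size fs = size (gins g),
      forall f, List.In f fs -> fdepth f <= K * m + 1 & forall w, size w = n ->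
      [seq feval w f | f <- fs] = [seq nth false (wire_vals c w) i | i <- gins g]].
    rewrite /m; elim: (gins g) gi => [|j js IHj] /=; first by exists [::].
    move=> /andP[jc /IHj[fs [sfs fsd fsv]]]; have [f fd fv] := IH j jc.
    exists (f :: fs); split=> [|f' /= []|w sw] /=; first by rewrite sfs.
    - move=> <-; apply: leq_trans fd _; rewrite leq_add2r leq_mul2l leq_maxl orbT //.
    - by move/fsd/leq_trans; apply; rewrite leq_add2r leq_mul2l leq_maxr orbT.
    - by rewrite fv // fsv.
  have [h hd hv] := G fs _ sfs fsd; exists h.
    by apply: leq_trans hd _; rewrite /gate_depth -/m mulnDr muln1; lia.
  move=> w sw; rewrite hv wire_vals_rcons nth_rcons size_wire_vals sw ltnn eqxx gate_evalE.
  by rewrite fsv.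
rewrite ic; have [f fd fv] := IH i ic; exists f => // w sw.
by rewrite fv // wire_vals_rcons nth_rcons size_wire_vals sw ic.
Qed.

Lemma formula_of_circuit K n c : circ_wf n c ->
  (forall j, j < size c -> let g := nth gate0 c j in
    forall fs d, size fs = size (gins g) -> (forall f, List.In f fs -> fdepth f <= d) ->
    exists2 h, fdepth h <= d + K &
      forall w, feval w h = gate_op (gkind g) [seq feval w f | f <- fs]) ->
  exists2 f, fdepth f <= K * circ_depth n c + 1 &
    forall w, size w = n -> feval w f = circ_eval c w.
Proof.
move=> [c0 wf] G; have [|f fd fv] := formulas_of_circuit wf G (i := (n + size c).-1).
  by rewrite prednK // addn_gt0 c0 orbT.
exists f; last by move=> w sw; rewrite fv // /circ_eval -nth_last size_wire_vals sw.
apply: leq_trans fd _; rewrite leq_add2r leq_mul2l; apply/orP; right.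
have /foldr_maxn_leP := leqnn (foldr maxn 0 (wire_depths n c)); apply; apply: mem_nth.
by rewrite size_wire_depths prednK // addn_gt0 c0 orbT.
Qed.

Definition FOr f g := FNeg (FAnd (FNeg f) (FNeg g)).

Lemma feval_or w f g : feval w (FOr f g) = feval w f || feval w g.
Proof. by rewrite /= negb_and !negbK. Qed.

Lemma formulas_of_NC1 L : NC1 L -> log_formulas L.
Proof.
move=> [C [c [k [H LC]]]]; exists (3 * c + 1) => n.
have [wf [_ [dC QC]]] := H n.
(* A disjunction written by De Morgan adds three levels, the most of any gate here. *)
have [|f fd fv] := @formula_of_circuit 3 n (C n) wf.
  move=> j jc g fs d sfs fsd; have [_ nt] := wf.2 j jc.
  have /andP[mj s2] := all_nthP gate0 QC j jc; rewrite -/g in nt mj s2; rewrite -sfs in s2 nt.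
  case: g {sfs} mj nt => -[] ins //= _ nt; case: fs s2 fsd nt => [|f1 [|f2 []]] //= _ fsd nt.
  - by exists (FConst true) => [/=|//]; lia.
  - by exists f1 => [|w]; [have := fsd f1 (or_introl erefl); lia|rewrite andbT].
  - exists (FAnd f1 f2) => [/=|w]; last by rewrite /= andbT.
    by have := fsd f1 (or_introl erefl); have := fsd f2 (or_intror (or_introl erefl)); lia.
  - by exists (FConst false) => [/=|//]; lia.
  - by exists f1 => [|w]; [have := fsd f1 (or_introl erefl); lia|rewrite orbF].
  - exists (FOr f1 f2) => [/=|w]; last by rewrite feval_or orbF.
    by have := fsd f1 (or_introl erefl); have := fsd f2 (or_intror (or_introl erefl)); lia.
  - by have := nt erefl.
  - by exists (FNeg f1) => //=; have := fsd f1 (or_introl erefl); lia.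
  - by have := nt erefl.
exists f; first by apply: leq_trans fd _; nia.
by move=> w sw; rewrite fv // -LC sw.
Qed.

(** * Majority by carry-save addition *)

Definition FXor f g := FOr (FAnd f (FNeg g)) (FAnd (FNeg f) g).
Definition FMaj f g h := FOr (FAnd f g) (FAnd h (FOr f g)).

Lemma feval_xor w f g : feval w (FXor f g) = feval w f (+) feval w g.
Proof. by rewrite feval_or /=; case: feval; case: feval. Qed.

Lemma feval_maj w f g h : feval w (FMaj f g h) =
  (1 < feval w f + feval w g + feval w h).
Proof. by rewrite feval_or /= !negb_and !negbK; case: feval; case: feval; case: feval. Qed.

Lemma fdepth_xor f g d : fdepth f <= d -> fdepth g <= d -> fdepth (FXor f g) <= d + 5.
Proof. by move=> /=; lia. Qed.

Lemma fdepth_maj f g h d : fdepth f <= d -> fdepth g <= d -> fdepth h <= d ->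
  fdepth (FMaj f g h) <= d + 7.
Proof. by move=> /=; lia. Qed.

Section CarrySave.

Definition num_val L (x : nat -> formula) w := \sum_(i < L) feval w (x i) * 2 ^ i.

Lemma num_val_lt L x w : num_val L x w < 2 ^ L.
Proof.
elim: L => [|L IH]; first by rewrite /num_val big_ord0.
by rewrite /num_val big_ord_recr /= -/(num_val L x w) expnS; case: feval; lia.
Qed.

Definition csa_sum (x y z : nat -> formula) i := FXor (FXor (x i) (y i)) (z i).
Definition csa_carry (x y z : nat -> formula) i :=
  if i is i'.+1 then FMaj (x i') (y i') (z i') else FConst false.

(** Full adders act independently in every column, so three numbers become two in constant depth,
    without carry propagation. The extra term is the carry out of the last column. *)
Lemma csaP L x y z w : num_val L (csa_sum x y z) w + num_val L (csa_carry x y z) w +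
  feval w (csa_carry x y z L) * 2 ^ L = num_val L x w + num_val L y w + num_val L z w.
Proof.
elim: L => [|L IH]; first by rewrite /num_val !big_ord0.
move: IH; rewrite /num_val !big_ord_recr /= -!/(num_val L _ w).
have -> : feval w (FMaj (x L) (y L) (z L)) * 2 ^ L.+1 = (feval w (x L) + feval w (y L) +
    feval w (z L)) * 2 ^ L - feval w (csa_sum x y z L) * 2 ^ L.
  rewrite feval_maj /csa_sum !feval_xor expnS.
  by case: feval; case: feval; case: feval; rewrite /=; lia.
rewrite /csa_sum !feval_xor.
by case: (feval w (x L)); case: (feval w (y L)); case: (feval w (z L)); rewrite /=; lia.
Qed.

Lemma csa_mod L x y z w :
  num_val L (csa_sum x y z) w + num_val L (csa_carry x y z) w =
  num_val L x w + num_val L y w + num_val L z w %[mod 2 ^ L].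
Proof. by rewrite -csaP [in RHS]addnC modnMDl. Qed.

Lemma fdepth_csa x y z d : (forall i, fdepth (x i) <= d) -> (forall i, fdepth (y i) <= d) ->
  (forall i, fdepth (z i) <= d) ->
  forall i, fdepth (csa_sum x y z i) <= d + 10 /\ fdepth (csa_carry x y z i) <= d + 10.
Proof.
move=> dx dy dz i; split.
  rewrite (_ : d + 10 = d + 5 + 5); last by rewrite -addnA.
  by apply: fdepth_xor; [apply: fdepth_xor|apply: leq_trans (dz i) (leq_addr _ _)].
case: i => [|i]; first by rewrite addnS.
by apply: leq_trans (fdepth_maj (dx i) (dy i) (dz i)) _; rewrite leq_add2l.
Qed.

(** Each half yields two numbers, and two carry-save steps of depth 10 reduce these four to two:
    depth 20 per level. Working modulo [2 ^ L] discards the carries out of the top. *)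
Lemma csa_tree L h d fs : size fs <= 2 ^ h -> 0 < d -> (forall f, List.In f fs -> fdepth f <= d) ->
  exists x y, [/\ forall i, fdepth (x i) <= d + 20 * h, forall i, fdepth (y i) <= d + 20 * h &
    forall w, num_val L x w + num_val L y w = count (feval w) fs %[mod 2 ^ L]].
Proof.
move=> + d0; pose zero (i : nat) := FConst false.
have zeroE w : num_val L zero w = 0 by rewrite /num_val big1.
elim: h fs => [|h IH] fs sfs fd.
  pose x i := if i is 0 then head (FConst false) fs else FConst false.
  exists x, zero; split=> [i|i|w]; rewrite ?muln0 ?addn0 //.
    by case: i => [|i] //=; case: fs sfs fd {x} => [|f fs] //= _ fd; apply: fd; left.
  have xE : feval w (head (FConst false) fs) = count (feval w) fs :> nat.
    by case: fs sfs {fd x} => [|f []] //=; rewrite addn0.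
  rewrite zeroE addn0 /num_val; case: (L) => [|L']; first by rewrite !modn1.
  by rewrite big_ord_recl big1 ?addn0 /= ?muln1 ?xE.
have [x1 [y1 [dx1 dy1 v1]]] : exists x y, [/\ forall i, fdepth (x i) <= d + 20 * h,
    forall i, fdepth (y i) <= d + 20 * h & forall w,
    num_val L x w + num_val L y w = count (feval w) (take (2 ^ h) fs) %[mod 2 ^ L]].
  apply: IH; first by rewrite size_take; case: ltnP.
  by move=> f ff; apply: fd; rewrite -(cat_take_drop (2 ^ h) fs); apply/List.in_or_app; left.
have [x2 [y2 [dx2 dy2 v2]]] : exists x y, [/\ forall i, fdepth (x i) <= d + 20 * h,
    forall i, fdepth (y i) <= d + 20 * h & forall w,
    num_val L x w + num_val L y w = count (feval w) (drop (2 ^ h) fs) %[mod 2 ^ L]].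
  apply: IH; first by rewrite size_drop leq_subLR addnn -mul2n -expnS.
  by move=> f ff; apply: fd; rewrite -(cat_take_drop (2 ^ h) fs); apply/List.in_or_app; right.
have D1 := fdepth_csa dx1 dy1 dx2.
have D2 := fdepth_csa (fun i => (D1 i).1) (fun i => (D1 i).2) (fun i => leq_trans (dy2 i) (leq_addr 10 _)).
have dE : d + 20 * h.+1 = d + 20 * h + 10 + 10 by lia.
eexists; eexists; split=> [i|i|w]; [rewrite dE; exact: (D2 i).1|rewrite dE; exact: (D2 i).2|].
rewrite csa_mod -modnDml csa_mod modnDml -[in RHS](cat_take_drop (2 ^ h) fs) count_cat.
by rewrite -[RHS]modnDm -v1 -v2 modnDm addnA.
Qed.

(** Linear depth in [L] is affordable: [L] is logarithmic in the fan-in, and the propagation takes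
    place once, after the carry-save tree. *)
Fixpoint ripple (x y : nat -> formula) L :=
  if L is L'.+1 then FMaj (x L') (y L') (ripple x y L') else FConst false.

Lemma rippleP x y L w : feval w (ripple x y L) = (2 ^ L <= num_val L x w + num_val L y w).
Proof.
elim: L => [|L IH]; first by rewrite /num_val !big_ord0.
rewrite [ripple _ _ _]/= feval_maj IH /num_val !big_ord_recr /= -!/(num_val L _ w).
have := num_val_lt L x w; have := num_val_lt L y w; rewrite expnS.
move: (num_val L x w) (num_val L y w) (feval w (x L)) (feval w (y L)) (2 ^ L) => a b u v P bP aP.
by case: u; case: v; case: (leqP P (a + b)) => H /=; lia.
Qed.

Lemma fdepth_ripple x y d L : 0 < d -> (forall i, fdepth (x i) <= d) -> (forall i, fdepth (y i) <= d) ->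
  fdepth (ripple x y L) <= d + 7 * L.
Proof.
move=> d0 dx dy; elim: L => [|L IH]; first by rewrite muln0 addn0.
rewrite [ripple _ _ _]/= mulnS addnCA addnC; apply: fdepth_maj IH.
  exact: leq_trans (dx L) (leq_addr _ _).
exact: leq_trans (dy L) (leq_addr _ _).
Qed.

Lemma top_bit x y L w : feval w (FXor (FXor (x L) (y L)) (ripple x y L)) =
  (2 ^ L <= (num_val L.+1 x w + num_val L.+1 y w) %% 2 ^ L.+1).
Proof.
rewrite !feval_xor rippleP /num_val !big_ord_recr /= -!/(num_val L _ w).
have := num_val_lt L x w; have := num_val_lt L y w.
move: (num_val L x w) (num_val L y w) => a b bL aL.
pose cr : bool := 2 ^ L <= a + b.
have [r [rE rL]] : exists r, a + b = cr * 2 ^ L + r /\ r < 2 ^ L.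
  by exists (a + b - cr * 2 ^ L); rewrite /cr; case: leqP => /=; lia.
have -> : a + feval w (x L) * 2 ^ L + (b + feval w (y L) * 2 ^ L) =
    (feval w (x L) + feval w (y L) + cr) * 2 ^ L + r by lia.
rewrite -/cr; move: (feval w (x L)) (feval w (y L)) cr rE => u v c _.
have small t : t < 2 ^ L.+1 -> t %% 2 ^ L.+1 = t by apply: modn_small.
have eL : 2 ^ L.+1 = 2 * 2 ^ L by rewrite expnS.
have red k : (k.+2 * 2 ^ L + r) %% 2 ^ L.+1 = (k * 2 ^ L + r) %% 2 ^ L.+1.
  by rewrite -[RHS](modnMDl 1) mul1n; congr modn; lia.
by case: u; case: v; case: c; rewrite /= ?red small; lia.
Qed.
End CarrySave.

(** Adding the constant [2 ^ h.+1 - v] turns the comparison into the bit of weight [2 ^ h.+1]. The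
    total is at most [3 * 2 ^ h < 2 ^ h.+2], so reduction modulo [2 ^ h.+2] loses nothing. *)
Lemma threshold_formula h d fs v : size fs <= 2 ^ h -> 0 < d ->
  (forall f, List.In f fs -> fdepth f <= d) ->
  exists2 g, fdepth g <= d + 40 * h.+1 & forall w, feval w g = (v <= count (feval w) fs).
Proof.
move=> sfs d0 fd; have [hv|vh] := ltnP (2 ^ h.+1) v.
  exists (FConst false) => [/=|w]; first by lia.
  apply/esym/negbTE; rewrite -ltnNge; apply: leq_ltn_trans (count_size _ _) _.
  by apply: leq_ltn_trans sfs _; apply: leq_ltn_trans hv; rewrite leq_exp2l.
have [x [y [dx dy vxy]]] := csa_tree h.+2 sfs d0 fd.
pose k := 2 ^ h.+1 - v; pose z i := FConst (odd (k %/ 2 ^ i)).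
have zE w : num_val h.+2 z w = k.
  have kL : k < 2 ^ h.+2 by apply: leq_ltn_trans (leq_subr _ _) _; rewrite ltn_exp2l.
  by rewrite [RHS](@digits_sum 2 k h.+2) //; apply: eq_bigr => i _; rewrite /digit modn2.
have dz i : fdepth (z i) <= d + 20 * h by rewrite /=; lia.
have D := fdepth_csa dx dy dz.
exists (FXor (FXor (csa_sum x y z h.+1) (csa_carry x y z h.+1))
   (ripple (csa_sum x y z) (csa_carry x y z) h.+1)).
  have dr : fdepth (ripple (csa_sum x y z) (csa_carry x y z) h.+1) <= d + 20 * h + 10 + 7 * h.+1.
    by apply: fdepth_ripple => [|i|i]; [lia|exact: (D i).1|exact: (D i).2].
  apply: leq_trans (_ : d + 20 * h + 10 + 7 * h.+1 + 5 + 5 <= _); last by lia.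
  apply: fdepth_xor; last exact: leq_trans dr (leq_addr _ _).
  by apply: fdepth_xor; apply: leq_trans (leq_addr _ _); [exact: (D _).1|exact: (D _).2].
move=> w; rewrite top_bit csa_mod zE -modnDml vxy modnDml.
have cL : count (feval w) fs <= 2 ^ h by apply: leq_trans (count_size _ _) sfs.
rewrite modn_small; first by rewrite /k; lia.
by rewrite /k !expnS; lia.
Qed.

Lemma gate_formula h (g : gate) fs d : size fs = size (gins g) -> size fs <= 2 ^ h ->
  (gkind g = GNot -> size (gins g) = 1) -> (forall f, List.In f fs -> fdepth f <= d) ->
  exists2 f, fdepth f <= d + (40 * h.+1 + 1) &
    forall w, feval w f = gate_op (gkind g) [seq feval w f | f <- fs].
Proof.
(* The bound is raised to [d.+1] because [threshold_formula] takes a positive depth, while an empty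
   [fs] allows [d = 0]. *)
move=> sg sfs nt fd; have fd' f : List.In f fs -> fdepth f <= d.+1 by move/fd/leqW.
have T v : exists2 f, fdepth f <= d + (40 * h.+1 + 1) & forall w, feval w f = (v <= count (feval w) fs).
  have [f fD fv] := threshold_formula v sfs (ltn0Sn d) fd'; exists f => //.
  by apply: leq_trans fD _; lia.
case: g sg nt => -[] ins /= sg nt.
- have [f fD fv] := T (size fs); exists f => // w; rewrite fv all_map all_count eqn_leq count_size.
  by [].
- have [f fD fv] := T 1; exists f => // w; rewrite fv has_map has_count.
  by [].
- have := nt erefl; rewrite -sg; case: (fs) fd => [|f []] // fd _; exists (FNeg f) => //=.
  by have := fd f (or_introl erefl); lia.
have [f fD fv] := T (size fs)./2.+1; exists f => // w; rewrite fv size_map count_map.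
by rewrite (@eq_count _ _ (feval w)) // -divn2; lia.
Qed.

Lemma TC0_sub_NC1 L : TC0 L -> NC1 L.
Proof.
move=> [C [c [k [D [H LC]]]]]; apply: NC1_of_formulas.
have [e pe] : poly_bounded (fun n => c * n ^ k + c) by apply/poly_boundedP; exists c, k.
exists ((40 * (3 * e).+1 + 1) * D + 1) => n; have [wf [sC dC]] := H n.
(* The fan-in of a gate is at most the size of the circuit, hence at most [(n + 2) ^ e <= 2 ^ h]. *)
set t := trunc_log 2 n; pose h := e * (t + 2).
have n2 : n + 2 <= 2 ^ (t + 2).
  have : n < 2 ^ t.+1 by apply: trunc_log_ltn.
  have : 0 < 2 ^ t by rewrite expn_gt0.
  by rewrite (addn2 t) !expnS; lia.
have [|f fd fv] := @formula_of_circuit (40 * h.+1 + 1) n (C n) wf.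
  move=> j jc g fs d sfs fsd; have [_ nt] := wf.2 j jc.
  apply: gate_formula => //; rewrite sfs.
  apply: leq_trans (_ : circ_size (C n) <= _).
    by rewrite /circ_size (big_nth gate0) big_mkord (bigD1 (Ordinal jc)) //= -/g; lia.
  apply: leq_trans sC (leq_trans (pe n) _).
  by rewrite /h mulnC expnM; case: (e) => // e'; rewrite leq_exp2r.
exists f; last by move=> w sw; rewrite fv // -LC sw.
apply: leq_trans fd _; apply: leq_trans (_ : (40 * h.+1 + 1) * D + 1 <= _).
  by rewrite leq_add2r leq_mul2l dC orbT.
have : 40 * h.+1 + 1 <= (40 * (3 * e).+1 + 1) * (t + 1) by rewrite /h; nia.
move: (40 * h.+1 + 1) (40 * (3 * e).+1 + 1) => a b ab; nia.
Qed.

(** * From formulas to bounded-degree connectivity instances *)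

(* The gadget for [f], [b] has vertices [o, o + gsize f b) and terminals [o] and [o + 1],
   which are linked iff [f] evaluates to [b]; every vertex is always linked to a terminal.
   For a conjunction, the midpoint [o + 2] of the series composition would be cut off from
   both terminals if both conjuncts fail, whence the third part, a gadget for the negation
   of [f] between the midpoint and [o + 1]. *)
Fixpoint gsize (f : formula) (b : bool) : nat :=
  match f with
  | FVar _ | FConst _ => 2
  | FNeg f => gsize f (~~ b)
  | FAnd f g => if b then 3 + gsize f true + gsize g true + gsize f false
                else 2 + gsize f false + gsize g false
  end.

Definition link (u v : nat) : edge := (u, v, None).

Fixpoint gedges (f : formula) (b : bool) (o : nat) : seq edge :=
  match f with
  | FVar i => [:: (o, o + 1, Some (i, b))]
  | FConst c => if c == b then [:: link o (o + 1)] else [::]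
  | FNeg f => gedges f (~~ b) o
  | FAnd f g =>
    if b then
      let o1 := o + 3 in let o2 := o1 + gsize f true in let o3 := o2 + gsize g true in
      [:: link o o1; link (o1 + 1) (o + 2); link (o + 2) o2; link (o2 + 1) (o + 1);
          link (o + 2) o3; link (o3 + 1) (o + 1)]
      ++ gedges f true o1 ++ gedges g true o2 ++ gedges f false o3
    else
      let o1 := o + 2 in let o2 := o1 + gsize f false in
      [:: link o o1; link (o1 + 1) (o + 1); link o o2; link (o2 + 1) (o + 1)]
      ++ gedges f false o1 ++ gedges g false o2
  end.

Lemma gsize_ge2 f b : 1 < gsize f b.
Proof. by elim: f b => [i|c|f IH|f IHf g IHg] [] /=; rewrite ?addSn. Qed.

(** A conjunction contains three gadgets, as [f] occurs twice, whence base 4 with room for the three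
    new vertices; at logarithmic depth this is still polynomial. *)
Lemma gsize_le f b : gsize f b <= 4 ^ fdepth f.
Proof.
elim: f b => [i|c|f IH|f IHf g IHg] b //=.
  by apply: leq_trans (IH _) _; rewrite leq_exp2l.
have le d : 4 ^ fdepth f <= 4 ^ maxn (fdepth f) d by rewrite leq_exp2l // leq_maxl.
have Hf c := leq_trans (IHf c) (le (fdepth g)).
have Hg c : gsize g c <= 4 ^ maxn (fdepth f) (fdepth g).
  by apply: leq_trans (IHg c) _; rewrite leq_exp2l // leq_maxr.
have P4 : 4 <= 4 ^ maxn (fdepth f) (fdepth g).
  by rewrite -{1}(expn1 4) leq_exp2l // leq_max; case: (f).
have := Hf true; have := Hf false; have := Hg true; have := Hg false.
by rewrite expnS; case: b; lia.
Qed.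

Lemma gedges_range f b o e : e \in gedges f b o ->
  [/\ o <= e.1.1 < o + gsize f b, o <= e.1.2 < o + gsize f b & e.1.1 != e.1.2].
Proof.
case: e => [[x y] l] /=.
suff : (x, y, l) \in gedges f b o -> [/\ o <= x < o + gsize f b, o <= y < o + gsize f b & x <> y].
  by move=> H /H[-> -> /eqP].
elim: f b o => [i|c|f IH|f IHf g IHg] b o /=.
- by rewrite inE => /eqP[-> -> _]; split; lia.
- by case: ifP => // _; rewrite inE => /eqP[-> -> _]; split; lia.
- exact: IH.
have := gsize_ge2 f true; have := gsize_ge2 f false.
have := gsize_ge2 g true; have := gsize_ge2 g false => g1 g2 f1 f2.
case: b; rewrite !inE !mem_cat.
  do 6 (case/orP; first by move/eqP=> [-> -> _]; split; lia).
  by case/or3P => [/IHf|/IHg|/IHf] [r1 r2 ne]; split=> //; lia.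
do 4 (case/orP; first by move/eqP=> [-> -> _]; split; lia).
by case/orP => [/IHf|/IHg] [r1 r2 ne]; split=> //; lia.
Qed.

(** The invariant keeps terminals at degree 2 within their gadget, so that the one link attached to
    each from outside raises it to 3 at most. For this gadgets are joined by links instead of by
    identifying terminals. *)
Lemma gedges_deg f b o v : let k := count (incident v) (gedges f b o) in
  [/\ v < o \/ o + gsize f b <= v -> k = 0, v < o + 2 -> k <= 2 & k <= 3].
Proof.
move=> k; have out : v < o \/ o + gsize f b <= v -> k = 0.
  move=> vo; apply/eqP; rewrite -leqn0 leqNgt -has_count; apply/hasP => -[[[x y] l] /gedges_range[/= r1 r2 _]].
  by rewrite /incident /=; lia.
suff [] : (v < o + 2 -> k <= 2) /\ k <= 3 by [].
rewrite /k; clear k out; elim: f b o => [i|c|f IH|f IHf g IHg] b o.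
- by rewrite /=; lia.
- by rewrite /=; case: ifP => _ /=; lia.
- exact: IH.
have lt x y : y < x -> (y == x) = false by move=> ?; rewrite ltn_eqF.
have gt x y : x < y -> (y == x) = false by move=> ?; rewrite gtn_eqF.
have zero f' b' o' : v < o' \/ o' + gsize f' b' <= v -> count (incident v) (gedges f' b' o') = 0.
  move=> vo; apply/eqP; rewrite -leqn0 leqNgt -has_count; apply/hasP => -[[[x y] l] /gedges_range[/= r1 r2 _]].
  by rewrite /incident /=; lia.
have := gsize_ge2 f true; have := gsize_ge2 f false.
have := gsize_ge2 g true; have := gsize_ge2 g false => g1 g2 f1 f2.
case: b; rewrite /= !count_cat.
  set o1 := o + 3; set o2 := o1 + gsize f true; set o3 := o2 + gsize g true.
  have := IHf true o1; have := IHg true o2; have := IHf false o3.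
  have := @zero f true o1; have := @zero g true o2; have := @zero f false o3.
  move: (count _ (gedges f true o1)) (count _ (gedges g true o2)) (count _ (gedges f false o3)).
  have l1 : o + 3 = o1 by [].
  have l2 : o1 + 2 <= o2 by rewrite leq_add2l.
  have l3 : o2 + 2 <= o3 by rewrite leq_add2l.
  have e2 : o2 = o1 + gsize f true by [].
  have e3 : o3 = o2 + gsize g true by [].
  rewrite -e2 -e3 /incident /=; clearbody o1 o2 o3 => k1 k2 k3 c3 c2 c1 [a3 b3] [a2 b2] [a1 b1].
  have [v1|v1] := ltnP v o1.
    have [s2 s3] : v < o2 /\ v < o3 by clear -v1 l2 l3; lia.
    rewrite (c1 (or_introl v1)) (c2 (or_introl s2)) (c3 (or_introl s3)) {c1 c2 c3}.
    rewrite (gt v o1 v1) (gt v (o1 + 1) (ltn_addr 1 v1)) (gt v o2 s2) (gt v (o2 + 1) (ltn_addr 1 s2)).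
    rewrite (gt v o3 s3) (gt v (o3 + 1) (ltn_addr 1 s3)).
    by clear; lia.
  have [u0 u1 u2] : [/\ o < v, o + 1 < v & o + 2 < v] by clear -v1 l1; split; lia.
  rewrite (lt v o) // (lt v (o + 1)) // (lt v (o + 2)) //.
  have [v2|v2] := ltnP v o2.
    have s3 : v < o3 by clear -v2 l3; lia.
    rewrite (c2 (or_introl v2)) (c3 (or_introl s3)).
    rewrite (gt v o2 v2) (gt v (o2 + 1) (ltn_addr 1 v2)) (gt v o3 s3) (gt v (o3 + 1) (ltn_addr 1 s3)).
    by clear -a1 b1 v1 l1; lia.
  have [u3 u4] : o1 < v /\ o1 + 1 < v by clear -v2 l2; lia.
  rewrite (c1 (or_intror v2)) (lt v o1) // (lt v (o1 + 1)) //.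
  have [v3|v3] := ltnP v o3.
    rewrite (c3 (or_introl v3)) (gt v o3 v3) (gt v (o3 + 1) (ltn_addr 1 v3)).
    by clear -a2 b2 v2 l1 l2; lia.
  have [u5 u6] : o2 < v /\ o2 + 1 < v by clear -v3 l3; lia.
  rewrite (c2 (or_intror v3)) (lt v o2) // (lt v (o2 + 1)) //.
  by clear -a3 b3 v3 l1 l2 l3; lia.
set o1 := o + 2; set o2 := o1 + gsize f false.
have := IHf false o1; have := IHg false o2; have := @zero f false o1; have := @zero g false o2.
move: (count _ (gedges f false o1)) (count _ (gedges g false o2)).
have l1 : o + 2 = o1 by [].
have l2 : o1 + 2 <= o2 by rewrite leq_add2l.
have e2 : o2 = o1 + gsize f false by [].
rewrite -e2 /incident /=; clearbody o1 o2 => k1 k2 c2 c1 [a2 b2] [a1 b1].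
have [v1|v1] := ltnP v o1.
  have s2 : v < o2 by clear -v1 l2; lia.
  rewrite (c1 (or_introl v1)) (c2 (or_introl s2)).
  rewrite (gt v o1 v1) (gt v (o1 + 1) (ltn_addr 1 v1)) (gt v o2 s2) (gt v (o2 + 1) (ltn_addr 1 s2)).
  by clear; lia.
have [u0 u1] : o < v /\ o + 1 < v by clear -v1 l1; lia.
rewrite (lt v o) // (lt v (o + 1)) //.
have [v2|v2] := ltnP v o2.
  rewrite (c2 (or_introl v2)) (gt v o2 v2) (gt v (o2 + 1) (ltn_addr 1 v2)).
  by clear -a1 b1 v1 l1; lia.
have [u3 u4] : o1 < v /\ o1 + 1 < v by clear -v2 l2; lia.
rewrite (c1 (or_intror v2)) (lt v o1) // (lt v (o1 + 1)) //.
by clear -a2 b2 v2 l1 l2; lia.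
Qed.

(** * Colourings of the gadgets *)

(** Such colourings are constant on components, so two vertices are linked iff all of them agree
    there. This replaces the handling of paths inside nested gadgets. *)
Definition mono (chi : nat -> bool) (w : seq bool) (E : seq edge) :=
  forall e, e \in E -> literal w e.2 -> chi e.1.1 = chi e.1.2.

Lemma mono_cat chi w E E' : mono chi w (E ++ E') -> mono chi w E /\ mono chi w E'.
Proof. by move=> H; split=> e eE; apply: H; rewrite mem_cat eE ?orbT. Qed.

Lemma mono_link chi w u v E : mono chi w (link u v :: E) -> chi u = chi v /\ mono chi w E.
Proof.
move=> H; split; first by apply: (H (link u v)) => //; apply: mem_head.
by move=> e eE; apply: H; rewrite inE eE orbT.
Qed.

Lemma mono_linkI (chi : nat -> bool) w u v E : chi u = chi v -> mono chi w E -> mono chi w (link u v :: E).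
Proof. by move=> uv H e; rewrite inE => /predU1P[->|/H]. Qed.

Lemma mono_catI chi w E E' : mono chi w E -> mono chi w E' -> mono chi w (E ++ E').
Proof. by move=> H H' e; rewrite mem_cat => /orP[/H|/H']. Qed.

(** The second claim says that no component avoids both terminals; it holds whatever the value of
    [f], which is what makes linked terminals imply a connected gadget. *)
Lemma gadget_linked w chi f b o : mono chi w (gedges f b o) ->
  (feval w f = b -> chi o = chi (o + 1)) /\
  (chi o = chi (o + 1) -> forall v, o <= v < o + gsize f b -> chi v = chi o).
Proof.
elim: f b o => [i|c|f IH|f IHf g IHg] b o /=.
- move=> H; split=> [fb|E v vo].
    by apply: (H (o, o + 1, Some (i, b))); rewrite ?mem_head //= fb eqxx.
  by have [->//|->] : v = o \/ v = o + 1 by lia.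
- move=> H; split=> [cb|E v vo].
    by move: H; rewrite cb eqxx => /mono_link[].
  by have [->//|->] : v = o \/ v = o + 1 by lia.
- by move=> /IH[H1 H2]; split=> // fb; apply: H1; rewrite -fb negbK.
case: b => /=.
  set o1 := o + 3; set o2 := o1 + gsize f true; set o3 := o2 + gsize g true.
  move=> /mono_link[e1 /mono_link[e2 /mono_link[e3 /mono_link[e4 /mono_link[e5 /mono_link[e6]]]]]].
  move=> /mono_cat[/IHf[f1 f2] /mono_cat[/IHg[g1 g2] /IHf[h1 h2]]].
  split=> [/andP[/f1 ff /g1 gg]|E]; first by rewrite e1 ff e2 e3 gg e4.
  have m : chi (o + 2) = chi o.
    case ff: (feval w f); first by rewrite -e2 -f1.
    by rewrite e5 h1 ?ff // e6 E.
  have E1 : chi o1 = chi (o1 + 1) by rewrite -e1 e2 m.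
  have E2 : chi o2 = chi (o2 + 1) by rewrite -e3 m e4.
  have E3 : chi o3 = chi (o3 + 1) by rewrite -e5 m e6.
  move=> v /andP[ov vs]; have [v3|v3] := ltnP v o1.
    have [->//|[->|->]] : v = o \/ v = o + 1 \/ v = o + 2; try by [].
    by move: v3; rewrite /o1; clear -ov; lia.
  have [va|va] := ltnP v o2; first by rewrite e1; apply: (f2 E1); rewrite v3.
  have [vb|vb] := ltnP v o3; first by rewrite -m e3; apply: (g2 E2); rewrite va.
  by rewrite -m e5; apply: (h2 E3); rewrite vb /o3 /o2 /o1 -!addnA !addnA -!addnA in vs *.
set o1 := o + 2; set o2 := o1 + gsize f false.
move=> /mono_link[e1 /mono_link[e2 /mono_link[e3 /mono_link[e4]]]].
move=> /mono_cat[/IHf[f1 f2] /IHg[g1 g2]]; split=> [|E].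
  by move/negbT; rewrite negb_and => /orP[/negbTE/f1 ff|/negbTE/g1 gg]; rewrite ?e1 ?ff ?e2 // -e1 e3 gg e4.
have E1 : chi o1 = chi (o1 + 1) by rewrite -e1 e2.
have E2 : chi o2 = chi (o2 + 1) by rewrite -e3 e4.
move=> v /andP[ov vs]; have [v3|v3] := ltnP v o1.
  have [->//|->] : v = o \/ v = o + 1 by move: v3; rewrite /o1; clear -ov; lia.
  by rewrite E.
have [va|va] := ltnP v o2; first by rewrite e1; apply: (f2 E1); rewrite v3.
by rewrite e3; apply: (g2 E2); rewrite va /o2 /o1 -!addnA in vs *.
Qed.

Lemma eq_mono (chi chi' : nat -> bool) w f b o :
  (forall v, o <= v < o + gsize f b -> chi v = chi' v) ->
  mono chi w (gedges f b o) -> mono chi' w (gedges f b o).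
Proof.
move=> cc H e eE le; have [r1 r2 _] := gedges_range eE.
by rewrite -!cc //; apply: H.
Qed.

(** Stated for all terminal colours compatible with the value of [f]: inside a cut gadget a part may
    itself be linked and then needs equal colours. The parts occupy disjoint ranges of vertices, so
    their colourings can be glued. *)
Lemma gadget_cut w f b o (x y : bool) : (feval w f = b -> x = y) ->
  exists chi, [/\ chi o = x, chi (o + 1) = y & mono chi w (gedges f b o)].
Proof.
have o1o p : (p + 1 == p) = false by lia.
elim: f b o x y => [i|c|f IH|f IHf g IHg] b o x y /=.
- move=> xy; exists (fun v => if v == o then x else y); rewrite eqxx o1o; split=> // e.
  by rewrite inE => /eqP->/= /eqP/xy->; case: ifP; case: ifP.
- move=> xy; exists (fun v => if v == o then x else y); rewrite eqxx o1o; split=> //.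
  case: eqP => [/xy->|_ e]; last by rewrite in_nil.
  by apply: mono_linkI => //; case: ifP; case: ifP.
- by move=> xy; apply: IH => fb; apply: xy; rewrite fb negbK.
have sf1 := gsize_ge2 f true; have sf0 := gsize_ge2 f false.
have sg1 := gsize_ge2 g true; have sg0 := gsize_ge2 g false.
case: b => xy.
  set o1 := o + 3; set o2 := o1 + gsize f true; set o3 := o2 + gsize g true.
  (* The midpoint takes the colour of [o] when [f] holds, so that any cut falls on [g], and
     otherwise that of [o + 1], to which the third part then links it. *)
  pose m := if feval w f then x else y.
  have [c1 [c1a c1b c1m]] : exists chi, [/\ chi o1 = x, chi (o1 + 1) = m & mono chi w (gedges f true o1)].
    by apply: IHf => ff; rewrite /m ff.
  have [c2 [c2a c2b c2m]] : exists chi, [/\ chi o2 = m, chi (o2 + 1) = y & mono chi w (gedges g true o2)].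
    by apply: IHg => gg; rewrite /m; case: ifP => // ff; apply: xy; rewrite ff gg.
  have [c3 [c3a c3b c3m]] : exists chi, [/\ chi o3 = m, chi (o3 + 1) = y & mono chi w (gedges f false o3)].
    by apply: IHf => ff; rewrite /m ff.
  pose chi v := if v < o1 then (if v == o then x else if v == o + 1 then y else m)
    else if v < o2 then c1 v else if v < o3 then c2 v else c3 v.
  have L1 v : o1 <= v < o2 -> chi v = c1 v by rewrite /chi => /andP[a ->]; rewrite ltnNge a.
  have L2 v : o2 <= v < o3 -> chi v = c2 v.
    by rewrite /chi => /andP[a ->]; rewrite !ltnNge a (leq_trans (leq_addr _ _) a).
  have L3 v : o3 <= v -> chi v = c3 v.
    move=> a; rewrite /chi !ltnNge a (leq_trans (leq_addr _ _) a).
    by rewrite (leq_trans (leq_addr _ _) (leq_trans (leq_addr _ _) a)).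
  have [p0 p1 p2] : [/\ o < o1, o + 1 < o1 & o + 2 < o1] by rewrite /o1; clear; split; lia.
  have La : chi o = x by rewrite /chi p0 eqxx.
  have Lb : chi (o + 1) = y by rewrite /chi p1 o1o eqxx.
  have Lm : chi (o + 2) = m by rewrite /chi p2 eqn_add2l (_ : (o + 2 == o) = false) //; clear; lia.
  exists chi; split=> //.
  have r1 : o1 <= o1 < o2 /\ o1 <= o1 + 1 < o2.
    by rewrite /o2; clear -sf1 sf0; lia.
  have r2 : o2 <= o2 < o3 /\ o2 <= o2 + 1 < o3.
    by rewrite /o3; clear -sg1; lia.
  apply: mono_linkI; first by rewrite La (L1 _ r1.1).
  apply: mono_linkI; first by rewrite (L1 _ r1.2) Lm.
  apply: mono_linkI; first by rewrite Lm (L2 _ r2.1).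
  apply: mono_linkI; first by rewrite (L2 _ r2.2) Lb.
  apply: mono_linkI; first by rewrite Lm (L3 _ (leqnn _)).
  apply: mono_linkI; first by rewrite (L3 _ (leq_addr _ _)) Lb.
  apply: mono_catI; first by apply: (eq_mono _ c1m) => v /L1->.
  apply: mono_catI; first by apply: (eq_mono _ c2m) => v /L2->.
  by apply: (eq_mono _ c3m) => v /andP[/L3->].
set o1 := o + 2; set o2 := o1 + gsize f false.
have [c1 [c1a c1b c1m]] : exists chi, [/\ chi o1 = x, chi (o1 + 1) = y & mono chi w (gedges f false o1)].
  by apply: IHf => ff; apply: xy; rewrite ff.
have [c2 [c2a c2b c2m]] : exists chi, [/\ chi o2 = x, chi (o2 + 1) = y & mono chi w (gedges g false o2)].
  by apply: IHg => gg; apply: xy; rewrite gg andbF.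
pose chi v := if v < o1 then (if v == o then x else y) else if v < o2 then c1 v else c2 v.
have L1 v : o1 <= v < o2 -> chi v = c1 v by rewrite /chi => /andP[a ->]; rewrite ltnNge a.
have L2 v : o2 <= v -> chi v = c2 v.
  by move=> a; rewrite /chi !ltnNge a (leq_trans (leq_addr _ _) a).
have [p0 p1] : o < o1 /\ o + 1 < o1 by rewrite /o1; clear; split; lia.
have La : chi o = x by rewrite /chi p0 eqxx.
have Lb : chi (o + 1) = y by rewrite /chi p1 o1o.
exists chi; split=> //.
have r1 : o1 <= o1 < o2 /\ o1 <= o1 + 1 < o2.
  by rewrite /o2; clear -sf1 sf0; lia.
apply: mono_linkI; first by rewrite La (L1 _ r1.1).
apply: mono_linkI; first by rewrite (L1 _ r1.2) Lb.
apply: mono_linkI; first by rewrite La (L2 _ (leqnn _)).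
apply: mono_linkI; first by rewrite (L2 _ (leq_addr _ _)) Lb.
apply: mono_catI; first by apply: (eq_mono _ c1m) => v /L1->.
by apply: (eq_mono _ c2m) => v /andP[/L2->].
Qed.

(** * Connectivity of the gadget graph *)

Lemma joinsC u v e : joins u v e = joins v u e.
Proof. by rewrite /joins orbC. Qed.

Lemma undirected_gedges n f b w : undirected n (edge_graph (gedges f b 0) w).
Proof.
move=> i j _ _; split; first by apply: eq_has => e; rewrite joinsC.
apply/negbTE/hasPn => e /gedges_range[_ _ ne]; rewrite negb_and /joins orbb; apply/orP; left.
by apply: contra ne => /andP[/eqP-> /eqP->].
Qed.

Lemma mono_edge chi w E u v : mono chi w E -> edge_graph E w u v -> chi u = chi v.
Proof.
by move=> H /hasP[e eE /andP[/orP[]/andP[/eqP<- /eqP<-] /(H e eE)]].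
Qed.

Lemma connected_gedges f w : connected (gsize f true) (edge_graph (gedges f true 0) w) <-> feval w f.
Proof.
set N := gsize f true; set E := gedges f true 0.
have N1 : 1 < N := gsize_ge2 f true.
split=> [con|ff].
  apply/negPn/negP => nf.
  have [|chi [c0 c1 cm]] := @gadget_cut w f true 0 true false; first by rewrite (negbTE nf).
  have [s [_ [ps [ls _]]]] := con 0 1 (ltnW N1) N1.
  suff : chi (last 0 s) = chi 0 by rewrite ls c0 -[1]add0n c1.
  elim: s (0) ps {ls} => //= v s IH u /andP[uv /IH->].
  by rewrite (mono_edge cm uv).
move=> u v uN vN; pose e : rel 'I_N := fun i j => edge_graph E w i j.
(* The colouring is the set of vertices reachable from [u]. *)
pose chi x := if insub x is Some i then connect e (Ordinal uN) i else false.
have chiE x (xN : x < N) : chi x = connect e (Ordinal uN) (Ordinal xN) by rewrite /chi insubT.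
have cm : mono chi w E.
  move=> d dE ld; have [/andP[_ r1] /andP[_ r2] _] := gedges_range dE; rewrite add0n -/N in r1 r2.
  rewrite !chiE; apply: same_connect_r.
    apply: sym_connect_sym => i j; rewrite /e; apply: eq_has => d'; rewrite joinsC //.
  by apply: connect1; apply/hasP; exists d; rewrite // ld andbT /joins /= !eqxx.
have [l1 l2] := gadget_linked cm.
have all0 x : x < N -> chi x = chi 0 by move=> xN; apply: l2; [exact: l1|].
have : chi v by rewrite all0 // -(all0 u uN) chiE connect0.
rewrite chiE => /connectP[p0 pp0 lp0]; case/shortenP: pp0 lp0 => p pp up _ lp.
exists [seq val i | i <- p]; split; first by apply/allP => _ /mapP[i _ ->]; apply: ltn_ord.
split; first by rewrite -[u]/(val (Ordinal uN)) path_map.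
split; first by rewrite -[u]/(val (Ordinal uN)) last_map -lp.
by rewrite -[u]/(val (Ordinal uN)) -map_cons map_inj_uniq //; apply: val_inj.
Qed.

Theorem theorem5p12 :
  ~ TC0_eq_NC1 ->
  ~ exists G : nat -> GNN,
      (forall n, (0 < n)%N -> gnn_valid n (G n)) /\
      (exists c k : nat, forall n, (g_prec (G n) <= c * n ^ k + c)%N) /\
      (exists M : nat, forall n, (size (g_layers (G n)) <= M)%N) /\
      (exists c : nat, forall n, (g_dim (G n) <= c * n + c)%N) /\
      solves_connectivity G.
Proof.
move=> sep [G [Gv [[a [e Gp]] [[M GM] [[b Gd] Gsol]]]]]; apply: sep => L.
split=> [|/formulas_of_NC1[c Lf]]; first exact: TC0_sub_NC1.
have [k [dd eval]] := tc_gnn M 3.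
(* A formula of depth at most [d = c * trunc_log 2 n + c] gives at most [4 ^ d = 2 ^ (2 * d)]
   vertices. *)
pose S n := 2 ^ ((2 * c) * trunc_log 2 n + 2 * c).
pose z n := S n + (a * S n ^ e + a) + (b * S n + b) + 1.
apply: (@TC0_of_computable L dd (fun n => (z n + 2) ^ k)).
  have pS : poly_bounded S by apply: poly_bounded_exp_log.
  by rewrite /z; poly_bounded_tac.
(* The number [N] of vertices depends on the formula only, so the single network [G N] serves all
   inputs of length [n]. *)
move=> n; have [f fd fL] := Lf n; pose N := gsize f true.
have N0 : 0 < N by apply: ltnW (gsize_ge2 _ _).
have NS : N <= S n.
  apply: leq_trans (gsize_le _ _) _; rewrite -(expnM 2 2) leq_exp2l //.
  by rewrite -mulnA -mulnDr leq_mul2l.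
pose E := gedges f true 0.
have NSe : N ^ e <= S n ^ e by case: (e) => // e'; rewrite leq_exp2r.
apply: eq_computable (eval n (z n) N (G N) E _ _ _ _ _ _ (Gv N N0)) => [w sw||||||].
- have solN := Gsol N N0 _ (@undirected_gedges N f true w).
  rewrite -(fL w sw); apply/idP/idP => [/solN/connected_gedges //|H].
  exact/solN/connected_gedges.
- by rewrite /z; lia.
- by apply: leq_trans (Gp N) _; rewrite /z; nia.
- by apply: leq_trans (Gd N) _; rewrite /z; nia.
- by rewrite /z addn1.
- exact: GM.
- by move=> v; rewrite size_filter; have [] := gedges_deg f true 0 v.
Qed.
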